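(* Let $\mathcal{M}$ be the L-solid translation $3$-manifold and let $\mathbf{v}\in\mathbb{R}^3$ be a Kronecker direction. Then any half-infinite geodesic in $\mathcal{M}$ with direction $\mathbf{v}$ is uniformly distributed in $\mathcal{M}$ unless it hits a singularity.
   Context: A vector $\mathbf{v}=(v_1,v_2,v_3)\in\mathbb{R}^3$ is a Kronecker direction if $v_1,v_2,v_3$ are linearly independent over $\mathbb{Q}$. The L-solid translation $3$-manifold consists of $3$ unit (atomic) cubes arranged in the shape of the letter L: cube $1$ (top) $[0,1]\times[1,2]\times[0,1]$, cube $2$ (middle) $[0,1]\times[0,1]\times[0,1]$ and cube $3$ (right) $[1,2]\times[0,1]\times[0,1]$, glued along common faces, with the remaining boundary faces identified in pairs by perpendicular translation: in the $x$-direction, the left and right faces of cube $1$ are identified, and the left face of cube $2$ is identified with the right face of cube $3$; in the $y$-direction, the bottom face of cube $2$ is identified with the top face of cube $1$, and the bottom and top faces of cube $3$ are identified; in the $z$-direction, the faces $z=0$ and $z=1$ of each cube are identified. Equivalently, it is the product of the L-shaped three-square translation surface with the unit torus $[0,1)$. A geodesic with direction $\mathbf{v}$ is a straight line trajectory of the linear flow in direction $\mathbf{v}$, continued through the face identifications. A singular point is a point of $\mathcal{M}$ lying on a (singular) edge around which the total angle is not $2\pi$; the geodesic is not defined beyond such a point. Let $\mathcal{L}(t)$, $t\ge0$, denote a half-infinite geodesic with arc-length parametrization. It is uniformly distributed if for every continuous function $f$ on $\mathcal{M}$, $$\lim_{T\to\infty}\frac1T\int_0^Tf(\mathcal{L}(t))\,dt=\frac{1}{3}\int_{\mathcal{M}}f\,d\lambda_3,$$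 where $\lambda_3$ is $3$-dimensional Lebesgue measure. *)

(* Defs.v *)
From HB Require Import structures.
From mathcomp Require Import all_boot all_order all_algebra.
From mathcomp Require Import all_classical all_reals all_analysis.
From Stdlib Require Relation_Operators.
Set Implicit Arguments.
Unset Strict Implicit.
Unset Printing Implicit Defensive.
Import Order.TTheory GRing.Theory Num.Theory.
Import numFieldNormedType.Exports.
Local Open Scope classical_set_scope.
Local Open Scope ring_scope.
Local Open Scope quotient_scope.

(* Points and vectors of R^3 are triples ((x, y), z) in R * R * R, so that the
   product topology and the product Lebesgue measure are available on them. *)

Definition euclidean_norm (R : realType) (v : R * R * R) : R :=
  Num.sqrt (v.1.1 ^+ 2 + v.1.2 ^+ 2 + v.2 ^+ 2).

Definition kronecker_direction (R : realType) (v : R * R * R) : Prop :=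
  forall a b c : rat,
    ratr a * v.1.1 + ratr b * v.1.2 + ratr c * v.2 = 0 ->
    [/\ a = 0, b = 0 & c = 0].

(* The corner with least coordinates of the top (0), middle (1) and
   right (2) cube. *)
Definition cube_corner (R : realType) (i : 'I_3) : R * R * R :=
  match val i with
  | 0%N => (0, 1, 0)
  | 1%N => (0, 0, 0)
  | _ => (1, 0, 0)
  end.

Arguments cube_corner R i : clear implicits.

Definition cube (R : realType) (i : 'I_3) : set (R * R * R) :=
  [set p | [/\ (cube_corner R i).1.1 <= p.1.1 <= (cube_corner R i).1.1 + 1,
               (cube_corner R i).1.2 <= p.1.2 <= (cube_corner R i).1.2 + 1 &
               (cube_corner R i).2 <= p.2 <= (cube_corner R i).2 + 1]].

Arguments cube R i : clear implicits.

(* Taking the union inside R^3 already glues the cubes along the two common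
   faces x = 1 (middle, right) and y = 1 (top, middle). *)
Definition L_solid (R : realType) : set (R * R * R) :=
  \bigcup_(i in [set: 'I_3]) cube R i.

Arguments L_solid R : clear implicits.

Inductive face_identification (R : realType) :
    R * R * R -> R * R * R -> Prop :=
| FaceXTop y z : 1 <= y <= 2 -> 0 <= z <= 1 ->
    face_identification (0, y, z) (1, y, z)
| FaceXMiddleRight y z : 0 <= y <= 1 -> 0 <= z <= 1 ->
    face_identification (0, y, z) (2, y, z)
| FaceYMiddleTop x z : 0 <= x <= 1 -> 0 <= z <= 1 ->
    face_identification (x, 0, z) (x, 2, z)
| FaceYRight x z : 1 <= x <= 2 -> 0 <= z <= 1 ->
    face_identification (x, 0, z) (x, 1, z)
| FaceZ x y : L_solid R (x, y, 0) ->
    face_identification (x, y, 0) (x, y, 1).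

(* face_identification only relates points of the solid, so the closure taken
   in R^3 restricts to the one taken in the solid. *)
Definition identified (R : realType) : rel (L_solid R) :=
  fun p q => `[< Relation_Operators.clos_refl_sym_trans _ (@face_identification R)
                   (set_val p) (set_val q) >].

Lemma identified_refl (R : realType) : reflexive (@identified R).
Proof. by move=> p; apply/asboolP; exact: Relation_Operators.rst_refl. Qed.

Lemma identified_sym (R : realType) : symmetric (@identified R).
Proof. by move=> p q; apply/asboolP/asboolP; exact: Relation_Operators.rst_sym. Qed.

Lemma identified_trans (R : realType) : transitive (@identified R).
Proof.
move=> q p r /asboolP pq /asboolP qr; apply/asboolP.
exact: Relation_Operators.rst_trans pq qr.
Qed.

Canonical identified_equiv (R : realType) :=
  EquivRel (@identified R) (@identified_refl R) (@identified_sym R)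
    (@identified_trans R).

Definition L_manifold (R : realType) : topologicalType :=
  quotient_topology {eq_quot (@identified R)}.

Lemma origin_in_L_solid (R : realType) :
  (0, 0, 0) \in L_solid R.
Proof.
apply/mem_set; exists (inord 1) => //.
by rewrite /cube /cube_corner /= inordK //= !add0r lexx ler01.
Qed.

Definition solid_origin (R : realType) : L_solid R :=
  exist _ (0, 0, 0) (origin_in_L_solid R).

(* The quotient map, made total on R^3: only its values on L_solid are
   meaningful, and points outside go to the image of the origin. *)
Definition to_manifold (R : realType) (p : R * R * R) : L_manifold R :=
  \pi_(quotient_topology {eq_quot (@identified R)})
    (insubd (solid_origin R) p).

(* A cube has 12 edges: an axis (0 = x, 1 = y, 2 = z) and the ends of the two
   other coordinate ranges where the edge sits. *)
Definition cube_edge : finType := ('I_3 * 'I_3 * bool * bool)%type.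

Definition edge_point (R : realType) (e : cube_edge) (s : R) : R * R * R :=
  let: (i, axis, a, b) := e in
  cube_corner R i +
  match val axis with
  | 0%N => (s, a%:R, b%:R)
  | 1%N => (a%:R, s, b%:R)
  | _ => (a%:R, b%:R, s)
  end.

(* The identifications are translations, so two cube edges become the same
   edge of the manifold iff their midpoints do. *)
Definition same_edge (R : realType) (e e' : cube_edge) : bool :=
  `[< to_manifold (edge_point e (2^-1 : R)) =
      to_manifold (edge_point e' (2^-1 : R)) >].

Arguments same_edge R e e' : clear implicits.

(* Each cube edge carries a dihedral angle pi/2. *)
Definition total_angle (R : realType) (e : cube_edge) : R :=
  pi / 2 *+ #|same_edge R e|.

Arguments total_angle R e : clear implicits.

Definition singular_point (R : realType) (x : L_manifold R) : Prop :=
  exists e : cube_edge, total_angle R e != 2 * pi /\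
    exists2 s : R, 0 <= s <= 1 & x = to_manifold (edge_point e s).

(* A line segment of the solid, traversed with velocity u, that represents the
   curve g over the time set I and is at p at time t. *)
Definition straight_on (R : realType) (g : R -> L_manifold R) (u p : R * R * R)
    (t : R) (I : set R) : Prop :=
  forall s, I s ->
    L_solid R (p + (s - t) *: u) /\ g s = to_manifold (p + (s - t) *: u).

(* Only the values at times t >= 0 matter.  The segments before and after time
   t may start from different representatives of the point g t: this is the
   continuation through the face identifications.  Away from singular points
   and for a direction transverse to the faces, it is unique. *)
Definition half_infinite_geodesic (R : realType) (v : R * R * R)
    (g : R -> L_manifold R) : Prop :=
  let u := (euclidean_norm v)^-1 *: v in
  (forall t : R, 0 <= t -> exists2 e : R, 0 < e &
     exists p, straight_on g u p t `[t, t + e]) /\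
  (forall t : R, 0 < t -> exists2 e : R, 0 < e &
     exists p, straight_on g u p t `[t - e, t]).

Definition hits_singularity (R : realType) (g : R -> L_manifold R) : Prop :=
  exists2 t : R, 0 <= t & singular_point (g t).

Definition lebesgue3 (R : realType) :=
  ((@lebesgue_measure R \x @lebesgue_measure R) \x @lebesgue_measure R)%E.

(* The faces have measure zero, so the integral over the manifold is the
   integral over the solid of the pulled-back function. *)
Definition manifold_integral (R : realType) (f : L_manifold R -> R) : R :=
  \int[@lebesgue3 R]_(p in L_solid R) f (to_manifold p).

Definition uniformly_distributed (R : realType) (g : R -> L_manifold R) : Prop :=
  forall f : L_manifold R -> R, continuous f ->
    T^-1 * \int[@lebesgue_measure R]_(t in `[0, T]) f (g t) @[T --> +oo]
      --> 3^-1 * manifold_integral f.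

(* Main.v *)
Require Import Defs.
From mathcomp Require Import all_boot all_order all_algebra.
From mathcomp Require Import all_classical all_reals all_analysis.
From mathcomp Require Import ring lra zify.

(** Number the three cubes of the solid by Z/3: top 0, middle 1, right -1, and
call this number the sheet of a point.  Crossing a face x = integer negates the
sheet, and crossing a face y = integer maps the sheet i to 1 - i.  A point of the
manifold off the vertical edges is thus a point of the torus R^3 / Z^3 with a
sheet, and a geodesic is a straight line of the torus with a sheet that changes
at the face crossings.  The vertical edges are singular, of total angle 6 pi, so
the geodesic avoids them and never crosses two such faces at once.

Cut the geodesic at its crossings of the levels y = integer, and let x_k be the
value of x, unrolled in R^3, at the k-th of them; x_k = xi + k alpha.  In between,
c_k = (-1)^(floor x) * sheet is constant, and at a crossing the rule i -> 1 - i
gives c_(k+1) = (-1)^(floor x_(k+1)) - c_k ([geodesic_coding]).  So sampling a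
continuous function f at a fixed phase of each period produces a sequence
F (c_k, x_k, z_k) along a skew product with fibre Z/3 over the rotation by
(alpha, beta), where alpha, beta and 1 are independent over the rationals.  Its
Cesaro averages are found by splitting F into the mean over the three sheets and a
remainder whose sum over the sheets is 0 ([phase_average]).

The mean over the sheets is a function on the two-dimensional torus.  By
Kronecker's theorem ([kronecker_density]) each translation of the torus is
approximated by a time shift, so Cesaro averages do not see translations and agree
with the averages over fine grids ([weyl_grid_avg]).

The remainder averages to 0 along every orbit, not only along almost every one;
this is [skew_cesaro], the heart of the proof.  If it failed, some Banach limit L
would give the values along the orbit a mean m <> 0.  Let the skew product act by
an operator S on functions A (k, i) of time and sheet.  Along the orbit S is the
time shift, which L ignores, so every convex combination A of the functions
S^s A_0, where A_0 is the remainder, has mean m along the orbit; hence its energy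
L (sum_i A (k, i)^2) is at least m^2.  By the parallelogram law a function A of
almost minimal energy satisfies S^s A = A up to a small error, uniformly in s
([near_invariant_element]).  Moreover A inherits almost periodicity from A_0: A
(k + r, i) is close to A (k, i), in mean over k, when r alpha is close to an even
integer and r beta to an integer.  Compare now s steps of the skew product
started at times k and k + r.  The two fibre maps differ by a translation of Z/3.
If it is not 0, then A (k, i) is close to a translate of itself in i, which for a
function with sum 0 forces A (k, i) to be small ([energy_where_sheets_differ]).
With eps = r alpha mod 2, the two fibre maps keep agreeing, or keep differing, until
x_(k+s) lies at distance at most eps below an integer, and they do not agree both
before and after such a visit.  For eps in a suitable interval given by consecutive
best approximations of alpha by rationals, these visits are neither too close nor
too far apart ([exists_well_spaced_hits]), and for each k the fibre maps differ for
at least one seventh of the times s in some range ([sheets_differ_often]).  So the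
energy of A is smaller than m^2, which is absurd.

It remains to pass from samples to integrals.  The time average is close to the
mean of the Cesaro averages at equally spaced phases ([time_average]), each phase
is a height y in the cubes, and the sum over phases of the averages over horizontal
grids is a Riemann sum of the volume integral ([slices_integral]). *)

Set Implicit Arguments.
Unset Strict Implicit.
Unset Printing Implicit Defensive.
Import Order.TTheory GRing.Theory Num.Theory.
Import numFieldNormedType.Exports.
Local Open Scope classical_set_scope.
Local Open Scope ring_scope.

(** * Cesaro averages and Banach limits *)

Section Means.
Context {R : realType}.
Implicit Types a b : nat -> R.

Definition bseq a := exists B, forall k, `|a k| <= B.

Lemma bseqP a : bseq a -> exists2 B, 0 <= B & forall k, `|a k| <= B.
Proof.
by move=> [B aB]; exists B => //; exact: le_trans (aB 0%N).
Qed.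

Lemma bseq_cst (c : R) : bseq (fun=> c).
Proof. by exists `|c|. Qed.

Lemma bseqD a b : bseq a -> bseq b -> bseq (fun k => a k + b k).
Proof.
move=> [A aA] [B bB]; exists (A + B) => k.
exact: le_trans (ler_normD _ _) (lerD _ _).
Qed.

Lemma bseqM a b : bseq a -> bseq b -> bseq (fun k => a k * b k).
Proof.
move=> [A aA] [B bB]; exists (A * B) => k.
by rewrite normrM ler_pM.
Qed.

Lemma bseqZ (c : R) a : bseq a -> bseq (fun k => c * a k).
Proof. by move=> ba; apply: bseqM => //; exact: bseq_cst. Qed.

Lemma bseqB a b : bseq a -> bseq b -> bseq (fun k => a k - b k).
Proof.
move=> [A aA] [B bB]; exists (A + B) => k.
exact: le_trans (ler_normB _ _) (lerD _ _).
Qed.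

Lemma bseqX n a : bseq a -> bseq (fun k => a k ^+ n).
Proof.
move=> [A aA]; exists (A ^+ n) => k.
by rewrite normrX lerXn2r ?nnegrE ?(le_trans _ (aA k)).
Qed.

Lemma bseq_shift a n : bseq a -> bseq (fun k => a (k + n)%N).
Proof. by move=> [A aA]; exists A => k. Qed.

Lemma bseq_sum (I : Type) (r : seq I) (P : pred I) (f : I -> nat -> R) :
  (forall i, bseq (f i)) -> bseq (fun k => \sum_(i <- r | P i) f i k).
Proof.
move=> bf; elim: r => [|i r IH].
  by under eq_fun do rewrite big_nil; exact: bseq_cst.
under eq_fun do rewrite big_cons; case: (P i) => //.
exact: bseqD.
Qed.

Definition cesaro a (n : nat) : R := n%:R^-1 * \sum_(k < n) a k.

Lemma cesaroD a b n : cesaro (fun k => a k + b k) n = cesaro a n + cesaro b n.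
Proof. by rewrite /cesaro big_split mulrDr. Qed.

Lemma cesaroB a b n : cesaro (fun k => a k - b k) n = cesaro a n - cesaro b n.
Proof. by rewrite /cesaro sumrB mulrBr. Qed.

Lemma cesaroZ (c : R) a n : cesaro (fun k => c * a k) n = c * cesaro a n.
Proof. by rewrite /cesaro -mulr_sumr mulrCA. Qed.

Lemma cesaro_cst (c : R) n : cesaro (fun=> c) n.+1 = c.
Proof. by rewrite /cesaro sumr_const card_ord -[c *+ _]mulr_natl mulKf. Qed.

Lemma le_cesaro a b n : (forall k, a k <= b k) -> cesaro a n <= cesaro b n.
Proof. by move=> ab; rewrite ler_wpM2l ?invr_ge0 ?ler0n//; apply: ler_sum. Qed.

Lemma cesaro_bound a (B : R) n : 0 <= B -> (forall k, `|a k| <= B) ->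
  `|cesaro a n| <= B.
Proof.
move=> B0 aB; case: n => [|n]; first by rewrite /cesaro big_ord0 mulr0 normr0.
rewrite ler_norml -{2}(cesaro_cst B n) le_cesaro ?andbT => [|k]; last first.
  exact: le_trans (ler_norm _) (aB k).
rewrite -(cesaro_cst (- B) n) le_cesaro// => k.
by have := aB k; rewrite ler_norml => /andP[].
Qed.

Lemma cesaro_shift1 a n :
  cesaro (fun k => a k.+1) n - cesaro a n = n%:R^-1 * (a n - a 0%N).
Proof.
rewrite /cesaro -mulrBr; congr (_ * _); rewrite -sumrB.
elim: n => [|n IH]; first by rewrite big_ord0 subrr.
by rewrite big_ord_recr /= IH addrC subrKA.
Qed.

Lemma cvg_invn_mul (c : R) : (n%:R^-1 * c @[n --> \oo] --> (0 : R)).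
Proof.
have h : (n%:R^-1 @[n --> \oo] --> (0 : R)).
  rewrite -(cvg_shiftS (fun n : nat => n%:R^-1 : R)).
  exact: cvg_harmonic.
rewrite -[X in _ --> X](mul0r c); apply: cvgM; first exact: h.
exact: cvg_cst.
Qed.

Lemma cesaro_shift1_cvg a : bseq a ->
  cesaro (fun k => a k.+1) n - cesaro a n @[n --> \oo] --> (0 : R).
Proof.
move=> /bseqP[B B0 aB]; apply/norm_cvg0P.
apply: (@squeeze_cvgr _ _ _ _ (fun=> 0) (fun n : nat => n%:R^-1 * (B + B))).
- near=> n; rewrite normr_ge0/= cesaro_shift1 normrM ger0_norm ?invr_ge0//.
  rewrite ler_wpM2l ?invr_ge0//.
  exact: le_trans (ler_normB _ _) (lerD (aB _) (aB _)).
- exact: cvg_cst.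
- exact: cvg_invn_mul.
Unshelve. all: by end_near. Qed.

Lemma cesaro_shift_cvg a r : bseq a ->
  cesaro (fun k => a (k + r)%N) n - cesaro a n @[n --> \oo] --> (0 : R).
Proof.
move=> ba; elim: r => [|r IH].
  under eq_fun => n.
    rewrite (_ : (fun k => a _) = a) ?subrr; last by apply/funext => k; rewrite addn0.
    over.
  exact: cvg_cst.
have h : forall n, cesaro (fun k => a (k + r.+1)%N) n - cesaro a n =
    (cesaro (fun k => a (k.+1 + r)%N) n - cesaro (fun k => a (k + r)%N) n) +
    (cesaro (fun k => a (k + r)%N) n - cesaro a n).
  move=> n; rewrite addrA subrK; congr (cesaro _ _ - _).
  by apply/funext => k; rewrite addSnnS.
under eq_fun do rewrite h.
have := cvgD (cesaro_shift1_cvg (bseq_shift r ba)) IH; rewrite addr0; exact.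
Qed.

(** Banach limits; they are total functions whose laws concern bounded sequences
only. *)
Record invariant_mean (L : (nat -> R) -> R) : Prop := InvariantMean {
  meanD : forall a b, bseq a -> bseq b -> L (fun k => a k + b k) = L a + L b ;
  meanZ : forall c a, bseq a -> L (fun k => c * a k) = c * L a ;
  mean_ge0 : forall a, bseq a -> (forall k, 0 <= a k) -> 0 <= L a ;
  mean_shift1 : forall a, bseq a -> L (fun k => a k.+1) = L a ;
  mean_cst : forall c, L (fun=> c) = c }.

(** The averages stay in a segment, which is compact. *)
Lemma cesaro_cvg_ultra (U : set_system nat) a : UltraFilter U -> bseq a ->
  cvg (cesaro a n @[n --> U]).
Proof.
move=> UU /bseqP[B B0 aB].
have /compact_near_coveringP _ := @segment_compact R (- B) B.
have := @segment_compact R (- B) B.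
have FU : ProperFilter (cesaro a n @[n --> U]) by apply: fmap_proper_filter.
move=> /(_ _ FU) [].
  apply: (@filterS _ U _ setT _ _ filterT) => n _ /=.
  by rewrite in_itv/= -ler_norml; exact: cesaro_bound.
move=> p [_ clp]; apply/cvg_ex; exists p => V pV.
have [//|nV] := in_ultra_setVsetC (cesaro a @^-1` V) UU.
have [] := clp (~` V) V nV pV.
by move=> x [].
Qed.

(** Take the limit of the averages along an ultrafilter containing the times at
which the averages of the given sequence stay away from 0.  It is shift invariant
because a shift changes the n-th average by O(1/n). *)
Lemma exists_invariant_mean a : bseq a ->
  ~ (cesaro a n @[n --> \oo] --> (0 : R)) ->
  exists2 L, invariant_mean L & L a <> 0.
Proof.
move=> ba ncv.
have [e e0 He] : exists2 e : R, 0 < e &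
    forall N, exists2 n, (N <= n)%N & e <= `|cesaro a n|.
  apply: contrapT => H; apply: ncv; apply/cvgrPdist_lt => e e0.
  apply: contrapT => H2; apply: H; exists e => // N.
  apply: contrapT => H3; apply: H2; exists N => // n /= Nn.
  rewrite sub0r normrN ltNge; apply/negP => ene.
  by apply: H3; exists n.
pose F := within [set n | e <= `|cesaro a n|] (\oo : set_system nat).
have FF : ProperFilter F.
  split; last exact: within_filter.
  move=> [N _ HN]; have [n Nn en] := He N.
  exact: (HN n).
have [U [UU FU]] := ultraFilterLemma FF.
have cvU b : bseq b -> cvg (cesaro b n @[n --> U]) by exact: cesaro_cvg_ultra.
have ooU : \oo `<=` U.
  by move=> A AA; apply: FU; apply: filterS AA => n An _.
have UP : ProperFilter U by exact: ultra_proper.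
have ev0 b c : (cesaro b n @[n --> \oo] --> c) -> lim (cesaro b n @[n --> U]) = c.
  move=> H; apply: cvg_lim => //; apply: cvg_trans H.
  by move=> A /= HA; exact: ooU.
exists (fun b => lim (cesaro b n @[n --> U])); first split.
- move=> b c /cvU cb /cvU cc; apply: cvg_lim => //.
  under eq_fun do rewrite cesaroD.
  exact: cvgD.
- move=> c b /cvU cb; apply: cvg_lim => //.
  under eq_fun do rewrite cesaroZ.
  exact: cvgZr.
- move=> b bb b0; apply: limr_ge; first exact: cvU.
  apply: filterE => n; rewrite mulr_ge0 ?invr_ge0//.
  by apply: sumr_ge0.
- move=> b bb; apply: cvg_lim => //.
  have -> : lim (cesaro b n @[n --> U]) = 0 + lim (cesaro b n @[n --> U]).
    by rewrite add0r.
  have h : cesaro (fun k => b k.+1) n - cesaro b n @[n --> U] --> (0 : R).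
    by move=> A /(cesaro_shift1_cvg bb) /= HA; exact: ooU.
  have -> : cesaro (fun k => b k.+1) = fun n =>
      (cesaro (fun k => b k.+1) n - cesaro b n) + cesaro b n.
    by apply/funext => n; rewrite subrK.
  by apply: cvgD; [exact: h|exact: cvU].
- move=> c; apply: ev0.
  apply: cvg_near_cst; exists 1%N => // -[|n] // _; exact: cesaro_cst.
- move=> L0.
  have : lim (`|cesaro a n| @[n --> U]) = 0.
    rewrite -[RHS](@normr0 _ R) -L0; apply: cvg_lim => //.
    by apply: cvg_norm; exact: cvU.
  move=> h0; have : e <= lim (`|cesaro a n| @[n --> U]).
    apply: limr_ge; first by apply: is_cvg_norm; exact: cvU.
    by apply: FU; exists 0%N.
  by rewrite h0 leNgt e0.
Qed.

End Means.

Section MeanTheory.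
Context {R : realType}.
Variable L : (nat -> R) -> R.
Hypothesis HL : invariant_mean L.
Implicit Types u v : nat -> R.

Lemma meanN1 u : bseq u -> L (fun k => - u k) = - L u.
Proof.
move=> bu; rewrite -mulN1r -(meanZ HL)//; congr L; apply/funext => k.
by rewrite mulN1r.
Qed.

Lemma meanB u v : bseq u -> bseq v -> L (fun k => u k - v k) = L u - L v.
Proof.
move=> bu bv; rewrite (meanD HL)// ?meanN1//.
have := bseqZ (-1) bv; congr bseq; apply/funext => k; exact: mulN1r.
Qed.

Lemma le_mean u v : bseq u -> bseq v -> (forall k, u k <= v k) -> L u <= L v.
Proof.
move=> bu bv uv; rewrite -subr_ge0 -meanB// (mean_ge0 HL)//; first exact: bseqB.
by move=> k; rewrite subr_ge0.
Qed.

Lemma mean_shift u n : bseq u -> L (fun k => u (k + n)%N) = L u.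
Proof.
move=> bu; elim: n => [|n IH].
  by congr L; apply/funext => k; rewrite addn0.
rewrite -IH -(mean_shift1 HL (bseq_shift n bu)); congr L; apply/funext => k.
by rewrite addSnnS.
Qed.

Lemma mean_sum (I : Type) (r : seq I) (P : pred I) (f : I -> nat -> R) :
  (forall i, bseq (f i)) ->
  L (fun k => \sum_(i <- r | P i) f i k) = \sum_(i <- r | P i) L (f i).
Proof.
move=> bf; elim: r => [|i r IH].
  by rewrite big_nil -[RHS](mean_cst HL); congr L; apply/funext => k; rewrite big_nil.
rewrite big_cons -IH; case: ifP => Pi.
  rewrite -(meanD HL)//; last exact: bseq_sum.
  by congr L; apply/funext => k; rewrite big_cons Pi.
by congr L; apply/funext => k; rewrite big_cons Pi.
Qed.
End MeanTheory.

(** * Visits of an irrational rotation to a short interval *)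

Section Rotation.
Context {R : realType}.
Variable a : R.

Definition nearZ (x e : R) := exists l : int, `|x - l%:~R| < e.

(** An interval of length w that ends at an integer, modulo 1: the integer part
changes between x and x + w exactly when x lies in it, for w < 1. *)
Definition hit (w x : R) := exists l : int, - w <= x - l%:~R < 0.

Hypothesis a_irr : forall (j : nat) (l : int), (0 < j)%N -> j%:R * a != l%:~R.
Hypothesis a_dense : forall p e : R, 0 < e ->
  exists2 r : nat, (0 < r)%N & nearZ (r%:R * a - p) e.

Lemma int_norm_lt1 (n : int) : `|n%:~R| < 1 :> R -> n = 0.
Proof.
by rewrite -intr_norm (_ : 1 = 1%:~R)// ltr_int; lia.
Qed.

Lemma opposite_signs (d d' : R) :
  0 < `|d'| < `|d| -> `|d| <= `|d' - d| -> d * d' < 0.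
Proof.
have [d1|d1] := ltP 0 d; have [d2|d2] := ltP 0 d'.
- rewrite (gtr0_norm d1) (gtr0_norm d2) => /andP[_ h].
  by rewrite ltr0_norm; lra.
- rewrite (ler0_norm d2) (gtr0_norm d1) pmulr_rlt0// => /andP[? _] _; lra.
- rewrite (ler0_norm d1) (gtr0_norm d2) mulrC pmulr_rlt0// => /andP[? ?] _; lra.
- rewrite (ler0_norm d1) (ler0_norm d2) => /andP[? h].
  by rewrite gtr0_norm; lra.
Qed.

(** Two consecutive records q < q' in the approximation of the integers by
multiples of a.  They come from opposite sides: if d and d' had the same sign, the
multiple q' - q < q' would be closer to an integer than q. *)
Lemma consecutive_best_approximations tol : 0 < tol ->
  exists q q' : nat, exists p p' : int,
    let d := q%:R * a - p%:~R in let d' := q'%:R * a - p'%:~R in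
    [/\ (0 < q < q')%N, `|d| < tol, 0 < `|d'| < `|d|, d * d' < 0 &
      forall j : nat, (0 < j < q')%N -> forall l : int, `|d| <= `|j%:R * a - l%:~R|].
Proof.
move=> tol_gt0; wlog tol2 : tol tol_gt0 / tol <= 2^-1.
  move=> /(_ (Num.min tol 2^-1)) []; rewrite ?lt_min ?tol_gt0 ?ge_min ?lexx ?orbT ?invr_gt0 ?ltr0n//.
  move=> q [q' [p [p' [? dt ? ? ?]]]]; exists q, q', p, p'; split => //.
  by move: dt; rewrite lt_min => /andP[].
have tol0 := tol_gt0.
have exq t : 0 < t -> exists q : nat, (0 < q)%N && `[< nearZ (q%:R * a) t >].
  move=> t0; have [q q0 qt] := a_dense 0 t0.
  by exists q; rewrite q0; apply/asboolP; rewrite subr0 in qt.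
pose q := ex_minn (exq _ tol0).
have [q0 [p pt] qmin] : [/\ (0 < q)%N, nearZ (q%:R * a) tol &
    forall j, (0 < j)%N -> nearZ (j%:R * a) tol -> (q <= j)%N].
  rewrite /q; case: ex_minnP => m /andP[m0 /asboolP mt] mm; split => // j j0 jt.
  by apply: mm; rewrite j0; apply/asboolP.
set d := q%:R * a - p%:~R in pt.
have d0 : 0 < `|d| by rewrite normr_gt0 subr_eq0 a_irr.
pose q' := ex_minn (exq _ d0).
have [q'0 [p' pt'] qmin'] : [/\ (0 < q')%N, nearZ (q'%:R * a) `|d| &
    forall j, (0 < j)%N -> nearZ (j%:R * a) `|d| -> (q' <= j)%N].
  rewrite /q'; case: ex_minnP => m /andP[m0 /asboolP mt] mm; split => // j j0 jt.
  by apply: mm; rewrite j0; apply/asboolP.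
set d' := q'%:R * a - p'%:~R in pt'.
have d'0 : d' != 0 by rewrite subr_eq0 a_irr.
have low j : (0 < j < q')%N -> forall l : int, `|d| <= `|j%:R * a - l%:~R|.
  move=> /andP[j0 jq'] l; rewrite leNgt; apply/negP => lt.
  by have := qmin' j j0; rewrite leqNgt jq' => /(_ _)/notF; apply; exists l.
have qq' : (q < q')%N.
  rewrite ltn_neqAle qmin ?andbT//; last first.
    by exists p'; exact: lt_trans pt' pt.
  apply/eqP => eqq.
  have : q'%:R * a - p'%:~R - (q%:R * a - p%:~R) = (p - p')%:~R.
    by rewrite eqq intrB; ring.
  rewrite -/d -/d' => e1.
  have pp' : p - p' = 0.
    apply: int_norm_lt1; rewrite -e1.
    by apply: le_lt_trans (ler_normB _ _) _; lra.
  by move: e1; rewrite pp' => /eqP; rewrite subr_eq0 => /eqP dd; rewrite dd ltxx in pt'.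
exists q, q', p, p'; split => //.
- by rewrite q0.
- by rewrite normr_gt0 d'0.
- have h := low (q' - q)%N _ (p' - p).
  have {}h : `|d| <= `|d' - d|.
    have -> : d' - d = (q' - q)%:R * a - (p' - p)%:~R.
      by rewrite /d /d' natrB ?(ltnW qq')// intrB; ring.
    by apply: h; lia.
  by apply: opposite_signs => //; rewrite normr_gt0 d'0 pt'.
Qed.

(** Two hits j steps apart bring j * a closer to an integer than eps. *)
Lemma rotation_hit_spacing q' (p : R) (eps x : R) (j : nat) :
  (forall j : nat, (0 < j < q')%N -> forall l : int, p <= `|j%:R * a - l%:~R|) ->
  0 < eps <= p -> (0 < j < q')%N -> hit eps x -> ~ hit eps (x + j%:R * a).
Proof.
move=> low /andP[e0 ep] jq' [l /andP[l1 l2]] [l' /andP[l1' l2']].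
have := low j jq' (l' - l); rewrite leNgt => /negP; apply.
by rewrite intrB ltr_norml; apply/andP; split; lra.
Qed.

(** Here q is the later one of two consecutive records q0 < q with signed errors d
and d', and eps ranges between max (|d| - |d'|, |d'|) and |d|.  No j < q brings
j * a as close to an integer as eps, whence the spacing.  A first hit after 3 * q
steps or more is impossible because going back by q, q0 + q or q0 + 2 * q steps
would lead to an earlier hit. *)
Lemma exists_well_spaced_hits tol : 0 < tol ->
  exists q : nat, exists lo hi : R, [/\ (0 < q)%N, 0 <= lo < hi, hi <= tol &
    forall eps, lo < eps < hi ->
      (forall x j, (0 < j < q)%N -> hit eps x -> ~ hit eps (x + j%:R * a)) /\
      (forall x, exists2 s : nat, (s < 3 * q)%N & hit eps (x + s%:R * a))].
Proof.
move=> /consecutive_best_approximations[q [q' [p [p']]]].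
set d := q%:R * a - _; set d' := q'%:R * a - _.
move=> [/andP[q0 qq'] dtol /andP[d'0 d'd] dd' low].
exists q', (Num.max (`|d| - `|d'|) `|d'|), `|d|; split => //.
- exact: leq_trans qq'.
- by rewrite gt_max le_max d'd (ltW d'0) orbT; lra.
- exact: ltW.
move=> eps /andP[]; rewrite gt_max => /andP[lo1 lo2] hi.
have e0 : 0 < eps by lra.
split; first by move=> x j; apply: rotation_hit_spacing low _; rewrite e0 ltW.
move=> x.
have exs : exists s : nat, `[< hit eps (x + s%:R * a) >].
  have [|r _ [l hl]] := a_dense (- x - eps / 2) (_ : 0 < eps / 2); first by lra.
  exists r; apply/asboolP; exists l; move: hl; rewrite ltr_norml => /andP[h1 h2].
  by apply/andP; split; lra.
case: (ex_minnP exs) => s /asboolP[l /andP[l1 l2]] smin.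
exists s; last by exists l; rewrite l1.
rewrite ltnNge; apply/negP => s3.
have back (m : nat) : (0 < m <= s)%N -> forall k : int,
    ~~ (- eps <= x + s%:R * a - l%:~R - (m%:R * a - k%:~R) < 0).
  move=> /andP[m0 ms] k; apply/negP => h.
  have : (s <= s - m)%N; last by move: m0 ms; clear; lia.
  apply: smin; apply/asboolP; exists (l - k).
  rewrite natrB// intrB (_ : _ - _ = x + s%:R * a - l%:~R - (m%:R * a - k%:~R))//.
  by ring.
set y := x + s%:R * a - l%:~R in l1 l2 back.
(* Going back by d', d + d' or d + 2 d' cannot leave the window in all cases. *)
have b1 := back q' ltac:(clear -q0 qq' s3; lia) p'.
have b2 := back (q + q')%N ltac:(clear -q0 qq' s3; lia) (p + p').
have b3 := back (q + (q' + q'))%N ltac:(clear -q0 qq' s3; lia) (p + (p' + p')).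
have e1 : q'%:R * a - p'%:~R = d' by [].
have e2 : (q + q')%:R * a - (p + p')%:~R = d + d' by rewrite /d /d' natrD intrD; ring.
have e3 : (q + (q' + q'))%:R * a - (p + (p' + p'))%:~R = d + 2 * d'.
  by rewrite /d /d' !natrD !intrD; ring.
rewrite e1 in b1; rewrite e2 in b2; rewrite e3 in b3.
move: dd' d'0 d'd lo1 lo2 hi b1 b2 b3 {e1 e2 e3 low back dtol}.
clearbody d d' y.
have [d1|d1] := ltP 0 d; have [d2|d2] := ltP 0 d';
  rewrite ?(gtr0_norm d1) ?(gtr0_norm d2) ?(ler0_norm d1) ?(ler0_norm d2) => dd'.
- by move: (mulr_gt0 d1 d2); rewrite (lt_gtF dd').
- move=> ? ? ? ? ?; rewrite !negb_and -!leNgt -!ltNge => b1 b2 b3.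
  by move: b1 b2 b3 => /orP[?|?] /orP[?|?] /orP[?|?]; lra.
- move=> ? ? ? ? ?; rewrite !negb_and -!leNgt -!ltNge => b1 b2 b3.
  by move: b1 b2 b3 => /orP[?|?] /orP[?|?] /orP[?|?]; lra.
- by move: (mulr_le0 d1 d2); rewrite leNgt dd'.
Qed.

Lemma exists_gap_below_returns (m : nat) : exists2 e : R, 0 < e &
  forall j : nat, (0 < j <= m)%N -> forall l : int, e <= `|j%:R * a - l%:~R|.
Proof.
elim: m => [|m [e e0 IH]]; first by exists 1 => // j; lia.
set x := m.+1%:R * a.
have xl : (Num.floor x)%:~R < x by rewrite lt_neqAle floor_le eq_sym a_irr.
have xr := floorD1_gt x; rewrite intrD in xr.
exists (Num.min e (Num.min (x - (Num.floor x)%:~R) ((Num.floor x)%:~R + 1 - x))).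
  by rewrite !lt_min e0; apply/andP; split => //; lra.
move=> j /andP[j0]; rewrite leq_eqVlt => /orP[/eqP -> l|jm l]; last first.
  by rewrite ge_min IH// j0.
rewrite !ge_min -/x; apply/orP; right; apply/orP.
have [lf|fl] := leP l (Num.floor x).
  left; rewrite ger0_norm ?lerB// ?ler_int// subr_ge0.
  by rewrite (le_trans _ (ltW xl))// ler_int.
right; have h : (Num.floor x)%:~R + 1 <= l%:~R :> R.
  by rewrite -[1]/(1%:~R) -intrD ler_int lezD1.
by rewrite ler0_norm; lra.
Qed.

End Rotation.

(** The state z changes only at the hits h, and a hit that finds it off turns it
on.  So it is on after the first hit, or else after the second one, and it then
persists until the next hit, for q steps at least. *)
Lemma sum_after_hits (h z : nat -> bool) (q : nat) : (0 < q)%N ->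
  (forall s, ~~ h s -> z s.+1 = z s) ->
  (forall s, h s -> ~~ z s -> z s.+1) ->
  (forall s j, (0 < j < q)%N -> h s -> ~~ h (s + j)%N) ->
  (forall s, exists2 j, (j < 3 * q)%N & h (s + j)%N) ->
  (q <= \sum_(s < 7 * q) z s)%N.
Proof.
move=> q0 zoff zon hs hg.
have [s [s6 hs0 zs]] : exists s, [/\ (s < 6 * q)%N, h s & z s.+1].
  have [s1 s13 hs1] := hg 0%N; rewrite add0n in hs1.
  have [z1|z1] := boolP (z s1.+1); first by exists s1; split => //; lia.
  have : exists j, h (s1.+1 + j)%N by have [j _ ?] := hg s1.+1; exists j.
  move=> ex2; case: (ex_minnP ex2) => j hj jmin.
  have j3 : (j < 3 * q)%N.
    by have [j' j'3 /jmin ?] := hg s1.+1; lia.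
  exists (s1.+1 + j)%N; split => //; first by lia.
  apply: zon => //; elim: j {hj j3} jmin => [|j IH] jmin; first by rewrite addn0.
  rewrite addnS zoff ?IH//.
  - by move=> n /jmin; lia.
  - by apply/negP => /jmin; rewrite ltnn.
have zq i : (i < q)%N -> z (s.+1 + i)%N.
  elim: i => [|i IH] iq; first by rewrite addn0.
  rewrite addnS zoff; first by rewrite IH// ltnW.
  by rewrite addSnnS hs// iq.
have le1 : (s.+1 <= 7 * q)%N by clear -s6 q0; lia.
have le2 : (s.+1 + q <= 7 * q)%N by clear -s6 q0; lia.
rewrite -(big_mkord xpredT (fun i => nat_of_bool (z i))).
rewrite (big_cat_nat (leq0n _) le1) (big_cat_nat (leq_addr q s.+1) le2) /=.
apply: leq_trans (leq_addl _ _); apply: leq_trans (leq_addr _ _).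
rewrite -{1}[s.+1]add0n big_addn addKn big_mkord.
rewrite (eq_bigr (fun=> 1%N)) ?sum1_card ?card_ord// => i _.
by rewrite addnC zq.
Qed.

(** * Signs and the group of sheets *)

Section Sign.
Context {R : realType}.

(** The sign (-1)^(floor x), in Z/3 because it multiplies sheets. *)
Definition psgn (x : R) : 'Z_3 := if odd `|Num.floor x|%N then -1 else 1.

Lemma odd_absz_add (m n : int) : odd (absz (m + n)%R) = odd `|m|%N (+) odd `|n|%N.
Proof. lia. Qed.

Lemma psgnDz x (m : int) : psgn (x + m%:~R) = if odd `|m|%N then - psgn x else psgn x.
Proof.
rewrite /psgn floorDrz ?intr_int// intrKfloor odd_absz_add.
by case: (odd _); case: (odd _) => //=; rewrite opprK.
Qed.

Lemma hit_psgn w x : 0 < w < 1 ->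
  psgn (x + w) = if `[< hit w x >] then - psgn x else psgn x.
Proof.
move=> /andP[w0 w1]; case: asboolP => [[l /andP[l1 l2]]|nh].
  have f1 : Num.floor x = l - 1 by apply: floor_def; rewrite intrB subrK; apply/andP; split; lra.
  have f2 : Num.floor (x + w) = l by apply: floor_def; rewrite intrD; apply/andP; split; lra.
  have -> : psgn x = psgn ((l - 1)%:~R) by rewrite /psgn f1 intrKfloor.
  have -> : psgn (x + w) = psgn (l%:~R) by rewrite /psgn f2 intrKfloor.
  have -> : l%:~R = (l - 1)%:~R + 1%:~R :> R by rewrite -intrD subrK.
  by rewrite psgnDz.
have -> // : Num.floor (x + w) = Num.floor x -> psgn (x + w) = psgn x.
  by rewrite /psgn => ->.
have := floor_le x; have := floorD1_gt x; rewrite intrD => h1 h2.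
apply: floor_def; rewrite intrD; apply/andP; split; first by lra.
rewrite ltNge; apply/negP => h; apply: nh; exists (Num.floor x + 1).
by rewrite intrD; apply/andP; split; lra.
Qed.

Lemma psgn_neq0 x : psgn x != 0.
Proof. by rewrite /psgn; case: ifP. Qed.

Lemma psgn_neq_nearZ x y (M : int) d : `|y - x - (2 * M)%:~R| < d -> psgn y != psgn x -> nearZ x d.
Proof.
set e := y - x - (2 * M)%:~R => ed ne.
have ye : y = x + e + (2 * M)%:~R by rewrite /e; ring.
have py : psgn y = psgn (x + e) by rewrite ye psgnDz; case: ifP => //; lia.
have fne : Num.floor (x + e) != Num.floor x.
  by apply: contra_neq ne => fe; rewrite py /psgn fe.
have hx1 := floor_le x; have hx2 := floorD1_gt x.
have hy1 := floor_le (x + e); have hy2 := floorD1_gt (x + e).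
move: ed; rewrite ltr_norml => /andP[ed1 ed2].
have := fne; rewrite neq_lt => /orP[lt|gt].
  exists (Num.floor x); have : Num.floor (x + e) + 1 <= Num.floor x by rewrite lezD1.
  by rewrite -(ler_int R) => h; rewrite ltr_norml; apply/andP; split; lra.
exists (Num.floor (x + e)); have : Num.floor x + 1 <= Num.floor (x + e) by rewrite lezD1.
by rewrite -(ler_int R) => h; rewrite ltr_norml; apply/andP; split; lra.
Qed.

Lemma sum_Z3 (f : 'Z_3 -> R) : \sum_i f i = f 0 + f 1 + f (-1).
Proof.
rewrite !big_ord_recl big_ord0 addr0 addrA; congr (f _ + f _ + f _); exact: val_inj.
Qed.

Lemma Z3P (i : 'Z_3) : [\/ i = 0, i = 1 | i = -1].
Proof.
by case: i => -[|[|[|]]]// ?; [apply: Or31|apply: Or32|apply: Or33]; exact: val_inj.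
Qed.

(** The products f i * f (i + j) add up to half of (sum f)^2 - sum f^2. *)
Lemma sum_translate_Z3 (f : 'Z_3 -> R) (j : 'Z_3) : j != 0 -> \sum_i f i = 0 ->
  \sum_i (f i - f (i + j)) ^+ 2 = 3 * \sum_i f i ^+ 2.
Proof.
rewrite !sum_Z3; case: (Z3P j) => ->// _ s0.
  have -> : 0 + 1 = 1 :> 'Z_3 by exact: val_inj.
  have -> : 1 + 1 = -1 :> 'Z_3 by exact: val_inj.
  have -> : -1 + 1 = 0 :> 'Z_3 by exact: val_inj.
  have -> : f (-1) = - f 0 - f 1 by lra.
  by ring.
have -> : 0 + -1 = -1 :> 'Z_3 by exact: val_inj.
have -> : 1 + -1 = 0 :> 'Z_3 by exact: val_inj.
have -> : -1 + -1 = 1 :> 'Z_3 by exact: val_inj.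
have -> : f (-1) = - f 0 - f 1 by lra.
by ring.
Qed.

Lemma sum_subl (f : 'Z_3 -> R) (j : 'Z_3) : \sum_i f (j - i) = \sum_i f i.
Proof.
rewrite [RHS](reindex_inj (h := fun i => j - i))//.
by move=> x y /addrI /oppr_inj.
Qed.

Lemma sum_addr (f : 'Z_3 -> R) (j : 'Z_3) : \sum_i f (i + j) = \sum_i f i.
Proof. by rewrite [RHS](reindex_inj (h := fun i => i + j))//; exact: addIr. Qed.

End Sign.

(** * The skew product over a rotation and near-invariant functions *)

Section SkewShift.
Context {R : realType}.
Variables (alpha xi : R).
Let X (k : nat) := xi + k%:R * alpha.
Implicit Types A : nat -> 'Z_3 -> R.

(** The operator of the skew product on functions of time and sheet.  Along a
sequence with c k.+1 = psgn (X k) - c k it is the time shift. *)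
Definition shiftS A : nat -> 'Z_3 -> R := fun k i => A k.+1 (psgn (X k) - i).

(** The fibre map of s steps of the skew product started at time k. *)
Fixpoint orb (s k : nat) (i : 'Z_3) : 'Z_3 :=
  if s is s'.+1 then orb s' k.+1 (psgn (X k) - i) else i.

Lemma orbS s k i : orb s.+1 k i = psgn (X (k + s)) - orb s k i.
Proof.
elim: s k i => [|s IH] k i; first by rewrite /= addn0.
by rewrite -[LHS]/(orb s.+1 k.+1 _) IH addSnnS.
Qed.

(** The linear part depends on s only, so two fibre maps of s steps differ by a
translation of Z/3. *)
Lemma orb_affine s k i : orb s k i = (-1) ^+ s * i + orb s k 0.
Proof.
elim: s => [|s IH]; first by rewrite /= expr0 mul1r addr0.
by rewrite !orbS IH exprS; ring.
Qed.

Lemma orb_inj s k : injective (orb s k).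
Proof.
elim: s k => [|s IH] k i j //= /IH /addrI; exact: oppr_inj.
Qed.

Lemma iter_shiftS s A k i : iter s shiftS A k i = A (k + s)%N (orb s k i).
Proof.
elim: s k i => [|s IH] k i; first by rewrite /= addn0.
by rewrite iterS /shiftS IH addSnnS.
Qed.

Definition bfun A := exists B, forall k i, `|A k i| <= B.

Lemma bfun_bseq A f g : bfun A -> bseq (fun k => A (f k) (g k)).
Proof. by move=> [B AB]; exists B. Qed.

(** Only midpoints, as the parallelogram law uses no other convex combinations. *)
Inductive hull (A0 : nat -> 'Z_3 -> R) : (nat -> 'Z_3 -> R) -> Prop :=
| hull_base : hull A0 A0
| hull_shift A : hull A0 A -> hull A0 (shiftS A)
| hull_mid A B : hull A0 A -> hull A0 B ->
    hull A0 (fun k i => 2^-1 * A k i + 2^-1 * B k i).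

Lemma hull_iter A0 A s : hull A0 A -> hull A0 (iter s shiftS A).
Proof. by move=> hA; elim: s => [//|s IH]; exact: hull_shift. Qed.

Lemma hull_bfun A0 A : bfun A0 -> hull A0 A -> bfun A.
Proof.
move=> b0; elim=> // {A} [A _ [B AB]|A A' _ [B AB] _ [B' AB']].
  by exists B => k i; exact: AB.
exists (2^-1 * B + 2^-1 * B') => k i; apply: le_trans (ler_normD _ _) _.
by rewrite !normrM ger0_norm ?invr_ge0//; apply: lerD; rewrite ler_wpM2l ?invr_ge0.
Qed.

Lemma hull_sum0 A0 A : (forall k, \sum_i A0 k i = 0) -> hull A0 A ->
  forall k, \sum_i A k i = 0.
Proof.
move=> b0; elim=> // {A} [A _ IH k|A A' _ IH _ IH' k].
  by rewrite /shiftS (sum_subl (fun i => A k.+1 i)).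
by rewrite big_split/= -!mulr_sumr IH IH' !mulr0 addr0.
Qed.

Variable L : (nat -> R) -> R.
Hypothesis HL : invariant_mean L.

Definition energy A := L (fun k => \sum_i A k i ^+ 2).
Definition dist2 A (B : nat -> 'Z_3 -> R) := L (fun k => \sum_i (A k i - B k i) ^+ 2).

Lemma bseq_energy A : bfun A -> bseq (fun k => \sum_i A k i ^+ 2).
Proof. by move=> bA; apply: bseq_sum => i; apply/bseqX/bfun_bseq. Qed.

Lemma bseq_dist2 A (B : nat -> 'Z_3 -> R) : bfun A -> bfun B ->
  bseq (fun k => \sum_i (A k i - B k i) ^+ 2).
Proof.
move=> bA bB; apply: bseq_sum => i; apply/bseqX/bseqB; exact: (@bfun_bseq _ id (fun=> i)).
Qed.

Lemma energy_ge0 A : bfun A -> 0 <= energy A.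
Proof.
move=> bA; apply: (mean_ge0 HL); first exact: bseq_energy.
by move=> k; apply: sumr_ge0 => i _; exact: sqr_ge0.
Qed.

Lemma energy_shift A : bfun A -> energy (shiftS A) = energy A.
Proof.
move=> bA; rewrite /energy -[RHS](mean_shift1 HL (bseq_energy bA)); congr L.
by apply/funext => k; rewrite /shiftS (sum_subl (fun i => A k.+1 i ^+ 2)).
Qed.

Lemma energy_iter A s : bfun A -> energy (iter s shiftS A) = energy A.
Proof.
move=> bA; elim: s => [//|s IH]; rewrite iterS energy_shift//.
apply: (@hull_bfun A) => //; apply: hull_iter; exact: hull_base.
Qed.

Lemma parallelogram A (B : nat -> 'Z_3 -> R) : bfun A -> bfun B ->
  dist2 A B = 2 * energy A + 2 * energy B -
    4 * energy (fun k i => 2^-1 * A k i + 2^-1 * B k i).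
Proof.
move=> bA bB.
have bM : bfun (fun k i => 2^-1 * A k i + 2^-1 * B k i).
  move: bA bB => [a Aa] [b Bb]; exists (2^-1 * a + 2^-1 * b) => k i.
  apply: le_trans (ler_normD _ _) _.
  by rewrite !normrM ger0_norm ?invr_ge0//; apply: lerD; rewrite ler_wpM2l ?invr_ge0.
rewrite /energy -!(meanZ HL) -?(meanD HL) -?(meanB HL); last first.
all: try (by do ?[apply: bseqD|apply: bseqZ|exact: bseq_energy]).
congr L; apply/funext => k; rewrite !mulr_sumr -!big_split/= -sumrB.
by apply: eq_bigr => i _; field.
Qed.

(** Let A have almost minimal energy in the hull.  Its shifts have the same energy,
and the midpoint of A and a shift belongs to the hull, so that its energy is not
much smaller; by the parallelogram law the shift is close to A. *)
Lemma near_invariant_element A0 eta : bfun A0 -> 0 < eta ->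
  exists2 A, hull A0 A & forall s, dist2 A (iter s shiftS A) <= 4 * eta.
Proof.
move=> b0 eta0.
pose E := [set energy A | A in hull A0].
have Einf : has_inf E.
  split; first by exists (energy A0), A0 => //; exact: hull_base.
  by exists 0 => _ [A hA <-]; apply: energy_ge0; exact: hull_bfun hA.
have [_ [A hA <-] Ae] := inf_adherent eta0 Einf.
exists A => // s.
have bA := hull_bfun b0 hA.
have hAs := hull_iter s hA.
rewrite (parallelogram bA (hull_bfun b0 hAs)) (energy_iter s bA).
have : inf E <= energy (fun k i => 2^-1 * A k i + 2^-1 * iter s shiftS A k i).
  by apply: ge_inf; [exact: Einf.2|exists (fun k i => 2^-1 * A k i + 2^-1 * iter s shiftS A k i) => //; exact: hull_mid].
lra.
Qed.

End SkewShift.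

(** * Almost periods of the skew product *)

Section AlmostPeriods.
Context {R : realType}.
Variables (alpha beta xi : R).
Let X (k : nat) := xi + k%:R * alpha.
Implicit Types A : nat -> 'Z_3 -> R.

Local Notation shiftS := (shiftS alpha xi).
Local Notation orb := (orb alpha xi).
Local Notation hull := (hull alpha xi).

Variable L : (nat -> R) -> R.
Hypothesis HL : invariant_mean L.
Local Notation energy := (energy L).
Local Notation dist2 := (dist2 L).

(** The operator is a time shift along the orbit, and the mean ignores shifts. *)
Lemma mean_along_orbit (c : nat -> 'Z_3) A0 A :
  (forall k, c k.+1 = psgn (X k) - c k) -> bfun A0 -> hull A0 A ->
  L (fun k => A k (c k)) = L (fun k => A0 k (c k)).
Proof.
move=> cS b0; elim=> // {A} [A hA <-|A A' hA IH hA' IH'].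
  rewrite -[RHS](mean_shift1 HL); last exact/bfun_bseq/(hull_bfun b0 hA).
  by congr L; apply/funext => k; rewrite /shiftS cS.
have bA := bfun_bseq id c (hull_bfun b0 hA).
have bA' := bfun_bseq id c (hull_bfun b0 hA').
by rewrite (meanD HL (bseqZ _ bA) (bseqZ _ bA')) (meanZ HL _ bA) (meanZ HL _ bA') IH IH'; field.
Qed.

(** Jensen for the square, after which the terms of the sheets off the orbit are
added. *)
Lemma mean_sqr_le_energy (c : nat -> 'Z_3) A : bfun A ->
  L (fun k => A k (c k)) ^+ 2 <= energy A.
Proof.
move=> bA; set m := L _.
have b1 : bseq (fun k => A k (c k)) by exact: (bfun_bseq id).
have b2 := bseqX 2 b1.
apply: (@le_trans _ _ (L (fun k => A k (c k) ^+ 2))); last first.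
  apply: (le_mean HL) => // [|k]; first exact: bseq_energy.
  by rewrite (bigD1 (c k))//= lerDl sumr_ge0// => i _; exact: sqr_ge0.
have : 0 <= L (fun k => A k (c k) ^+ 2 + ((- 2 * m) * A k (c k) + m ^+ 2)).
  apply: (mean_ge0 HL) => [|k].
    by apply/bseqD => //; apply/bseqD; [exact: bseqZ|exact: bseq_cst].
  have -> : A k (c k) ^+ 2 + (-2 * m * A k (c k) + m ^+ 2) = (A k (c k) - m) ^+ 2 by ring.
  exact: sqr_ge0.
have b3 := bseqZ (- 2 * m) b1; have b4 := bseq_cst (m ^+ 2).
rewrite (meanD HL b2 (bseqD b3 b4)) (meanD HL b3 b4) (meanZ HL _ b1) (mean_cst HL).
by rewrite -/m => h; rewrite -subr_ge0; apply: le_trans h _; rewrite le_eqVlt; apply/orP; left; apply/eqP; ring.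
Qed.

Hypothesis a_irr : forall (j : nat) (l : int), (0 < j)%N -> j%:R * alpha != l%:~R.

Definition near_int (d : R) (k : nat) : R := `[< nearZ (X k) d >]%:R.

Lemma bseq_bool (b : nat -> bool) : bseq (fun k => (b k)%:R : R).
Proof. by exists 1 => k; case: (b k); rewrite ?normr1 ?normr0. Qed.

(** By irrationality, m.+1 consecutive points X k cannot visit a small enough
neighbourhood of the integers twice, so the translates of its indicator by
0, ..., m have sum at most 1. *)
Lemma mean_near_int eta : 0 < eta -> exists2 d : R, 0 < d & L (near_int d) <= eta.
Proof.
move=> eta0.
pose m := Num.bound eta^-1.
have [e e0 he] := exists_gap_below_returns a_irr m.
exists (e / 2); first by rewrite divr_gt0.
have bn : bseq (near_int (e / 2)) by exact: bseq_bool.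
have : L (fun k => \sum_(j < m.+1) near_int (e / 2) (k + j)%N) <= 1.
  rewrite -[leRHS](mean_cst HL); apply: (le_mean HL) => [||k].
  - by apply: bseq_sum => i; exact: bseq_shift.
  - exact: bseq_cst.
  have [[j0 hj0]|H] := pselect (exists j : 'I_m.+1, nearZ (X (k + j)) (e / 2)); last first.
    rewrite big1// => j _; rewrite /near_int; case: asboolP => // hj.
    by exfalso; apply: H; exists j.
  rewrite (bigD1 j0)//= big1 ?addr0 => [|j jj0]; first by rewrite /near_int; case: asboolP.
  rewrite /near_int; case: asboolP => // hj; exfalso.
  wlog jlt : j j0 jj0 hj0 hj / (j0 < j)%N.
    move=> W; have : (j != j0 :> nat) by [].
    rewrite neq_ltn => /orP[?|?]; last exact: (W j j0).
    by apply: (W j0 j) => //; rewrite eq_sym.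
  move: hj0 hj => [l hl] [l' hl'].
  have := he (j - j0)%N _ (l' - l); rewrite subn_gt0 jlt/=.
  have -> : (j - j0 <= m)%N by have := ltn_ord j; clear; lia.
  move=> /(_ isT); rewrite leNgt => /negP; apply.
  have -> : (j - j0)%:R * alpha - (l' - l)%:~R = (X (k + j) - l'%:~R) - (X (k + j0) - l%:~R).
    by rewrite /X !natrD natrB ?(ltnW jlt)// intrB; ring.
  by apply: le_lt_trans (ler_normB _ _) _; rewrite [ltRHS]splitr ltrD.
rewrite (mean_sum HL) => [|i]; last exact: bseq_shift.
under eq_bigr do rewrite (mean_shift HL)//.
rewrite sumr_const card_ord -[L _ *+ _]mulr_natl => h.
have m0 : eta^-1 < m.+1%:R.
  by apply: (lt_le_trans (archi_boundP _)); rewrite ?invr_ge0 ?(ltW eta0)// ler_nat.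
have := le_lt_trans h (_ : 1 < m.+1%:R * eta).
by rewrite ltr_pM2l ?ltr0n// => /(_ _)/ltW; apply; rewrite -ltr_pdivrMr// mul1r.
Qed.

(** An even integer, as psgn has period 2. *)
Definition almost_periodic A := forall eta, 0 < eta -> exists2 d : R, 0 < d &
  forall (r : nat) (M l : int), `|r%:R * alpha - (2 * M)%:~R| < d ->
    `|r%:R * beta - l%:~R| < d -> dist2 A (fun k i => A (k + r)%N i) <= eta.

Lemma bfun_shift A r : bfun A -> bfun (fun k i => A (k + r)%N i).
Proof. by move=> [b Ab]; exists b. Qed.

Lemma bfun_shiftS A : bfun A -> bfun (shiftS A).
Proof. by move=> [b Ab]; exists b => k i; exact: Ab. Qed.

(** The operator involves psgn (X k), which differs from psgn (X (k + r)) only if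
X k is close to an integer; such k are rare by [mean_near_int]. *)
Lemma almost_periodic_shiftS A : bfun A -> almost_periodic A -> almost_periodic (shiftS A).
Proof.
move=> bA apA eta eta0; have [b Ab] := bA.
have b0 : 0 <= b by exact: le_trans (Ab 0%N 0).
have [d1 d10 h1] := apA (eta / 2) (divr_gt0 eta0 (ltr0n _ 2)).
have e20 : 0 < eta / 2 / (12 * b ^+ 2 + 1).
  by rewrite !divr_gt0// ltr_pwDr// mulr_ge0// sqr_ge0.
have [d2 d20 h2] := mean_near_int e20.
exists (Num.min d1 d2); first by rewrite lt_min d10.
move=> r M l; rewrite !lt_min => /andP[ra1 ra2] /andP[rb1 _].
have bn : bseq (near_int d2) by exact: bseq_bool.
have bd : bseq (fun k => \sum_i (A k i - A (k + r)%N i) ^+ 2).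
  by apply: bseq_dist2 => //; exact: bfun_shift.
have bd1 : bseq (fun k => \sum_i (A k.+1 i - A (k.+1 + r)%N i) ^+ 2).
  by have := bseq_shift 1 bd; congr bseq; apply/funext => k; rewrite addn1.
apply: (@le_trans _ _ (L (fun k => \sum_i (A k.+1 i - A (k.+1 + r)%N i) ^+ 2 +
    (12 * b ^+ 2) * near_int d2 k))).
  apply: (le_mean HL) => [||k].
  - by apply: bseq_dist2; [|apply: bfun_shift]; exact: bfun_shiftS.
  - by apply: bseqD => //; exact: bseqZ.
  rewrite /shiftS -/(X k) -/(X (k + r)).
  have [eqs|nes] := eqVneq (psgn (X (k + r))) (psgn (X k)).
    rewrite eqs (sum_subl (fun i => (A k.+1 i - A (k + r).+1 i) ^+ 2)) addSn lerDl.
    by rewrite mulr_ge0// ?mulr_ge0 ?sqr_ge0// /near_int ler0n.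
  have -> : near_int d2 k = 1.
    rewrite /near_int asboolT//; apply: (psgn_neq_nearZ (M := M)) nes.
    have -> : X (k + r) - X k - (2 * M)%:~R = r%:R * alpha - (2 * M)%:~R.
      by rewrite /X natrD; ring.
    exact: ra2.
  rewrite mulr1 -[leLHS]add0r lerD//; first by apply: sumr_ge0 => i _; exact: sqr_ge0.
  apply: (@le_trans _ _ (\sum_(i : 'Z_3) (2 * b) ^+ 2)); last first.
    by rewrite sum_Z3 le_eqVlt; apply/orP; left; apply/eqP; ring.
  apply: ler_sum => i _; rewrite -real_normK ?num_real// lerXn2r ?nnegrE// ?mulr_ge0//.
  by apply: le_trans (ler_normB _ _) _; rewrite mulr2n mulrDl mul1r lerD.
rewrite (meanD HL)// ?(meanZ HL)//; last exact: bseqZ.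
rewrite (mean_shift1 HL bd) [leRHS]splitr lerD//; first exact: h1 ra1 rb1.
have p : 0 < 12 * b ^+ 2 + 1 by rewrite ltr_pwDr// mulr_ge0// sqr_ge0.
have p' : 0 <= 12 * b ^+ 2 by rewrite mulr_ge0// sqr_ge0.
apply: (@le_trans _ _ ((12 * b ^+ 2 + 1) * (eta / 2 / (12 * b ^+ 2 + 1)))); last first.
  by rewrite mulrCA mulfV ?mulr1// gt_eqF.
apply: ler_pM => //; last by rewrite lerDl.
by apply: (mean_ge0 HL) => // k; rewrite /near_int ler0n.
Qed.

Lemma almost_periodic_mid A (B : nat -> 'Z_3 -> R) : bfun A -> bfun B ->
  almost_periodic A -> almost_periodic B ->
  almost_periodic (fun k i => 2^-1 * A k i + 2^-1 * B k i).
Proof.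
move=> bA bB apA apB eta eta0.
have [d1 d10 h1] := apA eta eta0; have [d2 d20 h2] := apB eta eta0.
exists (Num.min d1 d2); first by rewrite lt_min d10.
move=> r M l; rewrite !lt_min => /andP[ra1 ra2] /andP[rb1 rb2].
have b1 := bseq_dist2 bA (bfun_shift r bA).
have b2 := bseq_dist2 bB (bfun_shift r bB).
apply: (@le_trans _ _ (L (fun k => 2^-1 * \sum_i (A k i - A (k + r)%N i) ^+ 2 +
    2^-1 * \sum_i (B k i - B (k + r)%N i) ^+ 2))).
  apply: (le_mean HL) => [||k].
  - apply: bseq_sum => i; apply/bseqX/bseqB; apply: bseqD; apply: bseqZ; exact: bfun_bseq.
  - by apply: bseqD; exact: bseqZ.
  rewrite !mulr_sumr -big_split/=; apply: ler_sum => i _.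
  rewrite -subr_ge0 (_ : _ - _ = (2^-1 * ((A k i - A (k + r)%N i) - (B k i - B (k + r)%N i))) ^+ 2).
    exact: sqr_ge0.
  by field.
rewrite (meanD HL) ?(meanZ HL)//; try exact: bseqZ.
have := h1 _ _ _ ra1 rb1; have := h2 _ _ _ ra2 rb2; rewrite /dist2; lra.
Qed.

Lemma hull_almost_periodic A0 A : bfun A0 -> almost_periodic A0 -> hull A0 A ->
  almost_periodic A.
Proof.
move=> b0 ap0; elim=> // {A} [A hA IH|A B hA IH hB IH'].
  by apply: almost_periodic_shiftS => //; exact: hull_bfun hA.
by apply: almost_periodic_mid => //; [exact: hull_bfun hA|exact: hull_bfun hB].
Qed.

Lemma sqr_sum4 (a b c d : R) : (a + b + c + d) ^+ 2 <= 4 * (a ^+ 2 + b ^+ 2 + c ^+ 2 + d ^+ 2).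
Proof.
rewrite -subr_ge0 (_ : _ - _ = (a - b) ^+ 2 + (a - c) ^+ 2 + (a - d) ^+ 2 +
  (b - c) ^+ 2 + (b - d) ^+ 2 + (c - d) ^+ 2); last by ring.
by rewrite !addr_ge0// sqr_ge0.
Qed.

(** It is enough to compare the two fibre maps at 0, as they differ by a
translation. *)
Definition sheets_differ r s k := orb s (k + r) 0 - orb s k 0 != 0.

(** Follow A from time k to k + s by the skew product, to k + s + r by the almost
period, back to k + r by the skew product, and to k by the almost period.  The
round trip carries a sheet to a different one, so these four steps bound the
distance from A k to a nontrivial translate of itself, and [sum_translate_Z3]
turns that distance into the energy of A k. *)
Lemma energy_where_sheets_differ A s r : bfun A -> (forall k, \sum_i A k i = 0) ->
  L (fun k => (sheets_differ r s k)%:R * \sum_i A k i ^+ 2) <=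
  4 / 3 * (2 * dist2 A (iter s shiftS A) + 2 * dist2 A (fun k i => A (k + r)%N i)).
Proof.
move=> bA A0.
have bAs : bfun (iter s shiftS A) by apply: hull_bfun bA _; apply: hull_iter; exact: hull_base.
have bT1 := bseq_dist2 bA bAs.
have bT2 := bseq_dist2 bA (bfun_shift r bA).
set T1 := fun k => \sum_i (A k i - iter s shiftS A k i) ^+ 2 in bT1.
set T2 := fun k => \sum_i (A k i - A (k + r)%N i) ^+ 2 in bT2.
apply: (@le_trans _ _ (L (fun k => 4 / 3 * ((T1 k + T2 (k + s)%N) + (T1 (k + r)%N + T2 k))))); last first.
  have b1 := bseq_shift r bT1; have b2 := bseq_shift s bT2.
  have b3 := bseqD bT1 b2; have b4 := bseqD b1 bT2.
  rewrite (meanZ HL); last exact: bseqD.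
  rewrite (meanD HL b3 b4) (meanD HL bT1 b2) (meanD HL b1 bT2) !(mean_shift HL)//.
  by rewrite /dist2 -/T1 -/T2; lra.
apply: (le_mean HL) => [||k].
- by apply: bseqM; [exact: bseq_bool|exact: bseq_energy].
- by apply: bseqZ; apply: bseqD; apply: bseqD => //; exact: bseq_shift.
have [zk|_] := boolP (sheets_differ r s k); last first.
  rewrite mul0r mulr_ge0// ?divr_ge0// !addr_ge0//; apply: sumr_ge0 => i _; exact: sqr_ge0.
rewrite mul1r.
pose e := orb s (k + r) 0 - orb s k 0.
(* The solution of orb s (k + r) (i + kap) = orb s k i, for all i. *)
pose kap := - ((-1) ^+ s * e).
have kap0 : kap != 0.
  by rewrite oppr_eq0 -signr_odd; case: (odd s); rewrite ?expr1 ?expr0 ?mulN1r ?mul1r ?oppr_eq0.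
have orbe i : orb s (k + r) (i + kap) = orb s k i.
  rewrite orb_affine [RHS]orb_affine mulrDr /kap mulrN mulrA -expr2 sqrr_sign mul1r /e.
  by ring.
rewrite -(@ler_pM2l _ 3)// -(sum_translate_Z3 kap0)// mulrA (_ : 3 * (4 / 3) = 4); last by field.
have -> : T2 (k + s)%N = \sum_i (A (k + s)%N (orb s k i) - A (k + s + r)%N (orb s k i)) ^+ 2.
  by rewrite /T2 (reindex_inj (@orb_inj _ alpha xi s k)).
have -> : T1 (k + r)%N = \sum_i (A (k + r)%N (i + kap) - A (k + s + r)%N (orb s k i)) ^+ 2.
  rewrite /T1 -(sum_addr _ kap); apply: eq_bigr => i _.
  by rewrite iter_shiftS orbe addnAC.
have -> : T2 k = \sum_i (A k (i + kap) - A (k + r)%N (i + kap)) ^+ 2.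
  by rewrite /T2 -(sum_addr _ kap).
rewrite /T1 -!big_split mulr_sumr; apply: ler_sum => i _ /=.
rewrite iter_shiftS.
have := sqr_sum4 (A k i - A (k + s)%N (orb s k i))
  (A (k + s)%N (orb s k i) - A (k + s + r)%N (orb s k i))
  (- (A (k + r)%N (i + kap) - A (k + s + r)%N (orb s k i)))
  (- (A k (i + kap) - A (k + r)%N (i + kap))).
rewrite !sqrrN; set a := (_ + _) ^+ 2; have -> : a = (A k i - A k (i + kap)) ^+ 2.
  by rewrite /a; congr (_ ^+ 2); ring.
by move=> h; apply: le_trans h _; rewrite !addrA.
Qed.

End AlmostPeriods.

(** * Sum-zero functions average to zero *)

Section SkewProduct.
Context {R : realType}.
Variables (alpha beta xi zeta : R).
Let X (k : nat) := xi + k%:R * alpha.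
Let Z (k : nat) := zeta + k%:R * beta.

Hypothesis a_irr : forall (j : nat) (l : int), (0 < j)%N -> j%:R * alpha != l%:~R.
Hypothesis kron : forall p1 p2 e : R, 0 < e -> exists r : nat,
  nearZ (r%:R * (alpha / 2) - p1) e /\ nearZ (r%:R * beta - p2) e.

Let a_dense (p e : R) : 0 < e ->
  exists2 r : nat, (0 < r)%N & nearZ (r%:R * alpha - p) e.
Proof.
move=> e0; have [r [[l hl] _]] := kron ((p - alpha) / 2) 0 (divr_gt0 e0 (ltr0n _ 2)).
exists r.+1 => //; exists (2 * l).
have -> : r.+1%:R * alpha - p - (2 * l)%:~R = 2 * (r%:R * (alpha / 2) - (p - alpha) / 2 - l%:~R).
  by rewrite -natr1 intrM; field.
by rewrite normrM ger0_norm// mulrC -ltr_pdivlMr.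
Qed.

(** Choose r such that eps = r * alpha mod 2 lies in the range allowed by
[exists_well_spaced_hits].  At each step the difference of the two fibre maps is
negated, and moreover changes by a sign if the point X (k + s) is a hit; these are
the hypotheses of [sum_after_hits]. *)
Lemma sheets_differ_often (d : R) : 0 < d -> exists q r : nat, exists M l : int,
  [/\ (0 < q)%N, `|r%:R * alpha - (2 * M)%:~R| < d, `|r%:R * beta - l%:~R| < d &
    forall k, (q <= \sum_(s < 7 * q) sheets_differ alpha xi r s k)%N].
Proof.
move=> d0.
have tol0 : 0 < Num.min (d / 2) (2^-1 : R) by rewrite lt_min divr_gt0//= invr_gt0.
have [q [lo [hi [q0 /andP[lo0 lohi] hid hit_struct]]]] :=
  exists_well_spaced_hits a_irr a_dense tol0.
move: hid; rewrite le_min => /andP[hid hi2].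
pose w := (lo + hi) / 2; pose t := Num.min ((hi - lo) / 8) d.
have t0 : 0 < t by rewrite lt_min d0 andbT divr_gt0// subr_gt0.
(* The frequency alpha / 2 controls r * alpha modulo 2. *)
have [r [[M hM] [l hl]]] := kron (w / 2) 0 t0.
pose eps := r%:R * alpha - (2 * M)%:~R.
have eps_bnd : lo < eps < hi.
  move: hM; rewrite lt_min => /andP[h _].
  have : `|eps - w| < (hi - lo) / 4.
    have -> : eps - w = 2 * (r%:R * (alpha / 2) - w / 2 - M%:~R).
      by rewrite /eps intrM; field.
    by rewrite normrM ger0_norm//; lra.
  by rewrite /w ltr_norml => /andP[? ?]; apply/andP; split; lra.
move: (eps_bnd) => /andP[elo ehi].
have [sp gap] := hit_struct _ eps_bnd.
exists q, r, M, l; split => //.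
- by rewrite -/eps ger0_norm; lra.
- by move: hl; rewrite subr0 lt_min => /andP[].
move=> k.
have Xs s j : X (k + (s + j)) = X (k + s) + j%:R * alpha by rewrite /X !natrD; ring.
have eps01 : 0 < eps < 1 by apply/andP; split; lra.
have step s : orb alpha xi s.+1 (k + r) 0 - orb alpha xi s.+1 k 0 =
    (if `[< hit eps (X (k + s)) >] then psgn (X (k + s)) else 0) -
    (orb alpha xi s (k + r) 0 - orb alpha xi s k 0).
  rewrite !orbS -/(X _).
  have -> : X (k + r + s) = X (k + s) + eps + (2 * M)%:~R by rewrite /X /eps !natrD; ring.
  rewrite psgnDz (_ : odd (absz (2 * M)) = false); last by clear; lia.
  rewrite hit_psgn//; case: ifP => _; last by ring.
  (* -2 = 1 in Z/3. *)
  have e3 : - psgn (X (k + s)) - psgn (X (k + s)) = psgn (X (k + s)).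
    by case: (Z3P (psgn (X (k + s)))) => ->; exact: val_inj.
  by rewrite -{3}e3; ring.
apply: (@sum_after_hits (fun s => `[< hit eps (X (k + s)) >])
  (fun s => sheets_differ alpha xi r s k)) => //.
- move=> s; rewrite /sheets_differ step => /negbTE ->.
  by rewrite sub0r oppr_eq0.
- move=> s hs; rewrite /sheets_differ step hs negbK => /eqP ->.
  by rewrite subr0 psgn_neq0.
- move=> s j jq /asboolP hs; apply/asboolP; rewrite Xs.
  exact: sp jq hs.
- move=> s; have [j jq hj] := gap (X (k + s)); exists j => //.
  by apply/asboolP; rewrite Xs.
Qed.

Variable psi : 'Z_3 -> R -> R -> R.
Hypothesis psi_bnd : exists b : R, forall i x z, `|psi i x z| <= b.
Hypothesis psi_perx : forall i x z, psi i (x + 2) z = psi i x z.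
Hypothesis psi_perz : forall i x z, psi i x (z + 1) = psi i x z.
Hypothesis psi_cont : forall e : R, 0 < e -> exists2 d : R, 0 < d & forall i (x x' z z' : R),
  `|x - x'| < d -> `|z - z'| < d -> `|psi i x z - psi i x' z'| < e.
Hypothesis psi_sum0 : forall x z, \sum_i psi i x z = 0.

Lemma periodic_int_shift (f : R -> R) (T : R) : (forall x, f (x + T) = f x) ->
  forall (M : int) x, f (x + M%:~R * T) = f x.
Proof.
move=> fT; have pos (n : nat) y : f (y + n%:R * T) = f y.
  elim: n y => [|n IH] y; first by rewrite mul0r addr0.
  by rewrite -natr1 mulrDl mul1r addrA fT.
case=> n x; first exact: pos.
by rewrite NegzE -[LHS](pos n.+1) mulrNz mulNr subrK.
Qed.

Variable c : nat -> 'Z_3.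
Hypothesis c_step : forall k, c k.+1 = psgn (X k) - c k.

(** Otherwise a Banach limit gives the sequence a mean m <> 0, and the energies in
the hull are at least m ^ 2.  For an almost minimizer A and an almost period r from
[sheets_differ_often], add the bounds of [energy_where_sheets_differ] over the
s < 7 * q: each time k is counted q times at least, which bounds the energy of A by
less than m ^ 2. *)
Theorem skew_cesaro : cesaro (fun k => psi (c k) (X k) (Z k)) n @[n --> \oo] --> (0 : R).
Proof.
apply: contrapT => ncv.
pose A0 k i := psi i (X k) (Z k).
have b0 : bfun A0 by have [b hb] := psi_bnd; exists b => k i; exact: hb.
have [L HL Lne0] := exists_invariant_mean (bfun_bseq id c b0) ncv.
have ap0 : almost_periodic alpha beta L A0.
  move=> eta eta0.
  have tol0 : 0 < Num.min (eta / 3) 1 by rewrite lt_min ltr01 divr_gt0.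
  have [d d0 hd] := psi_cont tol0.
  exists d => // r M l ra rb.
  rewrite -[leRHS](mean_cst HL); apply: (le_mean HL) => [||k].
  - by apply: bseq_dist2 => //; exact: bfun_shift.
  - exact: bseq_cst.
  have h i : (A0 k i - A0 (k + r)%N i) ^+ 2 <= eta / 3.
    have -> : A0 (k + r)%N i = psi i (X k + (r%:R * alpha - (2 * M)%:~R)) (Z k + (r%:R * beta - l%:~R)).
      rewrite -(periodic_int_shift (f := fun x => psi i x _) (T := 2) _ M)//.
      rewrite -(periodic_int_shift (f := fun z => psi i _ z) (T := 1) _ l)//.
      by congr psi; rewrite /X /Z natrD ?intrM; ring.
    have := hd i (X k) (X k + (r%:R * alpha - (2 * M)%:~R)) (Z k) (Z k + (r%:R * beta - l%:~R)).
    have subDl (x y : R) : x - (x + y) = - y by ring.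
    rewrite !subDl !normrN => /(_ ra rb).
    set u := _ - _; rewrite lt_min => /andP[u1 u2].
    rewrite -real_normK ?num_real// expr2.
    by apply: ltW; apply: le_lt_trans u1; rewrite ler_piMl// ltW.
  apply: le_trans (ler_sum _ (fun i _ => h i)) _.
  by rewrite sum_Z3 le_eqVlt; apply/orP; left; apply/eqP; field.
set m := L _ in Lne0.
have m2 : 0 < m ^+ 2 by rewrite exprn_even_gt0//; apply/eqP.
(* 200 exceeds 7 * (4 / 3) * (2 * 4 + 2). *)
have eta0 : 0 < m ^+ 2 / 200 by rewrite divr_gt0.
have [A hA near_inv] := near_invariant_element alpha xi HL b0 eta0.
have bA := hull_bfun b0 hA.
have A_sum0 := hull_sum0 (fun k => psi_sum0 (X k) (Z k)) hA.
have [d d0 hd] := hull_almost_periodic HL a_irr b0 ap0 hA eta0.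
have [q [r [M [l [q0 ra rb often]]]]] := sheets_differ_often d0.
have dA := hd _ _ _ ra rb.
have Em : m ^+ 2 <= energy L A.
  by rewrite /m -(mean_along_orbit HL c_step b0 hA); exact: mean_sqr_le_energy.
have bE := bseq_energy bA.
have each s := energy_where_sheets_differ alpha xi HL s r bA A_sum0.
have bs s : bseq (fun k => (sheets_differ alpha xi r s k)%:R * \sum_i A k i ^+ 2).
  by apply: bseqM => //; exact: bseq_bool.
have : q%:R * energy L A <= \sum_(s < 7 * q)
    L (fun k => (sheets_differ alpha xi r s k)%:R * \sum_i A k i ^+ 2).
  rewrite -(mean_sum HL)// -(meanZ HL)//; apply: (le_mean HL) => [||k].
  - exact: bseqZ.
  - exact: bseq_sum.
  rewrite -mulr_suml ler_wpM2r//; first by apply: sumr_ge0 => i _; exact: sqr_ge0.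
  by rewrite -natr_sum ler_nat.
move=> h; have : q%:R * energy L A <= \sum_(s < 7 * q)
    4 / 3 * (2 * (4 * (m ^+ 2 / 200)) + 2 * (m ^+ 2 / 200)).
  apply: le_trans h _; apply: ler_sum => s _; apply: le_trans (each s) _.
  by have := near_inv s; lra.
rewrite sumr_const card_ord mulrnA -[leRHS]mulr_natl ler_pM2l ?ltr0n// -mulr_natl.
lra.
Qed.

End SkewProduct.

(** * Trigonometric means along an orbit and over a grid *)

Section Kronecker.
Context {R : realType}.

(** Meant for C phi a mean of cosines of phase phi: if the mean does not notice a
rotation of the phase by theta, then C phi = cos theta * C phi,
so C phi = 0. *)
Lemma resonance_free (C : R -> R) (theta : R) : cos theta != 1 ->
  (forall phi, C (phi + theta) = C phi) ->
  (forall phi, C (phi + theta) + C (phi - theta) = 2 * cos theta * C phi) ->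
  forall phi, C phi = 0.
Proof.
move=> th1 inv add phi; have := add phi.
rewrite inv -[in C (phi - theta)]inv subrK -mulrA => h.
apply/eqP; have : (1 - cos theta) * C phi = 0 by lra.
by move/eqP; rewrite mulf_eq0 subr_eq0 eq_sym (negbTE th1).
Qed.

Lemma cosDB (x y : R) : cos (x + y) + cos (x - y) = 2 * cos y * cos x.
Proof. by rewrite cosD cosB; ring. Qed.

Definition tau : R := pi *+ 2.

Lemma tau_gt0 : 0 < tau.
Proof. by rewrite pmulrn_lgt0// pi_gt0. Qed.

Lemma cos_tauDz_phase (l : int) (x phi : R) :
  cos (tau * (x + l%:~R) + phi) = cos (tau * x + phi).
Proof.
rewrite -[l%:~R]mulr1 (periodic_int_shift (f := fun x => cos (tau * x + phi)) (T := 1))// => y.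
by rewrite mulrDr mulr1 addrAC cosD2pi.
Qed.

Lemma cos_tauDz (l : int) (x : R) : cos (tau * (x + l%:~R)) = cos (tau * x).
Proof. by rewrite -[LHS](congr1 cos (addr0 _)) cos_tauDz_phase addr0. Qed.

Lemma mem_tau (y : R) : 0 <= y <= 2^-1 -> tau * y \in `[0, pi].
Proof.
move=> /andP[y0 y2]; rewrite in_itv/= mulr_ge0 ?(ltW tau_gt0)//=.
by rewrite /tau -mulr_natl mulrAC ler_piMl ?pi_ge0//; lra.
Qed.

Lemma cos_nearZ (x e : R) : 0 < e <= 2^-1 -> cos (tau * e) < cos (tau * x) -> nearZ x e.
Proof.
move=> /andP[e0 e2] h; exists (Num.floor (x + 2^-1)).
have l1 := floor_le (x + 2^-1); have l2 := floorD1_gt (x + 2^-1).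
rewrite intrD in l2; set l := Num.floor _ in l1 l2 *.
have y2 : `|x - l%:~R| <= 2^-1 by rewrite ler_norml; apply/andP; split; lra.
move: h; rewrite -(subrK l%:~R x) cos_tauDz -[cos (tau * (x - _))]cos_norm.
rewrite normrM (gtr0_norm tau_gt0) ltr_cos ?mem_tau ?normr_ge0 ?(ltW e0)//.
by rewrite ltr_pM2l ?tau_gt0// subrK.
Qed.

Lemma cos_eq1_int (x : R) : cos (tau * x) = 1 -> exists l : int, x = l%:~R.
Proof.
move=> cx; have [xi|xni] := eqVneq x (Num.floor x)%:~R.
  by exists (Num.floor x).
exfalso; have l1 : (Num.floor x)%:~R < x.
  by rewrite lt_neqAle floor_le eq_sym xni.
have l2 := floorD1_gt x; rewrite intrD in l2; set l := Num.floor _ in l1 l2.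
pose e := Num.min (x - l%:~R) (l%:~R + 1 - x).
have e0 : 0 < e by rewrite lt_min; apply/andP; split; lra.
have e2 : e <= 2^-1.
  by rewrite ge_min; have [?|?] := leP (x - l%:~R) 2^-1 => //=; lra.
have ce : cos (tau * e) < cos (tau * x).
  rewrite cx -(@cos0 R) ltr_cos ?mulr_gt0 ?tau_gt0// ?mem_tau ?(ltW e0)//.
  by rewrite in_itv/= lexx pi_ge0.
have [m hm] := cos_nearZ (introT andP (conj e0 e2)) ce.
move: hm; rewrite lt_min => /andP[h1 h2].
have [lm|ml] := leP m l.
  have : m%:~R <= l%:~R :> R by rewrite ler_int.
  by move=> ?; rewrite ger0_norm in h1; lra.
have : l%:~R + 1 <= m%:~R :> R by rewrite -[1]/(1%:~R) -intrD ler_int lezD1.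
by move=> ?; rewrite ler0_norm in h2; lra.
Qed.

Lemma ex_invariant_mean : exists L : (nat -> R) -> R, invariant_mean L.
Proof.
have [|L HL _] := @exists_invariant_mean R (fun=> 1) (bseq_cst 1); last by exists L.
move=> /cvgrPdist_lt/(_ 1 ltr01)[N _ /(_ N.+1 (leqnSn N))] /=.
by rewrite cesaro_cst sub0r normrN normr1 ltxx.
Qed.

Variables (a b : R).
Hypothesis indep : forall m n l : int,
  m%:~R * a + n%:~R * b = l%:~R -> m = 0 /\ n = 0.
Variables (p1 p2 : R).
Variable L : (nat -> R) -> R.
Hypothesis HL : invariant_mean L.
Variable n : nat.

Definition orbit_mean (h : R -> R -> R) := L (fun k => h (k%:R * a) (k%:R * b)).
Definition grid_mean (h : R -> R -> R) :=
  (n.+1%:R ^+ 2)^-1 * \sum_(i < n.+1) \sum_(j < n.+1)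
    h (p1 + i%:R / n.+1%:R) (p2 + j%:R / n.+1%:R).

Lemma orbit_mean_lin (h1 h2 h3 : R -> R -> R) (c1 c2 c3 : R) :
  bseq (fun k => h1 (k%:R * a) (k%:R * b)) ->
  bseq (fun k => h2 (k%:R * a) (k%:R * b)) ->
  bseq (fun k => h3 (k%:R * a) (k%:R * b)) ->
  orbit_mean (fun x z => c1 * h1 x z + (c2 * h2 x z + c3 * h3 x z)) =
  c1 * orbit_mean h1 + (c2 * orbit_mean h2 + c3 * orbit_mean h3).
Proof.
move=> b1 b2 b3.
by rewrite /orbit_mean !(meanD HL) ?(meanZ HL)//; try apply: bseqD; exact: bseqZ.
Qed.

Lemma grid_mean_lin (h1 h2 h3 : R -> R -> R) (c1 c2 c3 : R) :
  grid_mean (fun x z => c1 * h1 x z + (c2 * h2 x z + c3 * h3 x z)) =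
  c1 * grid_mean h1 + (c2 * grid_mean h2 + c3 * grid_mean h3).
Proof.
rewrite /grid_mean !mulrA ![c1 * _]mulrC ![c2 * _]mulrC ![c3 * _]mulrC -!mulrA -!mulrDr.
congr (_ * _); rewrite !mulr_sumr -!big_split; apply: eq_bigr => i _ /=.
by rewrite !mulr_sumr -!big_split; apply: eq_bigr.
Qed.

Definition wave (m l : int) (phi x z : R) := cos (tau * (m%:~R * x + l%:~R * z) + phi).

Lemma orbit_mean_wave m l phi : (m != 0) || (l != 0) -> orbit_mean (wave m l phi) = 0.
Proof.
move=> ml; pose theta := tau * (m%:~R * a + l%:~R * b).
have bw psi : bseq (fun k => wave m l psi (k%:R * a) (k%:R * b)).
  by exists 1 => k; exact: cos_max.
have th1 : cos theta != 1.
  apply/eqP => /cos_eq1_int[j hj].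
  by have [m0 l0] := indep hj; rewrite m0 l0 in ml.
apply: (resonance_free (C := fun psi => orbit_mean (wave m l psi)) th1) => psi.
  rewrite -[RHS](mean_shift1 HL (bw psi)); congr L; apply/funext => k.
  by rewrite /wave /theta -natr1; congr cos; ring.
rewrite -(meanD HL)// -(meanZ HL)//; congr L; apply/funext => k.
by rewrite /wave !addrA cosDB.
Qed.

Lemma sum_cyclic_shift (f : nat -> R) : f n.+1 = f 0%N ->
  \sum_(i < n.+1) f i.+1 = \sum_(i < n.+1) f i.
Proof. by move=> fn; rewrite big_ord_recr/= fn addrC [RHS]big_ord_recl. Qed.

Lemma grid_sum_wave (m : int) p phi : m != 0 -> (absz m < n.+1)%N ->
  \sum_(i < n.+1) cos (tau * (m%:~R * (p + i%:R / n.+1%:R)) + phi) = 0.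
Proof.
move=> m0 mn; pose theta : R := tau * (m%:~R / n.+1%:R).
have n0 : n.+1%:R != 0 :> R by rewrite pnatr_eq0.
have th1 : cos theta != 1.
  apply/eqP => /cos_eq1_int[j hj].
  have : m%:~R = (j * n.+1%:Z)%:~R :> R by rewrite intrM -hj divfK.
  move/intr_inj => mj; move: m0 mn; rewrite mj abszM mulf_eq0 negb_or => /andP[j0 _].
  by rewrite -{2}[n.+1]mul1n ltn_mul2r ltn0Sn/= ltnS leqn0 absz_eq0 (negbTE j0).
apply: (resonance_free (C := fun psi =>
  \sum_(i < n.+1) cos (tau * (m%:~R * (p + i%:R / n.+1%:R)) + psi)) th1) => psi.
  rewrite -(@sum_cyclic_shift (fun i => cos (tau * (m%:~R * (p + i%:R / n.+1%:R)) + psi))).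
    by apply: eq_bigr => i _; congr cos; rewrite /theta -[i.+1%:R]natr1; field; rewrite addrC natr1 n0.
  rewrite divff// mulrDr mulr1.
  by rewrite cos_tauDz_phase mul0r addr0.
rewrite -big_split mulr_sumr; apply: eq_bigr => i _ /=.
by rewrite !addrA cosDB.
Qed.

Lemma grid_mean_wave m l phi : (m != 0) || (l != 0) ->
  (absz m < n.+1)%N -> (absz l < n.+1)%N -> grid_mean (wave m l phi) = 0.
Proof.
move=> ml mn ln; rewrite /grid_mean; apply/eqP; rewrite mulf_eq0; apply/orP; right.
apply/eqP; have [m0|m0] := eqVneq m 0; last first.
  rewrite exchange_big big1// => j _ /=.
  rewrite -[RHS](grid_sum_wave p1 (tau * (l%:~R * (p2 + j%:R / n.+1%:R)) + phi) m0 mn).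
  by apply: eq_bigr => i _; rewrite /wave; congr cos; ring.
rewrite m0 eqxx/= in ml; rewrite big1// => i _.
rewrite -[RHS](grid_sum_wave p2 phi ml ln).
by apply: eq_bigr => j _; rewrite /wave m0; congr cos; ring.
Qed.

Definition bump (x : R) := (1 + cos (tau * x)) / 2.

Lemma bump_ge0 x : 0 <= bump x.
Proof. by rewrite divr_ge0// -lerBlDl sub0r cos_geN1. Qed.

Lemma bump_le1 x : bump x <= 1.
Proof. by rewrite ler_pdivrMr//; have := cos_le1 (tau * x); lra. Qed.

(** The wave factor makes room for induction: multiplication by a bump shifts the
frequency of a wave by at most one. *)
Definition bump_wave N1 N2 m l phi x z :=
  bump (x - p1) ^+ N1 * bump (z - p2) ^+ N2 * wave m l phi x z.

Lemma bseq_bump_wave N1 N2 m l phi :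
  bseq (fun k => bump_wave N1 N2 m l phi (k%:R * a) (k%:R * b)).
Proof.
exists 1 => k; rewrite /bump_wave !normrM !normrX ![`|bump _|]ger0_norm ?bump_ge0//.
apply: mulr_ile1 => //; rewrite ?mulr_ge0 ?exprn_ge0 ?bump_ge0//.
- by apply: mulr_ile1; rewrite ?exprn_ge0 ?bump_ge0// exprn_ile1 ?bump_ge0 ?bump_le1.
- by rewrite /wave; exact: cos_max.
Qed.

(** Both means annihilate nonconstant waves of frequency at most n, the one by
independence and the other by orthogonality of the characters of the grid, and
powers of bumps are combinations of waves. *)
Lemma orbit_grid_mean N1 N2 m l phi : (absz m + N1 < n.+1)%N -> (absz l + N2 < n.+1)%N ->
  orbit_mean (bump_wave N1 N2 m l phi) = grid_mean (bump_wave N1 N2 m l phi).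
Proof.
elim: N1 m l phi => [|N1 IH] m l phi.
  rewrite addn0; elim: N2 m l phi => [|N2 IH] m l phi mn.
    rewrite addn0 => ln.
    have -> : bump_wave 0 0 m l phi = wave m l phi.
      by apply/funext => x; apply/funext => z; rewrite /bump_wave !expr0 !mul1r.
    have [ml|] := boolP ((m != 0) || (l != 0)).
      by rewrite orbit_mean_wave// grid_mean_wave.
    rewrite negb_or !negbK => /andP[/eqP -> /eqP ->].
    have -> : wave 0 0 phi = fun _ _ => cos phi.
      by apply/funext => x; apply/funext => z; rewrite /wave !mul0r addr0 mulr0 add0r.
    rewrite /orbit_mean (mean_cst HL) /grid_mean.
    rewrite sumr_const card_ord sumr_const card_ord -mulrnA -[cos phi *+ _]mulr_natl mulrA.
    by rewrite natrM -expr2 mulVf ?mul1r// sqrf_eq0 pnatr_eq0.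
  move=> ln.
  have -> : bump_wave 0 N2.+1 m l phi = fun x z =>
      2^-1 * bump_wave 0 N2 m l phi x z + (4^-1 * bump_wave 0 N2 m (l + 1) (phi - tau * p2) x z +
      4^-1 * bump_wave 0 N2 m (l - 1) (phi + tau * p2) x z).
    apply/funext => x; apply/funext => z; rewrite /bump_wave /wave exprS !expr0 !mul1r.
    have := cosDB (tau * (m%:~R * x + l%:~R * z) + phi) (tau * (z - p2)).
    have -> : tau * (m%:~R * x + l%:~R * z) + phi + tau * (z - p2) =
      tau * (m%:~R * x + (l + 1)%:~R * z) + (phi - tau * p2) by rewrite intrD; ring.
    have -> : tau * (m%:~R * x + l%:~R * z) + phi - tau * (z - p2) =
      tau * (m%:~R * x + (l - 1)%:~R * z) + (phi + tau * p2) by rewrite intrB; ring.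
    by move=> /(canRL (addrK _)) ->; rewrite {1}/bump; field.
  rewrite orbit_mean_lin ?grid_mean_lin; try exact: bseq_bump_wave.
  by rewrite !IH//; clear -ln; lia.
move=> mn ln.
have -> : bump_wave N1.+1 N2 m l phi = fun x z =>
    2^-1 * bump_wave N1 N2 m l phi x z + (4^-1 * bump_wave N1 N2 (m + 1) l (phi - tau * p1) x z +
    4^-1 * bump_wave N1 N2 (m - 1) l (phi + tau * p1) x z).
  apply/funext => x; apply/funext => z; rewrite /bump_wave /wave exprS.
  have := cosDB (tau * (m%:~R * x + l%:~R * z) + phi) (tau * (x - p1)).
  have -> : tau * (m%:~R * x + l%:~R * z) + phi + tau * (x - p1) =
    tau * ((m + 1)%:~R * x + l%:~R * z) + (phi - tau * p1) by rewrite intrD; ring.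
  have -> : tau * (m%:~R * x + l%:~R * z) + phi - tau * (x - p1) =
    tau * ((m - 1)%:~R * x + l%:~R * z) + (phi + tau * p1) by rewrite intrB; ring.
  by move=> /(canRL (addrK _)) ->; rewrite {1}/bump; field.
rewrite orbit_mean_lin ?grid_mean_lin; try exact: bseq_bump_wave.
by rewrite !IH//; clear -mn; lia.
Qed.

End Kronecker.

(** * Density and equidistribution of two-dimensional rotations *)

Section KroneckerTheorem.
Context {R : realType}.

Lemma bernoulli_ge (s : R) (N : nat) : 0 <= s -> 1 + N%:R * s <= (1 + s) ^+ N.
Proof.
move=> s0; elim: N => [|N IH]; first by rewrite mul0r addr0 expr0.
rewrite exprS; apply: (@le_trans _ _ ((1 + s) * (1 + N%:R * s))); last first.
  by rewrite ler_wpM2l// addr_ge0.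
by rewrite -natr1 -subr_ge0 (_ : _ - _ = N%:R * s ^+ 2); [rewrite mulr_ge0// sqr_ge0|ring].
Qed.

Lemma exp_beats_square (rho : R) : 0 <= rho < 1 ->
  exists N : nat, rho ^+ N < (N.+1%:R ^+ 2)^-1.
Proof.
move=> /andP[r0 r1]; pose s := (1 - rho) / 3.
have s0 : 0 < s by rewrite divr_gt0// subr_gt0.
have s1 : s <= 3^-1 by rewrite /s; lra.
(* As rho <= (1 - s) ^ 3, Bernoulli gives rho ^ N * (1 + N * s) ^ 3 <= 1. *)
pose N := Num.bound (s ^- 3); exists N.
rewrite ltNge; apply/negP => h.
have NP : 0 < N.+1%:R :> R by [].
have rs : rho <= (1 - s) ^+ 3.
  have -> : rho = 1 - 3 * s by rewrite /s; field.
  rewrite -subr_ge0 (_ : _ - _ = s ^+ 2 * (3 - s)); last by ring.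
  by rewrite mulr_ge0 ?sqr_ge0//; lra.
clearbody s; have s0' := ltW s0.
have q1 : 0 <= 1 + N%:R * s by rewrite addr_ge0// mulr_ge0.
have q2 : 0 <= 1 - s by lra.
have q3 : 0 <= 1 + s by lra.
have h1 : rho ^+ N * (1 + N%:R * s) ^+ 3 <= 1.
  apply: (@le_trans _ _ (((1 - s) ^+ 3) ^+ N * ((1 + s) ^+ N) ^+ 3)).
    apply: ler_pM; rewrite ?exprn_ge0//.
      by apply: lerXn2r; rewrite ?nnegrE ?exprn_ge0.
    by apply: lerXn2r; rewrite ?nnegrE ?exprn_ge0// bernoulli_ge.
  rewrite exprAC -exprMn -exprMn.
  apply: exprn_ile1; first by rewrite exprn_ge0// mulr_ge0.
  apply: exprn_ile1; first by rewrite mulr_ge0.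
  by rewrite -subr_ge0 (_ : _ - _ = s ^+ 2); [exact: sqr_ge0|ring].
have q4 : 0 < (1 + N%:R * s) ^+ 3 by rewrite exprn_gt0// ltr_pwDl// mulr_ge0.
have h2 : (1 + N%:R * s) ^+ 3 <= N.+1%:R ^+ 2.
  rewrite -[leRHS]mul1r -ler_pdivrMr ?exprn_gt0// mulrC.
  by apply: le_trans h1; rewrite ler_pM2r.
have h3 : (s * N.+1%:R) ^+ 3 <= N.+1%:R ^+ 2.
  apply: le_trans h2; apply: lerXn2r; rewrite ?nnegrE ?q1 ?mulr_ge0//.
  by rewrite -natr1 mulrDr mulr1 mulrC addrC lerD2r; lra.
have h4 : s ^+ 3 * N.+1%:R <= 1.
  move: h3; rewrite exprMn [N.+1%:R ^+ 3]exprSr mulrA mulrAC.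
  by rewrite -[leRHS]mul1r ler_pM2r// exprn_gt0.
have : s ^- 3 < N.+1%:R.
  by apply: (lt_le_trans (archi_boundP _)); rewrite ?invr_ge0 ?exprn_ge0 ?(ltW s0)// ler_nat.
rewrite -[s ^- 3]mulr1 ltr_pdivrMl ?exprn_gt0//.
by rewrite ltNge h4.
Qed.

(** Suppose that the orbit avoids the box of radius e about (p1, p2).  The bump of
exponent N at (p1, p2) has orbit mean at most rho ^ N with rho < 1.  This is also
its mean over a grid of (N + 1) ^ 2 points through (p1, p2), where it takes the
value 1: a contradiction for N large. *)
Lemma kronecker_density (a b : R) :
  (forall m n l : int, m%:~R * a + n%:~R * b = l%:~R -> m = 0 /\ n = 0) ->
  forall p1 p2 e : R, 0 < e -> exists r : nat,
    nearZ (r%:R * a - p1) e /\ nearZ (r%:R * b - p2) e.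
Proof.
move=> indep p1 p2 e e0; wlog e2 : e e0 / e <= 2^-1.
  move=> /(_ (Num.min e 2^-1)) []; rewrite ?lt_min ?e0 ?invr_gt0 ?ltr0n ?ge_min ?lexx ?orbT//.
  by move=> r [[l hl] [l' hl']]; exists r; split; [exists l|exists l'];
    move: hl hl'; rewrite !lt_min => /andP[? ?] /andP[? ?].
apply: contrapT => far.
pose rho := bump e.
have e01 : 0 < e <= 2^-1 by rewrite e0.
have rho1 : 0 <= rho < 1.
  rewrite bump_ge0/= /rho /bump ltr_pdivrMr// mul1r -(natr1 1) ltrD2l.
  rewrite -(@cos0 R) ltr_cos ?mulr_gt0 ?tau_gt0// ?mem_tau ?(ltW e0)//.
  by rewrite in_itv/= lexx pi_ge0.
have [N hN] := exp_beats_square rho1.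
have [L HL] := @ex_invariant_mean R.
have := orbit_grid_mean indep p1 p2 HL (n := N) (N1 := N) (N2 := N) (m := 0) (l := 0) 0.
rewrite add0n => /(_ (ltnSn N) (ltnSn N)).
have low : (N.+1%:R ^+ 2)^-1 <= grid_mean p1 p2 N (bump_wave p1 p2 N N 0 0 0).
  rewrite /grid_mean ler_peMr ?invr_ge0 ?exprn_ge0// big_ord_recl big_ord_recl.
  have w1 x z : wave 0 0 0 x z = 1 :> R by rewrite /wave !mul0r !addr0 mulr0 cos0.
  have b0 x z : 0 <= bump_wave p1 p2 N N 0 0 0 x z.
    by rewrite /bump_wave w1 !mulr_ge0// exprn_ge0 ?bump_ge0.
  have -> : bump_wave p1 p2 N N 0 0 0 (p1 + (@ord0 N)%:R / N.+1%:R) (p2 + (@ord0 N)%:R / N.+1%:R) = 1.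
    rewrite /bump_wave w1 mul0r !addr0 !subrr mulr1 /bump mulr0 cos0.
    by rewrite -(natr1 1) divff// !expr1n mulr1.
  by rewrite -addrA lerDl addr_ge0// !sumr_ge0// => i _; rewrite sumr_ge0.
have up : orbit_mean a b L (bump_wave p1 p2 N N 0 0 0) <= rho ^+ N.
  rewrite -[leRHS](mean_cst HL); apply: (le_mean HL); first exact: bseq_bump_wave.
    exact: bseq_cst.
  move=> k; rewrite /bump_wave /wave !mul0r !addr0 mulr0 cos0 mulr1 -exprMn.
  rewrite lerXn2r ?nnegrE ?mulr_ge0 ?bump_ge0//.
  have far1 x : ~ nearZ x e -> bump x <= rho.
    move=> nx; rewrite leNgt; apply/negP => h; apply: nx; apply: cos_nearZ => //.
    by move: h; rewrite /rho /bump ltr_pM2r ?invr_gt0// ltrD2l.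
  have [n1|f1] := pselect (nearZ (k%:R * a - p1) e); last first.
    by rewrite -[rho]mulr1 ler_pM ?bump_ge0 ?bump_le1// far1.
  have [n2|f2] := pselect (nearZ (k%:R * b - p2) e); last first.
    by rewrite -[rho]mul1r ler_pM ?bump_ge0 ?bump_le1// far1.
  by exfalso; apply: far; exists k.
by move=> E; move: (le_lt_trans up hN); rewrite E ltNge low.
Qed.

Lemma cvg0_sum (I : finType) (f : I -> nat -> R) :
  (forall i, f i n @[n --> \oo] --> (0 : R)) ->
  (\sum_i f i n) @[n --> \oo] --> (0 : R).
Proof.
move=> f0; elim: (index_enum I) => [|i r IH].
  by under eq_fun do rewrite big_nil; exact: cvg_cst.
under eq_fun do rewrite big_cons.
by have := cvgD (f0 i) IH; rewrite addr0; exact.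
Qed.

Section Weyl.
Variables (alpha beta xi zeta : R).
Let X (k : nat) := xi + k%:R * alpha.
Let Z (k : nat) := zeta + k%:R * beta.
Hypothesis kron : forall p1 p2 e : R, 0 < e -> exists r : nat,
  nearZ (r%:R * alpha - p1) e /\ nearZ (r%:R * beta - p2) e.
Variable H : R -> R -> R.
Hypothesis H_bnd : exists b : R, forall x z, `|H x z| <= b.
Hypothesis H_perx : forall x z, H (x + 1) z = H x z.
Hypothesis H_perz : forall x z, H x (z + 1) = H x z.
Hypothesis H_cont : forall e : R, 0 < e -> exists2 d : R, 0 < d & forall (x x' z z' : R),
  `|x - x'| < d -> `|z - z'| < d -> `|H x z - H x' z'| < e.

Let bH (f g : nat -> R) : bseq (fun k => H (f k) (g k)).
Proof. by have [b hb] := H_bnd; exists b. Qed.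

Let H_pers (M l : int) x z : H (x + M%:~R) (z + l%:~R) = H x z.
Proof.
have /(_ M x) := periodic_int_shift (f := fun x => H x (z + l%:~R)) (fun x => H_perx x _).
rewrite mulr1 => ->.
by have /(_ l z) := periodic_int_shift (f := fun z => H x z) (H_perz x); rewrite mulr1.
Qed.

(** By Kronecker density the translation is close to a time shift, and averages
ignore time shifts. *)
Lemma cesaro_translate p1 p2 :
  cesaro (fun k => H (X k + p1) (Z k + p2)) n - cesaro (fun k => H (X k) (Z k)) n
    @[n --> \oo] --> (0 : R).
Proof.
apply/cvgrPdist_le => e e0.
have e20 : 0 < e / 2 by rewrite divr_gt0.
have [d d0 hd] := H_cont e20.
have [r [[M hM] [l hl]]] := kron p1 p2 d0.
have := cesaro_shift_cvg r (bH X Z) => /cvgrPdist_le/(_ _ e20)[N _ hN].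
exists N => // n /= /hN /=; rewrite !sub0r !normrN => h.
have -> : cesaro (fun k => H (X k + p1) (Z k + p2)) n - cesaro (fun k => H (X k) (Z k)) n =
  cesaro (fun k => H (X k + p1) (Z k + p2) - H (X (k + r)%N) (Z (k + r)%N)) n +
  (cesaro (fun k => H (X (k + r)%N) (Z (k + r)%N)) n - cesaro (fun k => H (X k) (Z k)) n).
  by rewrite cesaroB addrA subrK.
apply: le_trans (ler_normD _ _) _; rewrite [leRHS]splitr lerD//.
apply: cesaro_bound => [|k]; first exact: ltW.
rewrite -(H_pers (- M) (- l) (X (k + r)%N)) !intrN; apply/ltW/hd.
  have -> : X k + p1 - (X (k + r)%N - M%:~R) = - (r%:R * alpha - p1 - M%:~R).
    by rewrite /X natrD; ring.
  by rewrite normrN.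
have -> : Z k + p2 - (Z (k + r)%N - l%:~R) = - (r%:R * beta - p2 - l%:~R).
  by rewrite /Z natrD; ring.
by rewrite normrN.
Qed.

Definition grid_avg m x z := (m.+1%:R ^+ 2)^-1 *
  \sum_(i < m.+1) \sum_(j < m.+1) H (x + i%:R / m.+1%:R) (z + j%:R / m.+1%:R).

Lemma grid_avg_perx m x z : grid_avg m (x + m.+1%:R^-1) z = grid_avg m x z.
Proof.
rewrite /grid_avg; congr (_ * _).
rewrite -[RHS](@sum_cyclic_shift R _ (fun i => \sum_(j < m.+1) H (x + i%:R / m.+1%:R) (z + j%:R / m.+1%:R))).
  apply: eq_bigr => i _; apply: eq_bigr => j _; congr (H _ _).
  by rewrite -[i.+1%:R]natr1; ring.
by apply: eq_bigr => j _; rewrite divff// mul0r addr0 H_perx.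
Qed.

Lemma grid_avg_perz m x z : grid_avg m x (z + m.+1%:R^-1) = grid_avg m x z.
Proof.
rewrite /grid_avg; congr (_ * _); apply: eq_bigr => i _.
rewrite -[RHS](@sum_cyclic_shift R _ (fun j => H (x + i%:R / m.+1%:R) (z + j%:R / m.+1%:R))).
  by apply: eq_bigr => j _; congr (H _ _); rewrite -[j.+1%:R]natr1; ring.
by rewrite divff// mul0r addr0 H_perz.
Qed.

(** The grid average has period 1 / (m + 1) in both variables, so the base points
may be taken close to each other. *)
Lemma grid_avg_close m (e d : R) x z x' z' :
  (forall (x x' z z' : R), `|x - x'| < d -> `|z - z'| < d -> `|H x z - H x' z'| < e) ->
  m.+1%:R^-1 < d -> `|grid_avg m x z - grid_avg m x' z'| <= e.
Proof.
move=> hd md.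
have m0 : 0 < m.+1%:R^-1 :> R by rewrite invr_gt0.
have reduce (u v : R) : exists M : int, `|u - (v + M%:~R * m.+1%:R^-1)| < d.
  exists (Num.floor ((u - v) * m.+1%:R)).
  have h1 := floor_le ((u - v) * m.+1%:R); have h2 := floorD1_gt ((u - v) * m.+1%:R).
  set F := Num.floor _ in h1 h2 *; rewrite intrD in h2.
  have -> : u - (v + F%:~R / m.+1%:R) = ((u - v) * m.+1%:R - F%:~R) / m.+1%:R.
    by field; rewrite addrC natr1.
  rewrite ger0_norm; last by rewrite divr_ge0// subr_ge0.
  apply: lt_trans md; rewrite ltr_pdivrMr// mulVf//; lra.
have [M hM] := reduce x x'; have [l hl] := reduce z z'.
have <- : grid_avg m (x' + M%:~R * m.+1%:R^-1) (z' + l%:~R * m.+1%:R^-1) = grid_avg m x' z'.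
  rewrite (periodic_int_shift (f := fun x => grid_avg m x _))//; last by move=> y; exact: grid_avg_perx.
  by rewrite (periodic_int_shift (f := fun z => grid_avg m x' z))// => y; exact: grid_avg_perz.
rewrite /grid_avg -mulrBr normrM ger0_norm ?invr_ge0 ?exprn_ge0//.
rewrite ler_pdivrMl ?exprn_gt0// -sumrB.
apply: le_trans (ler_norm_sum _ _ _) _.
have -> : m.+1%:R ^+ 2 * e = \sum_(i < m.+1) \sum_(j < m.+1) e.
  by rewrite !sumr_const !card_ord -mulrnA -[RHS]mulr_natl natrM expr2.
apply: ler_sum => i _; rewrite -sumrB; apply: le_trans (ler_norm_sum _ _ _) _.
apply: ler_sum => j _; apply: ltW; apply: hd.
  by rewrite opprD addrACA subrr addr0.
by rewrite opprD addrACA subrr addr0.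
Qed.

Lemma cesaro_grid_avg m :
  cesaro (fun k => grid_avg m (X k) (Z k)) n - cesaro (fun k => H (X k) (Z k)) n
    @[n --> \oo] --> (0 : R).
Proof.
have -> : (fun n => cesaro (fun k => grid_avg m (X k) (Z k)) n - cesaro (fun k => H (X k) (Z k)) n) =
  fun n => (m.+1%:R ^+ 2)^-1 * \sum_(i < m.+1) \sum_(j < m.+1)
    (cesaro (fun k => H (X k + i%:R / m.+1%:R) (Z k + j%:R / m.+1%:R)) n -
     cesaro (fun k => H (X k) (Z k)) n).
  apply/funext => n; under [in RHS]eq_bigr do rewrite sumrB.
  rewrite sumrB mulrBr; congr (_ - _).
    rewrite /grid_avg cesaroZ; congr (_ * _).
    rewrite /cesaro exchange_big mulr_sumr; apply: eq_bigr => i _ /=.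
    by rewrite exchange_big mulr_sumr.
  by rewrite !sumr_const !card_ord -mulrnA -[cesaro _ _ *+ _]mulr_natl natrM -expr2 mulKf// sqrf_eq0.
pose D (i j : 'I_m.+1) n :=
  cesaro (fun k => H (X k + i%:R / m.+1%:R) (Z k + j%:R / m.+1%:R)) n -
  cesaro (fun k => H (X k) (Z k)) n.
have D0 : (\sum_i \sum_j D i j n) @[n --> \oo] --> (0 : R).
  apply: (@cvg0_sum _ (fun i n => \sum_j D i j n)) => i.
  by apply: (@cvg0_sum _ (D i)) => j; exact: cesaro_translate.
rewrite -[X in _ --> X](mulr0 (m.+1%:R ^+ 2)^-1); apply: cvgM; [exact: cvg_cst|exact: D0].
Qed.

(** Averaging over the translates by a grid leaves the Cesaro averages unchanged in
the limit and makes the function almost constant. *)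
Lemma weyl_grid_avg m (e d : R) x0 z0 : 0 < e ->
  (forall (x x' z z' : R), `|x - x'| < d -> `|z - z'| < d -> `|H x z - H x' z'| < e) ->
  m.+1%:R^-1 < d ->
  \forall n \near \oo, `|cesaro (fun k => H (X k) (Z k)) n - grid_avg m x0 z0| <= e + e.
Proof.
move=> e0 hd md.
have := cesaro_grid_avg m => /cvgrPdist_le/(_ _ e0)[N _ hN].
exists N.+1 => // n /= Nn; have /= := hN n (ltnW Nn).
rewrite sub0r normrN distrC => h.
rewrite -(subrK (cesaro (fun k => grid_avg m (X k) (Z k)) n) (cesaro _ n)) -addrA.
apply: le_trans (ler_normD _ _) _; rewrite lerD//.
case: n Nn {h} => // n _.
rewrite -(cesaro_cst (grid_avg m x0 z0) n) -cesaroB.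
by apply: cesaro_bound => [|k]; [exact: ltW|exact: grid_avg_close hd md].
Qed.

End Weyl.
End KroneckerTheorem.

(** * Riemann sums for the volume integral *)

Section Volume.
Context {R : realType}.
Notation mu := (@lebesgue_measure R).
Notation mu3 := (@lebesgue3 R).
Implicit Types p q : R * R * R.

Definition box (c : R * R * R) (w : R) : set (R * R * R) :=
  (`[c.1.1, c.1.1 + w[ `*` `[c.1.2, c.1.2 + w[) `*` `[c.2, c.2 + w[.

Lemma measurable_box c w : measurable (box c w).
Proof. by apply: measurableX; first apply: measurableX. Qed.

Lemma lebesgue3_prod (A B C : set R) : measurable A -> measurable B -> measurable C ->
  mu3 ((A `*` B) `*` C) = (mu A * mu B * mu C)%E.
Proof.
move=> mA mB mC; rewrite /lebesgue3 product_measure1E//; last exact: measurableX.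
by congr (_ * _)%E; exact: product_measure1E.
Qed.

Lemma lebesgue3_box c w : 0 < w -> mu3 (box c w) = (w ^+ 3)%:E.
Proof.
move=> w0; have len (x : R) : mu `[x, x + w[ = w%:E.
  by rewrite lebesgue_measure_itv/= lte_fin ltrDl w0 -EFinD addrAC subrr add0r.
by rewrite lebesgue3_prod// !len -!EFinM !exprS expr0 mulr1 mulrA.
Qed.

Lemma measurable_L_solid : measurable (L_solid R).
Proof.
apply: fin_bigcup_measurable; first exact: finite_finset.
move=> i _.
have -> : cube R i = (`[(cube_corner R i).1.1, (cube_corner R i).1.1 + 1] `*`
   `[(cube_corner R i).1.2, (cube_corner R i).1.2 + 1]) `*`
   `[(cube_corner R i).2, (cube_corner R i).2 + 1].
  apply/seteqP; split=> p; rewrite /cube /= !in_itv/=; first by case.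
  by case=> [[]].
by apply: measurableX; first apply: measurableX.
Qed.

Lemma L_solidP p : L_solid R p <->
  [/\ 0 <= p.1.1 <= 2, 0 <= p.1.2 <= 2, 0 <= p.2 <= 1 & (p.1.1 <= 1) || (p.1.2 <= 1)].
Proof.
case: p => [[x y] z] /=; split.
  move=> [i _]; rewrite /cube /cube_corner; case: i => -[|[|[|//]]] i3 /= [];
  move=> /andP[? ?] /andP[? ?] /andP[? ?].
  - by split; apply/andP || apply/orP; [split; lra..|left; lra].
  - by split; apply/andP || apply/orP; [split; lra..|left; lra].
  - by split; apply/andP || apply/orP; [split; lra..|right; lra].
move=> [/andP[x0 x2] /andP[y0 y2] /andP[z0 z1] xy].
have [x1|x1] := leP x 1; last first.
  rewrite leNgt x1/= in xy.
  by exists (@Ordinal 3 2 isT) => //; rewrite /cube /=; split; apply/andP; split; lra.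
have [y1|y1] := leP y 1.
  by exists (@Ordinal 3 1 isT) => //; rewrite /cube /=; split; apply/andP; split; lra.
by exists (@Ordinal 3 0 isT) => //; rewrite /cube /=; split; apply/andP; split; lra.
Qed.

Lemma lebesgue3_L_solid_lty : (mu3 (L_solid R) < +oo)%E.
Proof.
pose B : set (R * R * R) := (`[0%R, 2%R] `*` `[0%R, 2%R]) `*` `[0%R, 2%R].
have mB : measurable B by apply: measurableX; first apply: measurableX.
apply: (@le_lt_trans _ _ (mu3 B)).
  apply: le_measure; rewrite ?inE//; first exact: measurable_L_solid.
  move=> p /L_solidP[? ? /andP[? ?] _]; split; [split|]; rewrite /= in_itv/=//.
  by apply/andP; split; lra.
rewrite lebesgue3_prod// lebesgue_measure_itv/= lte_fin ltr0n/= -EFinD -!EFinM.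
exact: ltry.
Qed.

Variable F : R * R * R -> R.
Hypothesis F_bnd : exists B : R, forall p, L_solid R p -> `|F p| <= B.
Hypothesis F_unif : forall e : R, 0 < e -> exists2 d : R, 0 < d &
  forall p q, L_solid R p -> L_solid R q -> `|p.1.1 - q.1.1| < d ->
    `|p.1.2 - q.1.2| < d -> `|p.2 - q.2| < d -> `|F p - F q| < e.

Definition grid_floor (m : nat) (x : R) : R := (Num.floor (x * m.+1%:R))%:~R / m.+1%:R.

Lemma grid_floor_itv m x : grid_floor m x <= x < grid_floor m x + m.+1%:R^-1.
Proof.
have h1 := floor_le (x * m.+1%:R); have h2 := floorD1_gt (x * m.+1%:R).
rewrite intrD in h2; rewrite /grid_floor ler_pdivrMr// h1/=.
by rewrite -{2}[m.+1%:R^-1]mul1r -mulrDl ltr_pdivlMr.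
Qed.

Lemma le_grid_floor m (n : nat) x : n%:R <= x -> n%:R <= grid_floor m x.
Proof.
move=> nx; rewrite /grid_floor ler_pdivlMr// -natrM pmulrn ler_int floor_ge_int -pmulrn natrM.
by rewrite ler_pM2r.
Qed.

Definition grid_floor3 m p : R * R * R := (grid_floor m p.1.1, grid_floor m p.1.2, grid_floor m p.2).

Lemma L_solid_grid_floor3 m p : L_solid R p -> L_solid R (grid_floor3 m p).
Proof.
move=> /L_solidP[/andP[x0 x2] /andP[y0 y2] /andP[z0 z1] xy]; apply/L_solidP => /=.
have f x : grid_floor m x <= x by have /andP[] := grid_floor_itv m x.
have f0 x : 0 <= x -> 0 <= grid_floor m x by exact: (@le_grid_floor m 0).
rewrite !f0//=; split.
- exact: le_trans x2.
- exact: le_trans y2.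
- exact: le_trans z1.
- by move: xy => /orP[/(le_trans (f _)) -> //|/(le_trans (f _)) ->]; rewrite orbT.
Qed.

Definition grid_pt (m : nat) (abc : 'I_(2 * m.+1).+1 * 'I_(2 * m.+1).+1 * 'I_(2 * m.+1).+1) : R * R * R :=
  (abc.1.1%:R / m.+1%:R, abc.1.2%:R / m.+1%:R, abc.2%:R / m.+1%:R).

Lemma grid_floorP m x : 0 <= x <= 2 -> exists2 a : 'I_(2 * m.+1).+1, grid_floor m x = a%:R / m.+1%:R &
  x \in `[a%:R / m.+1%:R, a%:R / m.+1%:R + m.+1%:R^-1[.
Proof.
move=> /andP[x0 x2].
have f0 : 0 <= Num.floor (x * m.+1%:R) by rewrite floor_ge0 mulr_ge0.
have e : (absz (Num.floor (x * m.+1%:R)))%:R = (Num.floor (x * m.+1%:R))%:~R :> R.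
  by rewrite pmulrn gez0_abs.
have lt : (absz (Num.floor (x * m.+1%:R)) < (2 * m.+1).+1)%N.
  rewrite ltnS -(ler_nat R) e; apply: le_trans (floor_le _) _.
  by rewrite natrM ler_pM2r.
exists (Ordinal lt); rewrite /= e//.
by rewrite in_itv/=; exact: grid_floor_itv.
Qed.

Lemma grid_floor_uniq m (a : nat) x : a%:R / m.+1%:R <= x < a%:R / m.+1%:R + m.+1%:R^-1 ->
  grid_floor m x = a%:R / m.+1%:R.
Proof.
move=> /andP[h1 h2]; rewrite /grid_floor (@floor_def _ _ a)//.
rewrite -pmulrn intrD -pmulrn; apply/andP; split; first by rewrite -ler_pdivrMr.
by rewrite -ltr_pdivlMr// mulrDl mul1r.
Qed.

(** By uniform continuity F is the limit of its values at the grid points below,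
which are step functions. *)
Lemma measurable_F : measurable_fun (L_solid R) F.
Proof.
apply: (@measurable_realfun.measurable_fun_cvg _ _ _ _ (fun m p => F (grid_floor3 m p))).
  move=> m mL Y mY.
  have -> : L_solid R `&` (fun p => F (grid_floor3 m p)) @^-1` Y = L_solid R `&`
     \big[setU/set0]_(i : 'I_(2 * m.+1).+1 * 'I_(2 * m.+1).+1 * 'I_(2 * m.+1).+1 |
         F (grid_pt i) \in Y) box (grid_pt i) m.+1%:R^-1.
    apply/seteqP; split => p [Lp] /=.
      move=> Yp; split => //; rewrite -bigcup_seq_cond.
      have /L_solidP[x2 y2 /andP[z0 z1] _] := Lp.
      have [a ea xa] := grid_floorP m x2; have [b eb yb] := grid_floorP m y2.
      have [|c ec zc] := @grid_floorP m p.2; first by apply/andP; split; lra.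
      exists (a, b, c) => /=.
        by rewrite mem_index_enum/= inE /grid_pt/= -ea -eb -ec.
      by [].
    rewrite -bigcup_seq_cond => -[[[a b] c] /=].
    rewrite mem_index_enum/= inE => Yg [[/= xa yb] zc]; split => //.
    rewrite !in_itv/= in xa yb zc.
    by rewrite /grid_floor3 (grid_floor_uniq xa) (grid_floor_uniq yb) (grid_floor_uniq zc).
  apply: measurableI => //; apply: bigsetU_measurable => i _; exact: measurable_box.
move=> p Lp; apply/cvgrPdist_lt => e e0.
have [d d0 hd] := F_unif e0.
exists (Num.bound d^-1) => // m /= hm.
have md : m.+1%:R^-1 < d.
  rewrite -[d]invrK ltf_pV2 ?posrE ?invr_gt0//.
  apply: (lt_le_trans (archi_boundP _)); rewrite ?invr_ge0 ?(ltW d0)//.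
  by rewrite ler_nat; apply: leq_trans hm _.
have f x : `|x - grid_floor m x| < d.
  have /andP[h1 h2] := grid_floor_itv m x; rewrite ger0_norm ?subr_ge0//.
  by apply: lt_trans md; rewrite ltrBlDl.
by apply: hd => //; exact: L_solid_grid_floor3.
Qed.

Lemma integrable_F D : measurable D -> D `<=` L_solid R -> mu3.-integrable D (EFin \o F).
Proof.
move=> mD DL; apply: (@integrableS _ _ _ mu3 (L_solid R)) => //; first exact: measurable_L_solid.
apply: measurable_bounded_integrable.
- exact: measurable_L_solid.
- exact: lebesgue3_L_solid_lty.
- exact: measurable_F.
- have [B hB] := F_bnd; exists B; split; rewrite ?num_real// => M BM p Lp.
  exact: le_trans (hB _ Lp) (ltW BM).
Qed.

Lemma box_integral c (w e : R) : 0 < w -> box c w `<=` L_solid R ->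
  (forall p, box c w p -> `|F p - F c| <= e) ->
  `|\int[mu3]_(p in box c w) F p - w ^+ 3 * F c| <= w ^+ 3 * e.
Proof.
move=> w0 bL he.
have mb := measurable_box c w.
have iF := integrable_F mb bL.
have ic (r : R) : mu3.-integrable (box c w) (EFin \o (fun=> r)).
  apply: measurable_bounded_integrable => //.
  - by rewrite [X in (X < _)%E](lebesgue3_box c w0) ltry.
  - by exists `|r|; split; rewrite ?num_real// => M rM p _; exact: ltW.
have cst (r : R) : \int[mu3]_(p in box c w) r = w ^+ 3 * r.
  by rewrite Rintegral_cst// [X in fine X](lebesgue3_box c w0)/= mulrC.
have iD : mu3.-integrable (box c w) (EFin \o (fun p => F p - F c)).
  rewrite (_ : EFin \o _ = ((EFin \o F) \- (EFin \o (fun=> F c)))%E)//.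
  by apply: integrableB => //; exact: ic.
rewrite -cst -RintegralB//; apply: le_trans (le_normr_Rintegral _ _) _ => //.
rewrite -cst; apply: le_Rintegral => //.
have := integrable_norm iD; congr (mu3.-integrable _ _).
Qed.

Definition cell (m : nat) (i : 'I_3 * ('I_m.+1 * 'I_m.+1 * 'I_m.+1)) : R * R * R :=
  ((cube_corner R i.1).1.1 + i.2.1.1%:R / m.+1%:R,
   (cube_corner R i.1).1.2 + i.2.1.2%:R / m.+1%:R,
   (cube_corner R i.1).2 + i.2.2%:R / m.+1%:R).

Arguments cell m i : clear implicits.

Lemma cube_cornerE (i : 'I_3) :
  cube_corner R i = ((i == 2 :> nat)%:R, (i == 0 :> nat)%:R, 0).
Proof. by case: i => -[|[|[|]]]. Qed.

Lemma cell_cube m i p : box (cell m i) m.+1%:R^-1 p -> cube R i.1 p.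
Proof.
have h (k : 'I_m.+1) : 0 <= k%:R / m.+1%:R :> R /\ k%:R / m.+1%:R + m.+1%:R^-1 <= 1 :> R.
  split; first by rewrite divr_ge0.
  rewrite -{2}[m.+1%:R^-1]mul1r -mulrDl ler_pdivrMr// mul1r natr1 ler_nat; exact: ltn_ord.
have aux (c u w x : R) : 0 <= u /\ u + w <= 1 -> c + u <= x < c + u + w -> c <= x <= c + 1.
  by move=> [? ?] /andP[? ?]; apply/andP; split; lra.
case: i => i [[a b] c] [[/=]]; rewrite !in_itv/= => xi yi zi.
by split; [exact: aux (h a) xi|exact: aux (h b) yi|exact: aux (h c) zi].
Qed.

Lemma cell_L_solid m i : box (cell m i) m.+1%:R^-1 `<=` L_solid R.
Proof. by move=> p /cell_cube ?; exists i.1. Qed.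

Lemma grid1 m (x : R) : 0 <= x < 1 -> exists a : 'I_m.+1,
  a%:R / m.+1%:R <= x < a%:R / m.+1%:R + m.+1%:R^-1.
Proof.
move=> /andP[x0 x1].
have [|a ea] := @grid_floorP m x; first by apply/andP; split; lra.
rewrite in_itv/= => h; move: (h) => /andP[h1 _].
have am : (a < m.+1)%N.
  by rewrite -(ltr_nat R) -[ltRHS]mul1r -ltr_pdivrMr//; exact: le_lt_trans x1.
by exists (Ordinal am).
Qed.

Lemma cell_index_uniq m (b b' : bool) (a a' : 'I_m.+1) (x : R) :
  b%:R + a%:R / m.+1%:R <= x < b%:R + a%:R / m.+1%:R + m.+1%:R^-1 ->
  b'%:R + a'%:R / m.+1%:R <= x < b'%:R + a'%:R / m.+1%:R + m.+1%:R^-1 ->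
  b = b' /\ a = a'.
Proof.
have nat_form (c : bool) (k : nat) : c%:R + k%:R / m.+1%:R = (c * m.+1 + k)%:R / m.+1%:R :> R.
  by rewrite natrD natrM mulrDl mulfK.
rewrite !nat_form => /grid_floor_uniq e1 /grid_floor_uniq; rewrite e1 => /(congr1 (fun y => y * m.+1%:R)).
rewrite !divfK// => /eqP; rewrite eqr_nat => /eqP e.
have bb : b = b'.
  by move: e {e1} (ltn_ord a) (ltn_ord a'); case: b; case: b' => //; clear; lia.
by split => //; apply: val_inj => /=; move: e; rewrite bb => /addnI.
Qed.

Lemma cells_disjoint m (D : set _) : trivIset D (fun i => box (cell m i) m.+1%:R^-1).
Proof.
apply/trivIsetP => -[i [[a b] c]] [i' [[a' b'] c']] _ _; apply: contra_neqP => /eqP.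
move=> /set0P[p [[[/= xi yi] zi] [[/= xi' yi'] zi']]].
move: xi yi zi xi' yi' zi'; rewrite !in_itv/= !cube_cornerE/= => xi yi zi xi' yi' zi'.
have [e1 ea] := cell_index_uniq xi xi'; have [e2 eb] := cell_index_uniq yi yi'.
have [_ ec] := @cell_index_uniq m false false c c' p.2 zi zi'.
rewrite ea eb ec; congr (_, _); move: e1 e2 {xi yi xi' yi'}.
by case: i => -[|[|[|]]]// ?; case: i' => -[|[|[|]]]// ? _ _; exact: val_inj.
Qed.

(** The null set by which the solid and the union of the half-open cells may
differ. *)
Definition far_faces : set (R * R * R) :=
  ((([set 1%R] `*` setT) `*` setT) `|` (([set 2%R] `*` setT) `*` setT)) `|`
  (((setT `*` [set 1%R]) `*` setT) `|` ((setT `*` [set 2%R]) `*` setT)) `|`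
  (setT `*` setT) `*` [set 1%R].

Lemma measurable_far_faces : measurable far_faces.
Proof. by do ?[apply: measurableU|apply: measurableX]. Qed.

Lemma far_faces0 : mu3 far_faces = 0%E.
Proof.
have neg (A B C : set R) : measurable A -> measurable B -> measurable C ->
    (mu A * mu B * mu C)%E = 0%E -> mu3.-negligible ((A `*` B) `*` C).
  move=> mA mB mC z; exists ((A `*` B) `*` C); split => //.
    by apply: measurableX => //; exact: measurableX.
  by rewrite lebesgue3_prod.
have m1 (x : R) : measurable [set x] by exact: measurable_set1.
have mT : measurable [set: R] by exact: measurableT.
suff [B [mB B0 NB]] : mu3.-negligible far_faces.
  apply/eqP; rewrite eq_le measure_ge0 andbT -[X in (_ <= X)%E]B0.
  by apply: le_measure; rewrite ?inE//; exact: measurable_far_faces.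
apply: negligibleU; [apply: negligibleU; apply: negligibleU|]; apply: neg => //;
  by rewrite lebesgue_measure_set1 ?mul0e ?mule0 ?mul0e.
Qed.

Lemma L_solid_cells m : L_solid R `\` far_faces =
  (\big[setU/set0]_(i <- enum {: 'I_3 * ('I_m.+1 * 'I_m.+1 * 'I_m.+1)}) box (cell m i) m.+1%:R^-1)
    `\` far_faces.
Proof.
apply/seteqP; split => p [Lp nf]; split => //; last first.
  by move: Lp; rewrite -bigcup_seq => -[i _]; exact: cell_L_solid.
rewrite -bigcup_seq.
suff [i ip] : exists i, box (cell m i) m.+1%:R^-1 p by exists i => //=; rewrite mem_enum.
move: Lp => /L_solidP[/andP[x0 x2] /andP[y0 y2] /andP[z0 z1] xy].
have x1 : p.1.1 != 1 by apply/eqP => h; apply: nf; left; left; left; split.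
have x2' : p.1.1 != 2 by apply/eqP => h; apply: nf; left; left; right; split.
have y1 : p.1.2 != 1 by apply/eqP => h; apply: nf; left; right; left; split.
have y2' : p.1.2 != 2 by apply/eqP => h; apply: nf; left; right; right; split.
have z1' : p.2 != 1 by apply/eqP => h; apply: nf; right; split.
have {}z1 : p.2 < 1 by rewrite lt_neqAle z1'.
have {}x2 : p.1.1 < 2 by rewrite lt_neqAle x2'.
have {}y2 : p.1.2 < 2 by rewrite lt_neqAle y2'.
have [|c hc] := @grid1 m p.2; first by rewrite z0.
have mk (i : 'I_3) : (cube_corner R i).1.1 <= p.1.1 < (cube_corner R i).1.1 + 1 ->
    (cube_corner R i).1.2 <= p.1.2 < (cube_corner R i).1.2 + 1 ->
    exists i, box (cell m i) m.+1%:R^-1 p.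
  move=> /andP[u1 u2] /andP[v1 v2].
  have [|a ha] := @grid1 m (p.1.1 - (cube_corner R i).1.1); first by apply/andP; split; lra.
  have [|b hb] := @grid1 m (p.1.2 - (cube_corner R i).1.2); first by apply/andP; split; lra.
  exists (i, (a, b, c)); rewrite /box /=.
  move: ha hb => /andP[? ?] /andP[? ?]; split; [split|]; rewrite /= in_itv/=.
  - by rewrite -lerBrDl -addrA -ltrBlDl; apply/andP.
  - by rewrite -lerBrDl -addrA -ltrBlDl; apply/andP.
  - by rewrite cube_cornerE/= add0r.
have [xs|xb] := ltP p.1.1 1; last first.
  have xg : 1 < p.1.1 by rewrite lt_neqAle eq_sym x1.
  rewrite leNgt xg/= in xy.
  have yl : p.1.2 < 1 by rewrite lt_neqAle y1.
  by apply: (mk (@Ordinal 3 2 isT)); rewrite cube_cornerE/=; apply/andP; split; lra.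
have [ys|yb] := ltP p.1.2 1.
  by apply: (mk (@Ordinal 3 1 isT)); rewrite cube_cornerE/=; apply/andP; split; lra.
by apply: (mk (@Ordinal 3 0 isT)); rewrite cube_cornerE/=; apply/andP; split; lra.
Qed.

Lemma integral_riemann_sum m (e d : R) :
  (forall p q, L_solid R p -> L_solid R q -> `|p.1.1 - q.1.1| < d ->
    `|p.1.2 - q.1.2| < d -> `|p.2 - q.2| < d -> `|F p - F q| < e) ->
  m.+1%:R^-1 < d ->
  `|\int[mu3]_(p in L_solid R) F p - m.+1%:R^-1 ^+ 3 * \sum_i F (cell m i)| <= 3 * e.
Proof.
move=> hd md; set w := m.+1%:R^-1 : R.
have w0 : 0 < w by rewrite invr_gt0.
pose D := \big[setU/set0]_(i <- enum {: 'I_3 * ('I_m.+1 * 'I_m.+1 * 'I_m.+1)}) box (cell m i) w.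
have mD : measurable D by apply: bigsetU_measurable => i _; exact: measurable_box.
have DL : D `<=` L_solid R.
  by move=> p; rewrite /D -bigcup_seq => -[i _]; exact: cell_L_solid.
have mL := measurable_L_solid.
have -> : \int[mu3]_(p in L_solid R) F p = \int[mu3]_(p in D) F p.
  rewrite /Rintegral; congr fine.
  have strip E : measurable E -> E `<=` L_solid R ->
      (\int[mu3]_(p in E) (F p)%:E = \int[mu3]_(p in E `\` far_faces) (F p)%:E)%E.
    move=> mE EL; apply: negligible_integral => //.
    - exact: measurable_far_faces.
    - exact: integrable_F.
    - exact: far_faces0.
  by rewrite (strip _ mL)// (strip _ mD DL) (L_solid_cells m).
have -> : \int[mu3]_(p in D) F p = \sum_i \int[mu3]_(p in box (cell m i) w) F p.
  rewrite /Rintegral integral_bigsetU_EFin.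
  - rewrite -big_enum/= -sum_fine// => i _.
    by apply: integrable_fin_num; [exact: measurable_box|apply: integrable_F; [exact: measurable_box|exact: cell_L_solid]].
  - by move=> i; exact: measurable_box.
  - exact: enum_uniq.
  - exact: cells_disjoint.
  - exact: (measurable_int mu3 (integrable_F mD DL)).
rewrite mulr_sumr -sumrB; apply: le_trans (ler_norm_sum _ _ _) _.
have -> : 3 * e = \sum_(i : 'I_3 * ('I_m.+1 * 'I_m.+1 * 'I_m.+1)) w ^+ 3 * e.
  rewrite sumr_const !card_prod !card_ord -[RHS]mulr_natl !natrM mulrA; congr (_ * e).
  by rewrite /w; field; rewrite addrC natr1.
apply: ler_sum => i _; apply: box_integral => //; first exact: cell_L_solid.
move=> p bp; have [[xp yp] zp] := bp.
rewrite /= !in_itv/= in xp yp zp.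
have near (x c : R) : c <= x < c + w -> `|x - c| < d.
  by move=> /andP[? ?]; rewrite ger0_norm; [apply: lt_trans md; rewrite -/w; lra|lra].
apply/ltW/hd; [exact: cell_L_solid bp| |exact: near..].
apply: (@cell_L_solid m i); rewrite /box /=.
by split; [split|]; rewrite /= in_itv/= lexx/= ltrDl.
Qed.

End Volume.
Arguments cell {R} m i.

(** * Riemann sums for the time average *)

Section TimeAverage.
Context {R : realType}.
Notation mu := (@lebesgue_measure R).
Variables (G : R -> R) (B : R).
Hypothesis G_cont : forall T : R, 0 < T -> {within `[0, T], continuous G}.
Hypothesis G_bnd : forall t : R, 0 <= t -> `|G t| <= B.

Let I (T : R) := \int[mu]_(t in `[0, T]) G t.

Let integrable_G (T : R) : mu.-integrable `[0, T] (EFin \o G).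
Proof.
have [T0|T0] := ltP 0 T.
  by apply: continuous_compact_integrable; [exact: segment_compact|exact: G_cont].
have i1 : mu.-integrable `[0, 1] (EFin \o G).
  by apply: continuous_compact_integrable; [exact: segment_compact|exact: G_cont].
apply: integrableS i1 => // x /=; rewrite !in_itv/= => /andP[? ?].
by apply/andP; split; lra.
Qed.

Lemma integral_near_const (a b c e : R) : 0 <= a -> a <= b ->
  (forall t, a < t < b -> `|G t - c| <= e) ->
  `|I b - I a - (b - a) * c| <= (b - a) * e.
Proof.
move=> a0 ab he.
have iab : mu.-integrable `]a, b[ (EFin \o G).
  apply: integrableS (integrable_G b) => // x /=; rewrite !in_itv/= => /andP[? ?].
  by apply/andP; split; lra.
have iab' : mu.-integrable `]a, b] (EFin \o G).
  apply: integrableS (integrable_G b) => // x /=; rewrite !in_itv/= => /andP[? ?].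
  by apply/andP; split; lra.
have ic (r : R) : mu.-integrable `]a, b[ (EFin \o (fun=> r)).
  apply: measurable_bounded_integrable => //.
  - by rewrite [X in (X < _)%E]lebesgue_measure_itv/=; case: ifP => // _; rewrite -EFinB ltry.
  - by exists `|r|; split; rewrite ?num_real// => M rM p _; exact: ltW.
have cst (r : R) : \int[mu]_(p in `]a, b[) r = (b - a) * r.
  rewrite Rintegral_cst// [X in fine X]lebesgue_measure_itv/= lte_fin.
  case: ltP => [_|ba]; first by rewrite mulrC.
  by rewrite mulr0 (_ : b - a = 0) ?mul0r//; lra.
have iD : mu.-integrable `]a, b[ (EFin \o (fun t => G t - c)).
  rewrite (_ : EFin \o _ = ((EFin \o G) \- (EFin \o (fun=> c)))%E)//.
  by apply: integrableB => //; exact: ic.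
rewrite /I (Rintegral_itvB (integrable_G b)); [|by rewrite bnd_simp..].
rewrite -Rintegral_itv_bndo_bndc// -cst -RintegralB//.
apply: le_trans (le_normr_Rintegral _ _) _ => //.
rewrite -cst; apply: le_Rintegral => //.
by have := integrable_norm iD; congr (mu.-integrable _ _).
Qed.

Lemma integral_midpoints (t0 h e : R) (m : nat) : 0 <= t0 -> 0 < h ->
  (forall (i : nat) (t : R), t0 + i%:R * h < t < t0 + i.+1%:R * h ->
     `|G t - G (t0 + (i%:R + 2^-1) * h)| <= e) ->
  `|I (t0 + m%:R * h) - I t0 - h * \sum_(i < m) G (t0 + (i%:R + 2^-1) * h)| <= m%:R * h * e.
Proof.
move=> t00 h0 he; elim: m => [|m IH].
  by rewrite !mul0r addr0 subrr big_ord0 mulr0 subrr normr0.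
rewrite big_ord_recr /=.
have a0 : 0 <= t0 + m%:R * h by rewrite addr_ge0// mulr_ge0// ltW.
have ab : t0 + m%:R * h <= t0 + m.+1%:R * h.
  by rewrite lerD2l ler_pM2r// ler_nat.
have := integral_near_const a0 ab (he m).
have -> : t0 + m.+1%:R * h - (t0 + m%:R * h) = h by rewrite -natr1; ring.
move=> st; set s := \sum_(i < m) _ in IH *; set g := G (_ + (m%:R + _) * _) in st *.
rewrite (_ : _ - _ = (I (t0 + m%:R * h) - I t0 - h * s) +
  (I (t0 + m.+1%:R * h) - I (t0 + m%:R * h) - h * g)); last by ring.
apply: le_trans (ler_normD _ _) _.
rewrite (_ : m.+1%:R * h * e = m%:R * h * e + h * e); first exact: lerD.
by rewrite -natr1; ring.
Qed.

Lemma sum_mul_ord (a : nat -> R) (N n : nat) :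
  \sum_(i < N * n) a i = \sum_(j < n) \sum_(k < N) a (k * n + j)%N.
Proof.
elim: N => [|N IH]; first by rewrite mul0n big_ord0 big1// => j _; rewrite big_ord0.
under [RHS]eq_bigr do rewrite big_ord_recr/=.
rewrite big_split/= -IH mulSn addnC big_split_ord/=; congr (_ + _).
Qed.

(** Cut time into periods of length d, and each period into m.+1 equal steps.  The
sum of the midpoint values over N periods is a combination of the Cesaro averages
at the m.+1 phases. *)
Lemma time_average (t0 d target : R) : 0 <= t0 -> 0 < d ->
  (forall e : R, 0 < e -> exists m : nat,
    [/\ forall (i : nat) (t : R), t0 + i%:R * (d / m.+1%:R) < t < t0 + i.+1%:R * (d / m.+1%:R) ->
          `|G t - G (t0 + (i%:R + 2^-1) * (d / m.+1%:R))| <= e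
      & exists c : 'I_m.+1 -> R,
        (forall j : 'I_m.+1, \forall N \near \oo,
          `|cesaro (fun k => G (t0 + k%:R * d + (j%:R + 2^-1) * (d / m.+1%:R))) N - c j| <= e) /\
        `|m.+1%:R^-1 * (\sum_j c j) - target| <= e]) ->
  T^-1 * I T @[T --> +oo] --> target.
Proof.
move=> t00 d0 hyp; apply/cvgrPdist_le => e e0.
have e40 : 0 < e / 4 by rewrite divr_gt0.
have [m [near_mid [c [hc hct]]]] := hyp _ e40.
set h := d / m.+1%:R in near_mid hc.
have h0 : 0 < h by rewrite divr_gt0.
have hd : h * m.+1%:R = d by rewrite /h divfK.
have [N0 hN0] : exists N0 : nat, forall N, (N0 <= N)%N -> forall j : 'I_m.+1,
    `|cesaro (fun k => G (t0 + k%:R * d + (j%:R + 2^-1) * h)) N - c j| <= e / 4.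
  have : \forall N \near \oo, forall j : 'I_m.+1,
    `|cesaro (fun k => G (t0 + k%:R * d + (j%:R + 2^-1) * h)) N - c j| <= e / 4.
    exact: filter_forall.
  by move=> [N0 _ H]; exists N0 => N NN j; exact: H.
have B0 : 0 <= B by apply: le_trans (G_bnd (lexx 0)).
have I0 : I 0 = 0 by rewrite /I set_itv1 Rintegral_set1.
have Ibnd a b : 0 <= a -> a <= b -> `|I b - I a| <= (b - a) * B.
  move=> a0 ab; have := @integral_near_const a b 0 B a0 ab.
  rewrite mulr0 subr0; apply => t /andP[at0 _]; rewrite subr0; apply: G_bnd; lra.
have level N : (N0 <= N)%N -> (0 < N)%N ->
    `|I (t0 + N%:R * d) - I t0 - N%:R * d * target| <= 3 * (e / 4) * (N%:R * d).
  move=> NN Npos; have Nr : 0 < N%:R :> R by rewrite ltr0n.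
  have := integral_midpoints (N * m.+1) t00 h0 near_mid.
  have -> : (N * m.+1)%:R * h = N%:R * d by rewrite natrM -hd; ring.
  rewrite (sum_mul_ord (fun i => G (t0 + (i%:R + 2^-1) * h))).
  have -> : \sum_(j < m.+1) \sum_(k < N) G (t0 + ((k * m.+1 + j)%:R + 2^-1) * h) =
      N%:R * \sum_(j < m.+1) cesaro (fun k => G (t0 + k%:R * d + (j%:R + 2^-1) * h)) N.
    rewrite mulr_sumr; apply: eq_bigr => j _; rewrite /cesaro mulVKf ?gt_eqF//.
    by apply: eq_bigr => k _; congr G; rewrite natrD natrM -hd; ring.
  set S := \sum_j _; move=> est.
  have Sc : `|m.+1%:R^-1 * S - m.+1%:R^-1 * \sum_j c j| <= e / 4.
    rewrite -mulrBr normrM ger0_norm ?invr_ge0// ler_pdivrMl// -sumrB.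
    apply: le_trans (ler_norm_sum _ _ _) _.
    have -> : m.+1%:R * (e / 4) = \sum_(j < m.+1) e / 4 by rewrite sumr_const card_ord mulr_natl.
    by apply: ler_sum => j _; exact: hN0.
  have St : `|m.+1%:R^-1 * S - target| <= 2 * (e / 4).
    rewrite -(subrK (m.+1%:R^-1 * \sum_j c j) (m.+1%:R^-1 * S)) -addrA.
    apply: le_trans (ler_normD _ _) _; lra.
  have -> : I (t0 + N%:R * d) - I t0 - N%:R * d * target =
      (I (t0 + N%:R * d) - I t0 - h * (N%:R * S)) + N%:R * d * (m.+1%:R^-1 * S - target).
    by rewrite /h; ring.
  apply: le_trans (ler_normD _ _) _.
  have Nd0 : 0 <= N%:R * d by rewrite mulr_ge0// ltW.
  rewrite normrM (ger0_norm Nd0).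
  have : N%:R * d * `|m.+1%:R^-1 * S - target| <= N%:R * d * (2 * (e / 4)) by rewrite ler_wpM2l.
  move: est; lra.
(* The parts before t0 and after the last full period contribute C at most. *)
pose C := (t0 + d) * (B + `|target|) + t0 * B.
exists (Num.max (t0 + N0.+1%:R * d) (4 * C / e)); split; first exact: num_real.
move=> T; rewrite gt_max => /andP[T1 T2].
have T0 : 0 < T by apply: le_lt_trans T1; rewrite addr_ge0// mulr_ge0// ltW.
pose N := Num.truncn ((T - t0) / d).
have Tt0 : 0 <= (T - t0) / d.
  rewrite divr_ge0// ?(ltW d0)// subr_ge0; apply/ltW/le_lt_trans/T1.
  by rewrite lerDl mulr_ge0// ltW.
have /andP[N1 N2] := truncn_itv Tt0; rewrite -/N in N1 N2.
rewrite ler_pdivlMr// in N1; rewrite ltr_pdivrMr// in N2.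
have NN : (N0 < N)%N.
  have : N0.+1%:R * d < N.+1%:R * d by apply: lt_trans N2; rewrite ltrBrDl.
  by rewrite ltr_pM2r// ltr_nat ltnS.
have := level N (ltnW NN) (leq_ltn_trans (leq0n _) NN).
set s := t0 + N%:R * d => lev.
have sT : s <= T by rewrite /s -lerBrDl.
have Ts : T - s <= d by move: N2; rewrite -natr1 mulrDl mul1r /s; lra.
have s0 : 0 <= s by rewrite addr_ge0// mulr_ge0// ltW.
have b1 := Ibnd s T s0 sT.
have b2 := Ibnd 0 t0 (lexx 0) t00; rewrite I0 !subr0 in b2.
have b1' : (T - s) * B <= d * B by rewrite ler_wpM2r.
rewrite distrC.
have -> : T^-1 * I T - target = T^-1 * (I T - T * target).
  by rewrite mulrBr mulKf// gt_eqF.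
rewrite normrM ger0_norm ?invr_ge0 ?(ltW T0)// ler_pdivrMl//.
have -> : I T - T * target = (I s - I t0 - N%:R * d * target) + ((I T - I s) + (I t0 - (T - N%:R * d) * target)).
  by ring.
apply: le_trans (ler_normD _ _) _.
have t1 := ler_normD (I T - I s) (I t0 - (T - N%:R * d) * target).
have t2 := ler_normB (I t0) ((T - N%:R * d) * target).
have t3 : `|(T - N%:R * d) * target| <= (t0 + d) * `|target|.
  have q : 0 <= T - N%:R * d by move: sT; rewrite /s; lra.
  rewrite normrM (ger0_norm q) ler_wpM2r//.
  by move: Ts; rewrite /s; lra.
have t4 : 3 * (e / 4) * (N%:R * d) <= 3 * (e / 4) * T.
  by rewrite ler_pM2l ?mulr_gt0//; move: sT; rewrite /s; lra.
have t5 : C <= e / 4 * T.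
  by move: T2; rewrite ltr_pdivrMr// => T2; lra.
rewrite /C in t5.
have z1 : 0 <= t0 * B by exact: mulr_ge0.
have z2 : 0 <= d * B by rewrite mulr_ge0// ltW.
set nt := `|target| in t3 t5.
lra.
Qed.

End TimeAverage.

(** * Sheets and fractional coordinates on the manifold *)

Section Codes.
Context {R : realType}.
Implicit Types p q : R * R * R.
Local Open Scope quotient_scope.
Local Notation clos := (Relation_Operators.clos_refl_sym_trans _ (@face_identification R)).

Definition frac (x : R) : R := x - (Num.floor x)%:~R.

Lemma frac_itv x : 0 <= frac x < 1.
Proof.
have h1 := floor_le x; have h2 := floorD1_gt x; rewrite intrD in h2.
by rewrite /frac; apply/andP; split; lra.
Qed.

Lemma fracDz x (m : int) : frac (x + m%:~R) = frac x.
Proof. by rewrite /frac floorDrz ?intr_int// intrKfloor intrD; ring. Qed.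

Lemma frac_id x : 0 <= x < 1 -> frac x = x.
Proof.
by move=> h; rewrite /frac (@floor_def _ x 0) ?subr0// add0r.
Qed.

Lemma frac_eq x y : frac x = frac y -> exists m : int, y = x + m%:~R.
Proof.
move=> h; exists (Num.floor y - Num.floor x).
by rewrite intrB; move: h; rewrite /frac => h; lra.
Qed.

Definition is_int (x : R) : bool := frac x == 0.

Lemma is_intDz x (m : int) : is_int (x + m%:~R) = is_int x.
Proof. by rewrite /is_int fracDz. Qed.

Lemma is_int_intr (m : int) : is_int m%:~R.
Proof. by rewrite /is_int /frac intrKfloor subrr. Qed.

Lemma is_int01 x : 0 <= x <= 1 -> is_int x = (x == 0) || (x == 1).
Proof.
move=> /andP[x0 x1]; have [->|n1] := eqVneq x 1; first by rewrite orbT (is_int_intr 1).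
by rewrite orbF /is_int frac_id// x0/= lt_neqAle n1.
Qed.

Lemma is_int12 x : 1 <= x <= 2 -> is_int x = (x == 1) || (x == 2).
Proof.
move=> /andP[x1 x2]; have -> : x = (x - 1) + 1%:~R by rewrite /=; ring.
rewrite is_intDz is_int01; last by apply/andP; split; lra.
rewrite subrK subr_eq0; congr (_ || _).
by apply/eqP/eqP => h; lra.
Qed.

Lemma frac012 : (frac 0 = 0) * (frac 1 = 0) * (frac 2 = 0).
Proof.
by rewrite -[0]/(0%:~R) -[1]/(1%:~R) -[2%:R]/(2%:~R) /frac !intrKfloor !subrr.
Qed.

Lemma is_int012 : (is_int 0) * (is_int 1) * (is_int 2).
Proof. by rewrite /is_int !frac012 eqxx. Qed.

(** Top 0, middle 1, right -1.  A point of a vertical face belongs to the cube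
in which its coordinate is 0, so that the sheet is invariant under the
identifications off the vertical edges. *)
Definition sheet (x y : R) : 'Z_3 :=
  if x < 1 then (if 1 <= y < 2 then 0 else 1)
  else if x < 2 then (if (x == 1) && (1 <= y) then 0 else -1)
  else 1.

(** The points of the vertical edges. *)
Definition lattice p := is_int p.1.1 && is_int p.1.2.

(** An invariant of the identifications; it forgets the sheet on the vertical
edges, as these are glued to one another. *)
Definition code p := (frac p.1.1, frac p.1.2, frac p.2, lattice p,
  if lattice p then 0 else sheet p.1.1 p.1.2).

Lemma code_face p q : face_identification p q -> code p = code q.
Proof.
have i0 := is_int012.1.1; have i1 := is_int012.1.2; have i2 := is_int012.2.
case=> {p q} [y z y12 _|y z y01 _|x z x01 _|x z x12 _|x y Lxy]; rewrite /code /lattice/= !frac012 ?i0 ?i1 ?i2/= ?andbT.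
- rewrite is_int12//; case: ifPn => //; rewrite negb_or => /andP[y1 y2].
  have {}y12 : 1 <= y < 2 by move/andP: y12 => [-> y2']; rewrite lt_neqAle y2.
  by rewrite /sheet ltr01 y12 ltxx ltr1n eqxx (andP y12).1.
- rewrite is_int01//; case: ifPn => //; rewrite negb_or => /andP[y0 y1].
  have y1' : y < 1 by move/andP: y01 => [_ ?]; rewrite lt_neqAle y1.
  by rewrite /sheet ltr01 (leNgt 1 y) y1' ltrn1 ltxx.
- rewrite is_int01//; case: ifPn => //; rewrite negb_or => /andP[x0 x1].
  have x1' : x < 1 by move/andP: x01 => [_ ?]; rewrite lt_neqAle x1.
  by rewrite /sheet x1' ltxx andbF leNgt ltr01.
- rewrite is_int12//; case: ifPn => //; rewrite negb_or => /andP[x1 x2].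
  move/andP: x12 => [x1' x2'].
  by rewrite /sheet ltNge x1' (negbTE x1)/= lt_neqAle x2 x2'.
- by [].
Qed.

Lemma code_clos p q : clos p q -> code p = code q.
Proof.
elim=> [? ?|?|? ? _ ->|? ? ? _ -> _ ->] //; exact: code_face.
Qed.

Lemma set_val_insubd p : L_solid R p -> set_val (insubd (solid_origin R) p) = p.
Proof. by move=> Lp; rewrite set_valE insubdK//; exact/mem_set. Qed.

Lemma to_manifoldP p q : L_solid R p -> L_solid R q ->
  to_manifold p = to_manifold q <-> clos p q.
Proof.
move=> Lp Lq; rewrite /to_manifold; split.
  by move/eqquotP/asboolP; rewrite !set_val_insubd.
by move=> h; apply/eqquotP/asboolP; rewrite !set_val_insubd.
Qed.

Lemma to_manifold_face p q : face_identification p q ->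
  L_solid R p -> L_solid R q -> to_manifold p = to_manifold q.
Proof. by move=> h Lp Lq; apply/to_manifoldP => //; exact: Relation_Operators.rst_step. Qed.

Lemma to_manifold_code p q : L_solid R p -> L_solid R q ->
  to_manifold p = to_manifold q -> code p = code q.
Proof. by move=> Lp Lq /to_manifoldP => /(_ Lp Lq)/code_clos. Qed.

Definition unfold (i : 'Z_3) (x y z : R) : R * R * R :=
  ((cube_corner R i).1.1 + x, (cube_corner R i).1.2 + y, (cube_corner R i).2 + z).

Lemma unfold_L i x y z : 0 <= x <= 1 -> 0 <= y <= 1 -> 0 <= z <= 1 -> L_solid R (unfold i x y z).
Proof.
move=> /andP[? ?] /andP[? ?] /andP[? ?]; exists i => //.
by rewrite /cube /unfold/= !lerDl !lerD2l; split; apply/andP.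
Qed.

Lemma unfold0E x y z : unfold 0 x y z = (x, 1 + y, z).
Proof. by rewrite /unfold /= !add0r. Qed.
Lemma unfold1E x y z : unfold 1 x y z = (x, y, z).
Proof. by rewrite /unfold /= !add0r. Qed.
Lemma unfoldN1E x y z : unfold (-1) x y z = (1 + x, y, z).
Proof. by rewrite /unfold /= !add0r. Qed.

(** In cube coordinates, the identifications and the common faces of the solid
follow a single rule. *)
Lemma glue_x i y z : 0 <= y <= 1 -> 0 <= z <= 1 ->
  to_manifold (unfold i 1 y z) = to_manifold (unfold (- i) 0 y z).
Proof.
move=> y01 z01; have u01 : 0 <= (1 : R) <= 1 by rewrite ler01 lexx.
have u00 : 0 <= (0 : R) <= 1 by rewrite ler01 lexx.
have L1 := unfold_L i u01 y01 z01; have L0 := unfold_L (- i) u00 y01 z01.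
move: L1 L0; case: (Z3P i) => ->; rewrite ?oppr0 ?opprK ?unfold0E ?unfold1E ?unfoldN1E => L1 L0.
- apply/esym/to_manifold_face => //; apply: FaceXTop => //.
  by move/andP: y01 => [? ?]; apply/andP; split; lra.
- by rewrite addr0.
- by apply/esym; apply: to_manifold_face => //; exact: FaceXMiddleRight.
Qed.

Lemma glue_y i x z : 0 <= x <= 1 -> 0 <= z <= 1 ->
  to_manifold (unfold i x 1 z) = to_manifold (unfold (1 - i) x 0 z).
Proof.
move=> x01 z01; have u01 : 0 <= (1 : R) <= 1 by rewrite ler01 lexx.
have u00 : 0 <= (0 : R) <= 1 by rewrite ler01 lexx.
have L1 := unfold_L i x01 u01 z01; have L0 := unfold_L (1 - i) x01 u00 z01.
have e2 : 1 - -1 = -1 :> 'Z_3 by exact: val_inj.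
move: L1 L0; case: (Z3P i) => ->.
- rewrite subr0 unfold0E unfold1E => L1 L0.
  by apply/esym/to_manifold_face => //; exact: FaceYMiddleTop.
- by rewrite subrr unfold0E unfold1E addr0.
- rewrite e2 !unfoldN1E => L1 L0.
  apply/esym/to_manifold_face => //; apply: FaceYRight => //.
  by move/andP: x01 => [? ?]; apply/andP; split; lra.
Qed.

Lemma glue_z i x y : 0 <= x <= 1 -> 0 <= y <= 1 ->
  to_manifold (unfold i x y 1) = to_manifold (unfold i x y 0).
Proof.
move=> x01 y01; have u01 : 0 <= (1 : R) <= 1 by rewrite ler01 lexx.
have u00 : 0 <= (0 : R) <= 1 by rewrite ler01 lexx.
have L1 := unfold_L i x01 y01 u01; have L0 := unfold_L i x01 y01 u00.
apply/esym/to_manifold_face => //; move: L0; rewrite /unfold.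
by case: (Z3P i) => ->; rewrite /= !add0r; exact: FaceZ.
Qed.

Definition rep i x y z := unfold i (frac x) (frac y) (frac z).

Lemma frac_itvc x : 0 <= frac x <= 1.
Proof. by have /andP[-> /ltW ->] := frac_itv x. Qed.

Lemma rep_L i x y z : L_solid R (rep i x y z).
Proof. by apply: unfold_L; exact: frac_itvc. Qed.

(** With [to_manifold_code], off the vertical edges a point of the manifold amounts
to its sheet and its fractional coordinates. *)
Lemma normal_form p : L_solid R p -> ~~ lattice p ->
  to_manifold p = to_manifold (rep (sheet p.1.1 p.1.2) p.1.1 p.1.2 p.2).
Proof.
move=> Lp nlat.
have zred x y z : L_solid R (x, y, z) ->
    to_manifold (x, y, z) = to_manifold (x, y, frac z).
  move=> L; have /L_solidP[/= ? ? z01 ?] := L.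
  have [z1|z1] := eqVneq z 1.
    rewrite z1 frac012; have L0 : L_solid R (x, y, 0).
      by apply/L_solidP; split => //=; rewrite lexx ler01.
    by apply/esym/to_manifold_face; [exact: FaceZ|by []|rewrite -z1].
  by rewrite frac_id//; move/andP: z01 => [-> ?]; rewrite lt_neqAle z1.
case: p Lp nlat => -[x y] z Lp /=; rewrite /lattice /= => nlat.
rewrite zred// /rep.
have Lz : L_solid R (x, y, frac z).
  by have /L_solidP[/= ? ? ? ?] := Lp; apply/L_solidP; split => //=; exact: frac_itvc.
have /L_solidP[/= /andP[x0 x2] /andP[y0 y2] z01 xy] := Lz.
clear Lp; move: (frac z) Lz z01 => w Lz z01 {z}; rename w into z.
have u01 : 0 <= (1 : R) <= 1 by rewrite ler01 lexx.
have u00 : 0 <= (0 : R) <= 1 by rewrite ler01 lexx.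
have sub1 (w : R) : 1 <= w < 2 -> frac w = w - 1.
  move=> /andP[? ?]; rewrite -[w in LHS](subrK 1) -[1 in X in frac X]/(1%:~R) fracDz frac_id//.
  by apply/andP; split; lra.
rewrite /sheet; have [x1|x1] := ltP x 1.
  rewrite (@frac_id x) ?x0//.
  have x01 : 0 <= x <= 1 by rewrite x0 ltW.
  have [y1|y1] := ltP y 1.
    by rewrite /= unfold1E frac_id// y0.
  have [yl|yg] := ltP y 2; rewrite /=.
    by rewrite unfold0E sub1 ?y1// addrC subrK.
  have -> : y = 2 by lra.
  rewrite frac012 -[1 in RHS]subr0 -(glue_y 0 x01 z01) unfold0E.
  by congr (to_manifold (_, _, _)); lra.
have [xl|xg] := ltP x 2; last first.
  have ex : x = 2 by lra.
  have y1 : y <= 1 by move: xy; rewrite ex => /orP[|//]; rewrite lern1.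
  have y1' : y < 1.
    by rewrite lt_neqAle y1 andbT; apply: contraNneq nlat => ->; rewrite ex !is_int012.
  rewrite ex frac012 (@frac_id y) ?y0//.
  have y01 : 0 <= y <= 1 by rewrite y0.
  rewrite -[1]opprK -(glue_x (-1) y01 z01) unfoldN1E.
  by congr (to_manifold (_, _, _)); lra.
rewrite (sub1 x) ?x1//.
have [ex|nx] := eqVneq x 1; last first.
  have xgt : 1 < x by rewrite lt_neqAle eq_sym nx.
  have y1 : y <= 1 by move: xy; rewrite leNgt xgt.
  rewrite /= ; have [ey|ny] := eqVneq y 1; last first.
    have y1' : y < 1 by rewrite lt_neqAle ny.
    rewrite (@frac_id y) ?y0// unfoldN1E; congr (to_manifold (_, _, _)); lra.
  rewrite ey frac012.
  have xx01 : 0 <= x - 1 <= 1 by apply/andP; split; lra.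
  have := glue_y (-1) xx01 z01; rewrite (_ : 1 - -1 = -1 :> 'Z_3); last exact: val_inj.
  by rewrite unfoldN1E addrC subrK.
rewrite ex subrr /=.
have [y1|y1] := leP 1 y.
  have ny1 : y != 1 by apply: contraNneq nlat => ->; rewrite ex !is_int012.
  have ny2 : y != 2 by apply: contraNneq nlat => ->; rewrite ex !is_int012.
  have y2' : y < 2 by rewrite lt_neqAle ny2.
  rewrite sub1 ?y1//; have yy : 0 <= y - 1 <= 1 by apply/andP; split; lra.
  have gl := glue_x 0 yy z01; rewrite oppr0 in gl; rewrite -gl unfold0E.
  by congr (to_manifold (_, _, _)); lra.
by rewrite (@frac_id y) ?y0// unfoldN1E addr0.
Qed.

End Codes.

(** * The vertical edges are singular *)

Section Singular.
Context {R : realType}.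
Implicit Types p q : R * R * R.

Definition vedge (i : 'Z_3) (a b : bool) : cube_edge := (i, inord 2, a, b).

Lemma edge_point_vedge i a b (s : R) : edge_point (vedge i a b) s = unfold i a%:R b%:R s.
Proof. by rewrite /edge_point /= inordK. Qed.

(** Going around a vertical edge by four faces translates the sheet by 2, so the
edges of all three cubes are glued together. *)
Lemma vertical_edges_glued i (a b : bool) (s : R) : 0 <= s <= 1 ->
  to_manifold (unfold i a%:R b%:R s) = to_manifold (unfold 0 0 0 s).
Proof.
move=> s01.
have z01 : 0 <= (0 : R) <= 1 by rewrite lexx ler01.
have o01 : 0 <= (1 : R) <= 1 by rewrite lexx ler01.
have two (j : 'Z_3) : to_manifold (unfold (j - 1) 0 0 s) = to_manifold (unfold (1 + j) 0 0 s).
  rewrite -[1 + j]/(1 + j) -[in RHS](opprK j) -(glue_y (- j) z01 s01) -(glue_x j o01 s01).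
  by rewrite glue_y// glue_x// opprB.
have all0 (j : 'Z_3) : to_manifold (unfold j 0 0 s) = to_manifold (unfold 0 0 0 s).
  have st (k : 'Z_3) : to_manifold (unfold k 0 0 s) = to_manifold (unfold (k + 1) 0 0 s).
    have := two (k - 1).
    have -> : k - 1 - 1 = k + 1 by case: (Z3P k) => ->; exact: val_inj.
    by have -> : 1 + (k - 1) = k by case: (Z3P k) => ->; exact: val_inj.
  case: (Z3P j) => ->.
  - by [].
  - by rewrite [RHS]st add0r.
  - by rewrite [LHS]st addNr.
have h11 : to_manifold (unfold i 1 1 s) = to_manifold (unfold 0 0 0 s).
  by rewrite (glue_y i o01 s01) (glue_x (1 - i) z01 s01); exact: all0.
have h10 : to_manifold (unfold i 1 0 s) = to_manifold (unfold 0 0 0 s).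
  by rewrite (glue_x i z01 s01); exact: all0.
have h01 : to_manifold (unfold i 0 1 s) = to_manifold (unfold 0 0 0 s).
  by rewrite (glue_y i z01 s01); exact: all0.
have h00 := all0 i.
have e (c : bool) : c%:R = (if c then 1 else 0) :> R by case: c.
by rewrite !e; case: a; case: b.
Qed.

(** All 12 vertical edges of the cubes are one edge of the manifold. *)
Lemma total_angle_vedge i a b : total_angle R (vedge i a b) != 2 * pi.
Proof.
have half01 : 0 <= (2^-1 : R) <= 1 by apply/andP; split; lra.
have : (12 <= #|same_edge R (vedge i a b)|)%N.
  have -> : 12%N = #|{: 'I_3 * bool * bool}| by rewrite !card_prod card_ord card_bool.
  pose h (x : 'I_3 * bool * bool) : cube_edge := vedge x.1.1 x.1.2 x.2.
  have hinj : injective h by move=> [[? ?] ?] [[? ?] ?] [-> -> ->].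
  rewrite -(fintype.card_image hinj); apply/subset_leq_card/fintype.subsetP => _ /fintype.imageP[x _ ->].
  rewrite inE; apply/asboolP; rewrite /h !edge_point_vedge.
  have := vertical_edges_glued x.1.1 x.1.2 x.2 half01; rewrite -(vertical_edges_glued i a b half01) => ->; exact/asboolP.
rewrite /total_angle => N12; apply/eqP => h.
have p0 := pi_gt0 R.
have : (pi : R) / 2 *+ 12 <= pi / 2 *+ #|same_edge R (vedge i a b)|.
  by apply: ler_wpMn2l N12; rewrite divr_ge0 ?(ltW p0).
by rewrite h -mulr_natl; lra.
Qed.

Lemma lattice_singular p : L_solid R p -> lattice p -> singular_point (to_manifold p).
Proof.
case: p => [[x y] z] Lp; have /L_solidP[/= x02 y02 z01 xy] := Lp.
rewrite /lattice/= => /andP[xi yi].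
have bool3 (w : R) : 0 <= w <= 2 -> is_int w -> [\/ w = 0, w = 1 | w = 2].
  move=> /andP[w0 w2] wi; have [w1|w1] := leP w 1.
    move: wi; rewrite is_int01 ?w0// => /orP[/eqP ->|/eqP ->]; first exact: Or31.
    exact: Or32.
  move: wi; rewrite is_int12 ?w2 ?ltW// => /orP[/eqP ->|/eqP ->]; first exact: Or32.
  exact: Or33.
have mk i (a b : bool) : (x, y, z) = unfold i a%:R b%:R z -> singular_point (to_manifold (x, y, z)).
  move=> ->; exists (vedge i a b); split; first exact: total_angle_vedge.
  by exists z => //; rewrite edge_point_vedge.
case: (bool3 _ x02 xi) => ex; case: (bool3 _ y02 yi) => ey; rewrite ?ex ?ey in mk xy *.
- by apply: (mk 1 false false); rewrite unfold1E.
- by apply: (mk 1 false true); rewrite unfold1E.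
- by apply: (mk 0 false true); rewrite unfold0E.
- by apply: (mk 1 true false); rewrite unfold1E.
- by apply: (mk 1 true true); rewrite unfold1E.
- by apply: (mk 0 true true); rewrite unfold0E.
- by apply: (mk (-1) true false); rewrite unfoldN1E.
- by apply: (mk (-1) true true); rewrite unfoldN1E.
- by move: xy; rewrite lern1.
Qed.

End Singular.

(** * Uniform continuity on the solid *)

Section Uniform.
Local Open Scope quotient_scope.
Context {R : realType}.
Implicit Types p q : R * R * R.
Variable f : L_manifold R -> R.
Hypothesis f_cont : continuous f.
Let F p := f (to_manifold p).

Definition close3 (d : R) p q :=
  [/\ `|p.1.1 - q.1.1| < d, `|p.1.2 - q.1.2| < d & `|p.2 - q.2| < d].

Lemma within_L_solid_continuous : {within L_solid R, continuous F}.
Proof.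
apply/subspace_sigL_continuousP.
have -> : sigL (L_solid R) F = f \o \pi_(quotient_topology {eq_quot (@identified R)}).
  apply/funext => x; rewrite /sigL /= /F /to_manifold; congr (f _).
  by congr (\pi_(quotient_topology {eq_quot (@identified R)}) _); exact: valKd.
by apply/quotient_continuous.
Qed.

Lemma compact_L_solid : compact (L_solid R).
Proof.
have box_compact (a b c a' b' c' : R) : compact ((`[a, a'] `*` `[b, b']) `*` `[c, c']).
  by apply: compact_setX; [apply: compact_setX|]; exact: segment_compact.
have -> : L_solid R = ((`[0, 1] `*` `[0, 2]) `*` `[0, 1]) `|` ((`[0, 2] `*` `[0, 1]) `*` `[0, 1]).
  apply/seteqP; split => p; rewrite /setU /setX/= !in_itv/=.
    move=> /L_solidP[/andP[x0 x2] /andP[y0 y2] -> h].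
    by rewrite x0 x2 y0 y2; move: h => /orP[->|->]; [left|right].
  move=> h; apply/L_solidP; move: h => [[[/andP[x0 x1] y] z]|[[x /andP[y0 y1]] z]].
    by split => //; rewrite ?x0 ?x1//; apply: le_trans x1 _; rewrite ler1n.
  by split => //; rewrite ?y0 ?y1 ?orbT//; apply: le_trans y1 _; rewrite ler1n.
by apply: compactU.
Qed.

Lemma L_solid_local (e : R) p : 0 < e -> L_solid R p -> exists2 r : R, 0 < r &
  forall q, L_solid R q -> close3 r p q -> `|F p - F q| < e.
Proof.
move=> e0 Lp; have /subspace_continuousP/(_ p Lp) := within_L_solid_continuous.
move=> /cvgrPdist_lt/(_ e e0); rewrite near_withinE => /nbhs_ballP[r /= r0 hr].
exists r => // q Lq [h1 h2 h3]; exact: hr.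
Qed.

Lemma L_solid_bounded : exists B : R, forall p, L_solid R p -> `|F p| <= B.
Proof.
have /compact_bounded[M [_ hM]] := continuous_compact within_L_solid_continuous compact_L_solid.
by exists (M + 1) => p Lp; apply: (hM (M + 1)); [rewrite ltrDl|exists p].
Qed.

(** The topology of the manifold is a quotient topology, so f gives a continuous
function on the solid, which is compact. *)
Lemma L_solid_uniform (e : R) : 0 < e -> exists2 d : R, 0 < d &
  forall p q, L_solid R p -> L_solid R q -> close3 d p q -> `|F p - F q| < e.
Proof.
move=> e0; have e20 : 0 < e / 2 by rewrite divr_gt0.
have /compact_near_coveringP nc := compact_L_solid.
have := nc R (0^'+)%classic (fun d p => forall q, L_solid R p -> L_solid R q -> close3 d p q -> `|F p - F q| < e) _.
case.
  move=> p Lp; have [r r0 hr] := L_solid_local e20 Lp.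
  have r20 : 0 < r / 2 by rewrite divr_gt0.
  exists (ball p (r / 2), [set d : R | d < r / 2]).
    split => /=; first exact: nbhsx_ballx.
    by apply: nbhs_right_lt.
  move=> [p' d] /= [[[b1 b2] b3] dr] q Lp' Lq [c1 c2 c3].
  have tri (x y z : R) : `|x - y| < r / 2 -> `|y - z| < d -> `|x - z| < r.
    move=> xy yz; rewrite -(subrK y x) -addrA; apply: le_lt_trans (ler_normD _ _) _.
    rewrite [ltRHS]splitr ltrD//; exact: lt_trans yz dr.
  have lt2 (x y : R) : `|x - y| < r / 2 -> `|x - y| < r.
    by move=> h; apply: lt_trans h _; lra.
  have h1 := hr _ Lp' (And3 (lt2 _ _ b1) (lt2 _ _ b2) (lt2 _ _ b3)).
  have h2 := hr _ Lq (And3 (tri _ _ _ b1 c1) (tri _ _ _ b2 c2) (tri _ _ _ b3 c3)).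
  rewrite -(subrK (F p) (F p')) -addrA; apply: le_lt_trans (ler_normD _ _) _.
  by rewrite [ltRHS]splitr ltrD// distrC.
move=> d0 /= d00 hd.
exists (d0 / 2); first by rewrite divr_gt0.
move=> p q Lp Lq; apply: (hd (d0 / 2)) => //=; last by rewrite divr_gt0.
by rewrite sub0r normrN gtr0_norm; lra.
Qed.

End Uniform.

(** * How the sheet changes along a geodesic *)

Section RealInduction.
Context {R : realType}.

Lemma real_induction (P : R -> Prop) : P 0 ->
  (forall t, 0 <= t -> P t -> exists2 e, 0 < e & forall s, t <= s <= t + e -> P s) ->
  (forall t, 0 < t -> (forall s, 0 <= s < t -> P s) -> P t) ->
  forall t, 0 <= t -> P t.
Proof.
move=> P0 right left t t0; apply: contrapT => nPt.
pose S := [set r : R | 0 <= r /\ forall s, 0 <= s <= r -> P s].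
have S0 : S 0 by split => // s /andP[? ?]; have -> : s = 0 by lra.
have Sub r : S r -> r <= t.
  by move=> [r0 hr]; rewrite leNgt; apply/negP => tr; apply: nPt; apply: hr; rewrite t0 ltW.
have supS : has_sup S by split; [exists 0|exists t => r; exact: Sub].
pose m := sup S.
have m0 : 0 <= m by exact: sup_upper_bound.
have below s : 0 <= s < m -> P s.
  move=> /andP[s0 sm].
  have ms0 : 0 < m - s by rewrite subr_gt0.
  have [r [r0 hr] sr] := sup_adherent ms0 supS.
  by apply: hr; rewrite s0/=; move: sr; rewrite -/m; lra.
have Pm : P m.
  have [mp|mn] := ltP 0 m; first exact: left.
  by have -> : m = 0 by lra.
have [e e0 he] := right _ m0 Pm.
have : S (m + e).
  split; first by rewrite addr_ge0// ltW.
  move=> s /andP[s0 sme]; have [sm|ms] := ltP s m; first by apply: below; rewrite s0.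
  by apply: he; rewrite ms.
by move=> /(sup_upper_bound supS); rewrite -/m; lra.
Qed.

Lemma locally_constant_on (T : Type) (h : R -> T) (a b : R) :
  (forall t, a < t < b -> exists2 e : R, 0 < e &
     forall s, a < s < b -> t - e <= s <= t + e -> h s = h t) ->
  forall s t, a < s < b -> a < t < b -> h s = h t.
Proof.
move=> loc.
suff H s t : a < s < b -> a < t < b -> s <= t -> h s = h t.
  move=> s t hs ht; have [st|/ltW ts] := leP s t; first exact: H.
  by apply/esym/H.
move=> hs ht st.
have := @real_induction (fun r => s + r < b -> h s = h (s + r)) _ _ _ (t - s).
rewrite subrKC subr_ge0 => H; apply: H => //; last by case/andP: ht.
- by rewrite addr0.
- move=> r r0 IH; have [srb|bsr] := ltP (s + r) b; last first.
    by exists 1 => // r' /andP[? ?] ?; exfalso; lra.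
  move/andP: hs => [as_ sb].
  have [|e e0 he] := loc (s + r); first by apply/andP; split; lra.
  exists e => // r' /andP[? ?] ?; rewrite IH//; apply/esym/he; apply/andP; split; lra.
- move=> r r0 IH srb; move/andP: hs => [as_ sb].
  have [|e e0 he] := loc (s + r); first by apply/andP; split; lra.
  pose r' := Num.max 0 (r - e).
  have r'r : r' < r by rewrite gt_max r0; lra.
  have r'0 : 0 <= r' by rewrite le_max lexx.
  have r're : r - e <= r' by rewrite le_max lexx orbT.
  rewrite (IH r'); [|by rewrite r'0|lra].
  apply: he; apply/andP; split; lra.
Qed.

End RealInduction.

Section SheetRules.
Context {R : realType}.

Lemma psgn_0_1 (x : R) : 0 <= x < 1 -> psgn x = 1.
Proof. by move=> h; rewrite /psgn (@floor_def _ x 0) ?add0r. Qed.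

Lemma psgn_1_2 (x : R) : 1 <= x < 2 -> psgn x = -1.
Proof. by move=> h; rewrite /psgn (@floor_def _ x 1). Qed.

Lemma psgn2 : psgn (2 : R) = 1.
Proof. by rewrite /psgn (_ : 2 = 2%:~R)// intrKfloor. Qed.

Lemma psgn_sqr (x : R) : psgn x * psgn x = 1.
Proof. by rewrite /psgn; case: ifP => _; exact: val_inj. Qed.

(** The action on sheets of floor y crossings of levels y = integer. *)
Definition flip (y : R) (i : 'Z_3) : 'Z_3 := if odd (absz (Num.floor y)) then 1 - i else i.

Lemma flipDz y (m : int) i : flip (y + m%:~R) i = if odd (absz m) then 1 - flip y i else flip y i.
Proof.
rewrite /flip floorDrz ?intr_int// intrKfloor odd_absz_add.
by case: (odd _); case: (odd _) => //=; ring.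
Qed.

Lemma between_ints (y : R) (k : int) : 0 <= y <= 2 -> k%:~R < y < k%:~R + 1 -> k = 0 \/ k = 1.
Proof.
move=> /andP[y0 y2] /andP[ky yk].
have : -1 < k by rewrite -(ltr_int R); lra.
have : k < 2 by rewrite -(ltr_int R); lra.
clear; lia.
Qed.

(** In a row of the L, crossing a face x = integer negates both factors. *)
Lemma psgn_sheet (x y z : R) (k : int) : L_solid R (x, y, z) -> k%:~R < y < k%:~R + 1 ->
  psgn x * sheet x y = if k == 0 then 1 else 0.
Proof.
move=> /L_solidP[/= /andP[x0 x2] y02 _ xy] hk.
have [ek|ek] := between_ints y02 hk; subst k; rewrite /=.
  move/andP: hk => [yk1 yk2]; rewrite add0r in yk2.
  have ny : (1 <= y) = false by rewrite leNgt yk2.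
  rewrite /sheet ny andbF/=; have [x1|x1] := ltP x 1; first by rewrite psgn_0_1 ?x0// mulr1.
  have [xx2|xx2] := ltP x 2; first by rewrite psgn_1_2 ?x1//; exact: val_inj.
  have -> : x = 2 by lra.
  by rewrite psgn2 mulr1.
move/andP: hk => [yk1 yk2]; rewrite -[1%:~R]/(1 : R) in yk1 yk2.
have y2 : y < 2 by lra.
have ny : (y <= 1) = false by rewrite leNgt yk1.
rewrite ny orbF in xy; rewrite /sheet (ltW yk1) y2/=.
have [x1|x1] := ltP x 1; first by rewrite mulr0.
have -> : x = 1 by lra.
by rewrite eqxx ltr1n mulr0.
Qed.

(** In a column of the L, a change of sheet i -> 1 - i makes up for the change of
parity of floor y. *)
Lemma flip_sheet (x y z : R) (k : int) : L_solid R (x, y, z) -> k%:~R < x < k%:~R + 1 ->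
  flip y (sheet x y) = if k == 0 then 1 else -1.
Proof.
move=> /L_solidP[/= x02 /andP[y0 y2] _ xy] hk.
have fl0 i : 0 <= y < 1 -> flip y i = i.
  by move=> h; rewrite /flip (@floor_def _ y 0) ?add0r.
have fl1 i : 1 <= y < 2 -> flip y i = 1 - i.
  by move=> h; rewrite /flip (@floor_def _ y 1).
have fl2 i : y = 2 -> flip y i = i.
  by move=> ->; rewrite /flip (_ : 2 = 2%:~R)// intrKfloor.
have [ek|ek] := between_ints x02 hk; subst k; rewrite /=.
  move/andP: hk => [xk1 xk2]; rewrite add0r in xk2.
  rewrite /sheet xk2; have [y1|y1] := leP 1 y; last by rewrite /= fl0 ?y0.
  have [yy2|yy2] := ltP y 2; first by rewrite /= fl1 ?y1// subr0.
  by rewrite fl2//; lra.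
move/andP: hk => [xk1 xk2]; rewrite -[1%:~R]/(1 : R) in xk1 xk2.
have x2 : x < 2 by lra.
have nx : (x <= 1) = false by rewrite leNgt xk1.
rewrite nx/= in xy; rewrite /sheet ltNge (ltW xk1) x2/= gt_eqF//=.
have [yy1|yy1] := ltP y 1; first by rewrite fl0 ?y0.
have y1 : y = 1 by lra.
by rewrite fl1 ?y1 ?lexx ?ltr1n//; exact: val_inj.
Qed.

End SheetRules.

Section Coding.
Context {R : realType}.
Implicit Types p : R * R * R.
Variables (g : R -> L_manifold R) (u p0 : R * R * R).

Definition advance p (c : R) : R * R * R := (p.1.1 + c * u.1.1, p.1.2 + c * u.1.2, p.2 + c * u.2).

Lemma advanceE p c : p + c *: u = advance p c.
Proof. by rewrite /advance; case: p => [[x y] z]; case: u => [[u1 u2] u3]. Qed.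

Hypothesis g_right : forall t : R, 0 <= t -> exists2 e : R, 0 < e & exists p, straight_on g u p t `[t, t + e].
Hypothesis g_left : forall t : R, 0 < t -> exists2 e : R, 0 < e & exists p, straight_on g u p t `[t - e, t].
Hypothesis g_nonsing : ~ hits_singularity g.
Hypothesis p0_L : L_solid R p0.
Hypothesis p0_rep : g 0 = to_manifold p0.

Let Q (t : R) := advance p0 t.

Lemma g_nonlattice t p : 0 <= t -> L_solid R p -> g t = to_manifold p -> ~~ lattice p.
Proof.
move=> t0 Lp gp; apply/negP => lat; apply: g_nonsing; exists t => //.
by rewrite gp; exact: lattice_singular.
Qed.

(** This expresses that the geodesic follows the straight line Q of the torus. *)
Definition aligned t p := exists m : int * int * int,
  p = ((Q t).1.1 + m.1.1%:~R, (Q t).1.2 + m.1.2%:~R, (Q t).2 + m.2%:~R).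

Lemma aligned_eq t p p' : L_solid R p -> L_solid R p' ->
  to_manifold p = to_manifold p' -> aligned t p -> aligned t p'.
Proof.
move=> Lp Lp' /(to_manifold_code Lp Lp')[/frac_eq[m1 e1] /frac_eq[m2 e2] /frac_eq[m3 e3] _ _].
move=> [[[n1 n2] n3] /= ep]; exists (n1 + m1, n2 + m2, n3 + m3) => /=.
rewrite !intrD !addrA; rewrite ep/= in e1 e2 e3.
by case: p' Lp' e1 e2 e3 => [[? ?] ?] _ /= -> -> ->.
Qed.

Lemma aligned_advance t s p : aligned s (advance p (s - t)) <-> aligned t p.
Proof.
have shift (x c : R) (n : int) : x + (s - t) * c + n%:~R = x + s * c + n%:~R - t * c by ring.
split=> -[[[m1 m2] m3]] e; exists (m1, m2, m3) => /=; move: e; rewrite /Q /advance/=.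
  case: p => [[x y] z] /= [ex ey ez].
  by congr (_, _, _); lra.
by move=> -> /=; congr (_, _, _); ring.
Qed.

(** Alignment propagates along a segment, and passes from a representative to
another because identified points differ by integers. *)
Lemma geodesic_aligned t : 0 <= t ->
  exists p, [/\ L_solid R p, g t = to_manifold p & aligned t p].
Proof.
move: t; apply: real_induction.
- exists p0; split => //; exists (0, 0, 0); rewrite /Q /advance/= !mul0r !addr0.
  by case: p0 => [[? ?] ?].
- move=> t t0 [p [Lp gp alp]]; have [e e0 [p' hp']] := g_right t0.
  exists e => // s ts; have [|Ls gs] := hp' s; first by rewrite /= in_itv.
  have [|Lt gt] := hp' t; first by rewrite /= in_itv/= lexx lerDl ltW.
  rewrite subrr scale0r addr0 in Lt gt.
  rewrite advanceE in Ls gs; exists (advance p' (s - t)); split => //.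
  apply/aligned_advance; apply: aligned_eq alp => //.
  by rewrite -gp -gt.
- move=> t t0 IH; have [e e0 [p' hp']] := g_left t0.
  have [|Lt gt] := hp' t; first by rewrite /= in_itv/= lexx andbT gerBl ltW.
  rewrite subrr scale0r addr0 in Lt gt.
  exists p'; split => //.
  pose s := Num.max 0 (t - e).
  have st : s < t by rewrite gt_max t0; lra.
  have s0 : 0 <= s by rewrite le_max lexx.
  have se : t - e <= s by rewrite le_max lexx orbT.
  have [|Ls gs] := hp' s; first by rewrite /= in_itv/= se ltW.
  rewrite advanceE in Ls gs.
  have [|p [Lp gp alp]] := IH s; first by rewrite s0.
  apply/(aligned_advance t s); apply: aligned_eq alp => //.
  by rewrite -gp -gs.
Qed.

(** Off the vertical edges all representatives of a point have the same sheet. *)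
Lemma exists_sheet_of_geodesic : exists Sh : R -> 'Z_3,
  forall (t : R) p, 0 <= t -> L_solid R p -> g t = to_manifold p -> Sh t = sheet p.1.1 p.1.2.
Proof.
have ex t : exists i : 'Z_3, forall p, 0 <= t -> L_solid R p -> g t = to_manifold p -> i = sheet p.1.1 p.1.2.
  have [t0|nt0] := pselect (0 <= t); last by exists 0 => p /nt0.
  have [p [Lp gp _]] := geodesic_aligned t0.
  exists (sheet p.1.1 p.1.2) => p' _ Lp' gp'.
  have nl := g_nonlattice t0 Lp gp; have nl' := g_nonlattice t0 Lp' gp'.
  have := to_manifold_code Lp Lp' (etrans (esym gp) gp').
  by rewrite /code (negbTE nl) (negbTE nl') => -[].
by have [Sh hSh] := choice ex; exists Sh => t p; exact: hSh.
Qed.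

Variable Sh : R -> 'Z_3.
Hypothesis ShP : forall (t : R) p, 0 <= t -> L_solid R p -> g t = to_manifold p -> Sh t = sheet p.1.1 p.1.2.

Lemma geodesic_rep t : 0 <= t -> g t = to_manifold (rep (Sh t) (Q t).1.1 (Q t).1.2 (Q t).2).
Proof.
move=> t0; have [p [Lp gp [[[m1 m2] m3] ep]]] := geodesic_aligned t0.
rewrite (ShP t0 Lp gp) gp (normal_form Lp (g_nonlattice t0 Lp gp)).
rewrite /rep (_ : frac p.1.1 = frac (Q t).1.1); last by rewrite ep fracDz.
rewrite (_ : frac p.1.2 = frac (Q t).1.2); last by rewrite ep fracDz.
by rewrite (_ : frac p.2 = frac (Q t).2); last by rewrite ep fracDz.
Qed.

(** The integer translations on the two sides of t may differ: the geodesic may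
cross a face at time t. *)
Lemma geodesic_segments t : 0 <= t -> exists2 e : R, 0 < e &
  (exists m : int * int * int, forall s : R, t <= s <= t + e ->
     let p := ((Q s).1.1 + m.1.1%:~R, (Q s).1.2 + m.1.2%:~R, (Q s).2 + m.2%:~R) in
     L_solid R p /\ Sh s = sheet p.1.1 p.1.2) /\
  (exists m : int * int * int, forall s : R, 0 <= s -> t - e <= s <= t ->
     let p := ((Q s).1.1 + m.1.1%:~R, (Q s).1.2 + m.1.2%:~R, (Q s).2 + m.2%:~R) in
     L_solid R p /\ Sh s = sheet p.1.1 p.1.2).
Proof.
move=> t0.
have [p [Lp gp alp]] := geodesic_aligned t0.
have al p' : L_solid R p' -> g t = to_manifold p' -> aligned t p'.
  by move=> Lp' gp'; apply: aligned_eq alp => //; rewrite -gp.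
have fin p' s (m : int * int * int) : 0 <= s ->
    p' = ((Q t).1.1 + m.1.1%:~R, (Q t).1.2 + m.1.2%:~R, (Q t).2 + m.2%:~R) ->
    L_solid R (p' + (s - t) *: u) -> g s = to_manifold (p' + (s - t) *: u) ->
    let p := ((Q s).1.1 + m.1.1%:~R, (Q s).1.2 + m.1.2%:~R, (Q s).2 + m.2%:~R) in
    L_solid R p /\ Sh s = sheet p.1.1 p.1.2.
  move=> s0 ep' Ls gs p1.
  have e1 : p' + (s - t) *: u = p1.
    by rewrite advanceE ep' /p1 /Q /advance/=; congr (_, _, _); ring.
  by rewrite e1 in Ls gs; split => //; exact: ShP.
have [e e0 [pr hr]] := g_right t0.
have [|Lr gr] := hr t; first by rewrite /= in_itv/= lexx lerDl ltW.
rewrite subrr scale0r addr0 in Lr gr.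
have [m em] := al _ Lr gr.
have [t1|t1] := ltP 0 t; last first.
  exists e => //; split; exists m => s.
    move=> ts; have [|Ls gs] := hr s; first by rewrite /= in_itv.
    by apply: (fin pr) => //; move/andP: ts => [? ?]; lra.
  move=> s0 /andP[_ st]; have es : s = t by lra.
  rewrite es; have [|Ls gs] := hr t; first by rewrite /= in_itv/= lexx lerDl ltW.
  by apply: (fin pr).
have [e' e'0 [pl hl]] := g_left t1.
have [|Ll gl] := hl t; first by rewrite /= in_itv/= lexx andbT gerBl ltW.
rewrite subrr scale0r addr0 in Ll gl.
have [m' em'] := al _ Ll gl.
exists (Num.min e e'); first by rewrite lt_min e0.
have mine : Num.min e e' <= e by rewrite ge_min lexx.
have mine' : Num.min e e' <= e' by rewrite ge_min lexx orbT.
split; [exists m => s /andP[s1 s2]|exists m' => s s0 /andP[s1 s2]].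
  have [|Ls gs] := hr s; first by rewrite /= in_itv/= s1/=; lra.
  by apply: (fin pr) => //; lra.
have [|Ls gs] := hl s; first by rewrite /= in_itv/= s2 andbT; lra.
by apply: (fin pl).
Qed.

(** Only faces x = integer are crossed, where the sign and the sheet are negated
together. *)
Lemma level_constant (n : int) (a b : R) : 0 <= a ->
  (forall t, a < t < b -> n%:~R < (Q t).1.2 < n%:~R + 1) ->
  forall s t, a < s < b -> a < t < b ->
    psgn (Q s).1.1 * Sh s = psgn (Q t).1.1 * Sh t.
Proof.
move=> a0 lev; apply: locally_constant_on => t /[dup] tab /andP[at_ tb].
have t0 : 0 <= t by lra.
have [e e0 [[m hm] [m' hm']]] := geodesic_segments t0.
exists e => // s /[dup] sab /andP[as_ sb] /andP[s1 s2].
have key (m0 : int * int * int) r : a < r < b ->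
    let p := ((Q r).1.1 + m0.1.1%:~R, (Q r).1.2 + m0.1.2%:~R, (Q r).2 + m0.2%:~R) in
    L_solid R p /\ Sh r = sheet p.1.1 p.1.2 ->
    psgn (Q r).1.1 * Sh r = (if odd (absz m0.1.1) then -1 else 1) * (if n + m0.1.2 == 0 then 1 else 0).
  move=> rab /= [Lr ->].
  have := psgn_sheet (k := n + m0.1.2) Lr; rewrite psgnDz => <-.
    by case: ifP => _; ring.
  have /andP[l1 l2] := lev _ rab.
  rewrite /= in l1 l2; rewrite intrD; apply/andP; split; lra.
have [st|ts] := leP s t.
  rewrite (key m')//; first by rewrite (key m')//; apply: hm' => //; apply/andP; split; lra.
  by apply: hm'; [lra|rewrite s1].
rewrite (key m)//; first by rewrite (key m)//; apply: hm; apply/andP; split; lra.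
by apply: hm; rewrite s2 ltW.
Qed.

(** As the geodesic avoids the vertical edges, x is not an integer when y is; so
floor x does not change, and the sheet changes by the rule of the y-face. *)
Lemma crossing t : 0 < t -> is_int (Q t).1.2 -> exists2 e : R, 0 < e &
  forall s s', 0 <= s -> t - e <= s < t -> t < s' <= t + e ->
    [/\ Num.floor (Q s).1.1 = Num.floor (Q t).1.1,
        Num.floor (Q s').1.1 = Num.floor (Q t).1.1 &
        flip (Q s).1.2 (Sh s) = flip (Q s').1.2 (Sh s')].
Proof.
move=> t0 yt.
have [e e0 [[m hm] [m' hm']]] := geodesic_segments (ltW t0).
have xt : ~~ is_int (Q t).1.1.
  have [|Lt _] := hm t; first by rewrite lexx lerDl ltW.
  have [p [Lp gp [n ep]]] := geodesic_aligned (ltW t0).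
  have := g_nonlattice (ltW t0) Lp gp; rewrite ep /lattice/= !is_intDz yt andbT.
  by [].
pose X := Num.floor (Q t).1.1.
have X1 : X%:~R < (Q t).1.1.
  rewrite lt_neqAle floor_le andbT; apply: contraNneq xt => <-; exact: is_int_intr.
have X2 := floorD1_gt (Q t).1.1; rewrite intrD -/X in X2.
pose w := Num.min ((Q t).1.1 - X%:~R) (X%:~R + 1 - (Q t).1.1).
have w0 : 0 < w by rewrite lt_min; apply/andP; split; lra.
have w1 : w <= (Q t).1.1 - X%:~R by rewrite ge_min lexx.
have w2 : w <= X%:~R + 1 - (Q t).1.1 by rewrite ge_min lexx orbT.
pose e' := Num.min e (w / (2 * (`|u.1.1| + 1))).
have den0 : 0 < 2 * (`|u.1.1| + 1) by rewrite mulr_gt0// ltr_wpDl.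
exists e'; first by rewrite lt_min e0 divr_gt0.
have e'e : e' <= e by rewrite ge_min lexx.
have e'w : e' * `|u.1.1| < w.
  have : e' <= w / (2 * (`|u.1.1| + 1)) by rewrite ge_min lexx orbT.
  rewrite ler_pdivlMr// => h; have := normr_ge0 u.1.1 => n0.
  have e'0 : 0 < e' by rewrite lt_min e0 divr_gt0.
  by have := mulr_ge0 (ltW e'0) n0; lra.
have inX s : t - e' <= s <= t + e' -> X%:~R < (Q s).1.1 < X%:~R + 1.
  move=> /andP[s1 s2].
  have ds : `|(Q s).1.1 - (Q t).1.1| < w.
    have -> : (Q s).1.1 - (Q t).1.1 = (s - t) * u.1.1 by rewrite /Q /advance/=; ring.
    rewrite normrM; apply: le_lt_trans e'w; rewrite ler_wpM2r// ler_norml.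
    by apply/andP; split; lra.
  by move: ds; rewrite ltr_norml => /andP[? ?]; apply/andP; split; lra.
have key (m0 : int * int * int) r : t - e' <= r <= t + e' ->
    let p := ((Q r).1.1 + m0.1.1%:~R, (Q r).1.2 + m0.1.2%:~R, (Q r).2 + m0.2%:~R) in
    L_solid R p /\ Sh r = sheet p.1.1 p.1.2 ->
    flip (Q r).1.2 (Sh r) =
      let i := if X + m0.1.1 == 0 then 1 else -1 in if odd (absz m0.1.2) then 1 - i else i.
  move=> rab /= [Lr ->].
  have /andP[l1 l2] := inX _ rab; rewrite /= in l1 l2.
  have := flip_sheet (k := X + m0.1.1) Lr; rewrite flipDz => <-; last first.
    by rewrite intrD; apply/andP; split; lra.
  by case: (odd _); rewrite /= ?subKr.
have e'0 : 0 < e' by rewrite lt_min e0 divr_gt0.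
move=> s s' s0 /andP[s1 s2] /andP[s3 s4]; split.
- by apply: floor_def; rewrite intrD; have /andP[/ltW -> ->] := inX s ltac:(apply/andP; split; lra).
- by apply: floor_def; rewrite intrD; have /andP[/ltW -> ->] := inX s' ltac:(apply/andP; split; lra).
- transitivity (flip (Q t).1.2 (Sh t)).
    rewrite (key m'); [|by apply/andP; split; lra|by apply: hm' => //; apply/andP; split; lra].
    rewrite (key m')//; first by apply/andP; split; lra.
    by apply: hm'; [exact: ltW|apply/andP; split; lra].
  rewrite (key m); [|by apply/andP; split; lra|by apply: hm; apply/andP; split; lra].
  rewrite (key m)//; first by apply/andP; split; lra.
  by apply: hm; apply/andP; split; lra.
Qed.

End Coding.

(** * Symbolic coding of a geodesic *)

Section Levels.
Context {R : realType}.
Implicit Types p : R * R * R.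
Variables (g : R -> L_manifold R) (u p0 : R * R * R).
Hypothesis g_right : forall t : R, 0 <= t -> exists2 e : R, 0 < e & exists p, straight_on g u p t `[t, t + e].
Hypothesis g_left : forall t : R, 0 < t -> exists2 e : R, 0 < e & exists p, straight_on g u p t `[t - e, t].
Hypothesis g_nonsing : ~ hits_singularity g.
Hypothesis p0_L : L_solid R p0.
Hypothesis p0_rep : g 0 = to_manifold p0.
Let Q (t : R) := advance u p0 t.
Hypothesis u2 : u.1.2 != 0.
Let d : R := `|u.1.2|^-1.

(** The levels y = integer are crossed at the times T0 + k * d.  In between,
c k = psgn x * sheet is constant by [level_constant].  At a crossing the rule
i -> 1 - i of [crossing] turns psgn x * c k into 1 - psgn x * c k, which is
psgn x * c k.+1. *)
Theorem geodesic_coding : exists T0 : R, exists c : nat -> 'Z_3, 0 < T0 /\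
  (forall k, c k.+1 = psgn (Q (T0 + k.+1%:R * d)).1.1 - c k) /\
  (forall (k : nat) (r : R), 0 < r < d ->
    let q := Q (T0 + k%:R * d + r) in
    frac q.1.2 = (if 0 < u.1.2 then r / d else 1 - r / d) /\
    g (T0 + k%:R * d + r) = to_manifold (rep (psgn q.1.1 * c k) q.1.1 q.1.2 q.2)).
Proof.
have d0 : 0 < d by rewrite invr_gt0 normr_gt0.
pose sg : R := if 0 < u.1.2 then 1 else -1.
have sg2 : sg * sg = 1 by rewrite /sg; case: ifP => _; rewrite ?mulr1// mulrNN mulr1.
have usg : u.1.2 = sg / d.
  rewrite /d invrK /sg; have [up|un] := ltP 0 u.1.2; first by rewrite mul1r gtr0_norm.
  by rewrite mulN1r ler0_norm// opprK.
pose N : int := Num.floor (sg * p0.1.2) + 1.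
(* The first positive time at which y is an integer. *)
pose T0 := d * (N%:~R - sg * p0.1.2).
have T00 : 0 < T0 by rewrite mulr_gt0// subr_gt0 floorD1_gt.
have Qy (k : nat) (r : R) : (Q (T0 + k%:R * d + r)).1.2 = sg * (N%:~R + k%:R + r / d).
  rewrite /Q /advance/= usg /T0 -{1}[p0.1.2]mul1r -sg2; field; exact: lt0r_neq0.
(* The integer part of y between the times T0 + k * d and T0 + k.+1 * d. *)
pose n (k : nat) : int := if 0 < u.1.2 then N + k else - (N + k) - 1.
have Ylev (k : nat) (r : R) : 0 < r < d ->
    (n k)%:~R < (Q (T0 + k%:R * d + r)).1.2 < (n k)%:~R + 1.
  move=> /andP[r0 rd]; rewrite Qy /n /sg.
  have rd1 : r / d < 1 by rewrite ltr_pdivrMr// mul1r.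
  have rd0 : 0 < r / d by rewrite divr_gt0.
  case: ifP => _; rewrite ?intrB ?intrN ?intrD -?pmulrn; apply/andP; split; lra.
have [Sh ShP] := exists_sheet_of_geodesic g_right g_left g_nonsing p0_L p0_rep.
have t_ge0 (k : nat) : 0 <= T0 + k%:R * d by apply: addr_ge0; [exact: ltW|apply: mulr_ge0 => //; exact: ltW].
have tS (k : nat) : T0 + k.+1%:R * d = T0 + k%:R * d + d by rewrite -natr1; ring.
pose C t := psgn (Q t).1.1 * Sh t.
pose c k := C (T0 + k%:R * d + d / 2).
have levC (k : nat) (r : R) : 0 < r < d -> C (T0 + k%:R * d + r) = c k.
  move=> rd; have d20 : 0 < d / 2 by rewrite divr_gt0.
  have := level_constant g_right g_left p0_L p0_rep ShP (n := n k) (t_ge0 k)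
    (b := T0 + k%:R * d + d); apply.
  - move=> t /andP[t1 t2]; have := Ylev k (t - (T0 + k%:R * d)).
    by rewrite subrKC; apply; apply/andP; split; lra.
  - by move/andP: rd => [? ?]; apply/andP; split; lra.
  - by apply/andP; split; lra.
exists T0, c; split => //; split; last first.
  move=> k r rd q; split.
    have := Ylev k r rd; rewrite -/q => /andP[y1 y2].
    have -> : frac q.1.2 = q.1.2 - (n k)%:~R.
      by rewrite /frac (@floor_def _ q.1.2 (n k))// intrD ltW.
    rewrite /q Qy /n /sg; case: ifP => _; rewrite ?intrB ?intrN ?intrD -?pmulrn; ring.
  rewrite -(levC k r rd) /C -/q mulrA psgn_sqr mul1r.
  apply: (geodesic_rep g_right g_left g_nonsing p0_L p0_rep ShP).
  by move/andP: rd => [? ?]; have := t_ge0 k; lra.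
move=> k; set t := T0 + k.+1%:R * d.
have t0 : 0 < t by have := t_ge0 k; rewrite /t tS; lra.
have yint : is_int (Q t).1.2.
  have := Qy k.+1 0; rewrite addr0 -/t mul0r addr0 => ->.
  rewrite pmulrn -intrD /sg; case: ifP => _; first by rewrite mul1r is_int_intr.
  by rewrite mulN1r -intrN is_int_intr.
have [e e0 he] := crossing g_right g_left g_nonsing p0_L p0_rep ShP t0 yint.
pose eta := Num.min e (d / 2).
have eta0 : 0 < eta by rewrite lt_min e0 divr_gt0.
have etae : eta <= e by rewrite ge_min lexx.
have etad : eta <= d / 2 by rewrite ge_min lexx orbT.
have tk := t_ge0 k.
have [||| f1 f2] := he (t - eta) (t + eta).
- by rewrite /t tS; lra.
- by apply/andP; split; lra.
- by apply/andP; split; lra.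
have es : t - eta = T0 + k%:R * d + (d - eta) by rewrite /t tS; ring.
have re : 0 < d - eta < d by apply/andP; split; lra.
have re' : 0 < eta < d by apply/andP; split; lra.
have fl1 : Num.floor (Q (t - eta)).1.2 = n k.
  by apply: floor_def; rewrite es intrD; have /andP[/ltW -> ->] := Ylev k _ re.
have fl2 : Num.floor (Q (t + eta)).1.2 = n k.+1.
  by apply: floor_def; rewrite intrD; have /andP[/ltW -> ->] := Ylev k.+1 _ re'.
have odds : odd (absz (n k.+1)) = ~~ odd (absz (n k)).
  by rewrite /n; case: ifP => _; clear; lia.
rewrite /flip fl1 fl2 odds => fe.
have Se : Sh (t + eta) = 1 - Sh (t - eta).
  by move: fe; case: (odd _) => /= [<-//|->]; rewrite subKr.
rewrite -(levC k _ re) -(levC k.+1 _ re') -/t -es /C Se.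
have -> : psgn (Q (t + eta)).1.1 = psgn (Q t).1.1 by rewrite /psgn f2.
have -> : psgn (Q (t - eta)).1.1 = psgn (Q t).1.1 by rewrite /psgn f1.
by rewrite mulrBr mulr1.
Qed.

End Levels.

(** * Observables in strip coordinates *)

Section Strip.
Context {R : realType}.
Implicit Types p : R * R * R.

(** For d <= 1, two points at distance less than d are separated by one integer at
most, at which the two pieces match. *)
Lemma glued_modulus (h : int -> R -> R) (d e : R) : 0 < e -> d <= 1 ->
  (forall n s s', 0 <= s <= 1 -> 0 <= s' <= 1 -> `|s - s'| < d -> `|h n s - h n s'| < e) ->
  (forall n, h n 1 = h (n + 1) 0) ->
  forall x x' : R, `|x - x'| < d ->
    `|h (Num.floor x) (frac x) - h (Num.floor x') (frac x')| < 2 * e.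
Proof.
move=> e0 d1 mod_h glue x x'; wlog xx' : x x' / x <= x'.
  move=> W; have [xx'|/ltW x'x] := leP x x'; first exact: W.
  by rewrite distrC => h1; rewrite distrC; exact: W.
rewrite distrC ger0_norm ?subr_ge0// => xd.
have [h1 h2] : (Num.floor x)%:~R <= x /\ x < (Num.floor x)%:~R + 1.
  by split; [exact: floor_le|have := floorD1_gt x; rewrite intrD].
have [ff|ff] := eqVneq (Num.floor x') (Num.floor x).
  have : `|frac x - frac x'| < d.
    by rewrite /frac ff distrC opprB addrA subrK ger0_norm// subr_ge0.
  move=> /(mod_h (Num.floor x) _ _ (frac_itvc x) (frac_itvc x')); rewrite ff; lra.
have ff1 : Num.floor x' = Num.floor x + 1.
  apply: floor_def; rewrite !intrD; apply/andP; split; last by lra.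
  rewrite leNgt; apply/negP => h3; move/eqP: ff; apply; apply: floor_def.
  by rewrite intrD; apply/andP; split; lra.
have fx' : frac x' = x' - (Num.floor x)%:~R - 1 by rewrite /frac ff1 intrD; ring.
have fx'0 : 0 <= frac x' by have /andP[] := frac_itv x'.
have u0 : 0 <= (0 : R) <= 1 by rewrite lexx ler01.
have u1 : 0 <= (1 : R) <= 1 by rewrite lexx ler01.
have a1 : `|frac x - 1| < d.
  by have /andP[_ ?] := frac_itv x; rewrite ler0_norm /frac; lra.
have a2 : `|0 - frac x'| < d by rewrite sub0r normrN ger0_norm//; lra.
have b1 := mod_h (Num.floor x) _ _ (frac_itvc x) u1 a1.
have b2 := mod_h (Num.floor x') _ _ u0 (frac_itvc x') a2.
rewrite ff1 -glue in b2.
rewrite ff1 -(subrK (h (Num.floor x) 1) (h (Num.floor x) (frac x))) -addrA.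
by apply: le_lt_trans (ler_normD _ _) _; lra.
Qed.

Variable f : L_manifold R -> R.
Hypothesis f_cont : continuous f.
Let F p := f (to_manifold p).

(** The function f on a strip between two levels y = integer, where
i = psgn x * sheet is constant along a geodesic.  The gluing of the faces
x = integer makes it continuous in x, with period 2. *)
Definition strip (i : 'Z_3) (x y z : R) := F (unfold (psgn x * i) (frac x) y (frac z)).

Lemma strip_modulus (e : R) : 0 < e -> exists2 d : R, 0 < d &
  forall i (x x' y y' z z' : R), 0 <= y <= 1 -> 0 <= y' <= 1 ->
    `|x - x'| < d -> `|y - y'| < d -> `|z - z'| < d ->
    `|strip i x y z - strip i x' y' z'| < e.
Proof.
move=> e0; have e50 : 0 < e / 5 by rewrite divr_gt0.
have [d0 d00 hd] := L_solid_uniform f_cont e50.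
pose d := Num.min d0 1.
have dpos : 0 < d by rewrite lt_min d00 ltr01.
have dd0 : d <= d0 by rewrite ge_min lexx.
have d1 : d <= 1 by rewrite ge_min lexx orbT.
have zero (x : R) : `|x - x| < d0 by rewrite subrr normr0.
exists d => // i x x' y y' z z' y01 y'01 xx' yy' zz'.
pose hx (n : int) s := F (unfold ((if odd (absz n) then -1 else 1) * i) s y (frac z)).
have sx : `|strip i x y z - strip i x' y z| < 2 * (e / 5).
  apply: (@glued_modulus hx d) => // [n s s' s01 s'01 ss'|n].
    apply: hd; [apply: unfold_L => //; exact: frac_itvc..|].
    split => //=; first by rewrite opprD addrACA subrr add0r; lra.
  rewrite /hx /F glue_x//; last exact: frac_itvc.
  by rewrite odd_absz_add addbT -mulNr; case: (odd _); rewrite /= ?opprK.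
have sy : `|strip i x' y z - strip i x' y' z| < e / 5.
  apply: hd; [apply: unfold_L => //; exact: frac_itvc..|].
  by split => //=; rewrite opprD addrACA subrr add0r; lra.
pose hz (n : int) s := F (unfold (psgn x' * i) (frac x') y' s).
have sz : `|strip i x' y' z - strip i x' y' z'| < 2 * (e / 5).
  apply: (@glued_modulus hz d) => // [n s s' s01 s'01 ss'|n].
    apply: hd; [apply: unfold_L => //; exact: frac_itvc..|].
    by split => //=; rewrite opprD addrACA subrr add0r; lra.
  by rewrite /hz /F glue_z//; exact: frac_itvc.
have -> : strip i x y z - strip i x' y' z' = (strip i x y z - strip i x' y z) +
  ((strip i x' y z - strip i x' y' z) + (strip i x' y' z - strip i x' y' z')) by ring.
apply: le_lt_trans (ler_normD _ _) _.
have := ler_normD (strip i x' y z - strip i x' y' z) (strip i x' y' z - strip i x' y' z').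
lra.
Qed.

Lemma strip_perx i x y z : strip i (x + 2) y z = strip i x y z.
Proof.
rewrite /strip -[2]/((2 : int)%:~R) psgnDz/= fracDz//.
Qed.

Lemma strip_perz i x y z : strip i x y (z + 1) = strip i x y z.
Proof. by rewrite /strip -[1]/((1 : int)%:~R) fracDz. Qed.

Lemma strip_sum x y z : \sum_i strip i x y z = \sum_i F (unfold i (frac x) y (frac z)).
Proof.
have inj : injective (fun i : 'Z_3 => psgn x * i).
  by move=> i j h; rewrite -[i]mul1r -[j]mul1r -(psgn_sqr x) -!mulrA h.
by rewrite [RHS](reindex_inj inj).
Qed.

Lemma strip_bounded : exists2 B : R, 0 <= B &
  forall i x y z, 0 <= y <= 1 -> `|strip i x y z| <= B.
Proof.
have [B hB] := L_solid_bounded f_cont; exists B.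
  by apply: le_trans (hB _ (rep_L 0 0 0 0)).
by move=> i x y z y01; apply: hB; apply: unfold_L => //; exact: frac_itvc.
Qed.

Variables (g : R -> L_manifold R) (u : R * R * R).
Hypothesis g_right : forall t : R, 0 <= t -> exists2 e : R, 0 < e & exists p, straight_on g u p t `[t, t + e].
Hypothesis g_left : forall t : R, 0 < t -> exists2 e : R, 0 < e & exists p, straight_on g u p t `[t - e, t].

Lemma segment_continuous (I : set R) p t (e : R) : 0 < e -> I t -> straight_on g u p t I ->
  exists2 r : R, 0 < r & forall s, I s -> `|t - s| < r -> `|f (g t) - f (g s)| < e.
Proof.
move=> e0 It st; have [Lt gt] := st t It.
rewrite subrr scale0r addr0 in Lt gt.
have [r r0 hr] := L_solid_local f_cont e0 Lt.
pose U := `|u.1.1| + `|u.1.2| + `|u.2| + 1.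
have n1 := normr_ge0 u.1.1; have n2 := normr_ge0 u.1.2; have n3 := normr_ge0 u.2.
have [U1 U2 U3 U0] : [/\ `|u.1.1| <= U, `|u.1.2| <= U, `|u.2| <= U & 0 < U].
  by rewrite /U; split; lra.
exists (r / U); first by rewrite divr_gt0.
move=> s Is ts; have [Ls gs] := st s Is; rewrite gt gs; apply: hr => //.
have small (x c : R) : `|c| <= U -> `|x - (x + (s - t) * c)| < r.
  move=> cU; rewrite opprD addNKr normrN normrM distrC.
  apply: le_lt_trans (ler_wpM2l (normr_ge0 _) cU) _.
  by rewrite -ltr_pdivlMr.
by rewrite advanceE; split; exact: small.
Qed.

Lemma geodesic_continuous (T : R) : 0 < T -> {within `[0, T], continuous (f \o g)}.
Proof.
move=> T0; apply/(continuous_within_itvP _ T0).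
have right (t e : R) : 0 <= t -> 0 < e -> exists2 r : R, 0 < r &
    forall s, t <= s -> `|t - s| < r -> `|f (g t) - f (g s)| < e.
  move=> t0 e0; have [e' e'0 [p st]] := g_right t0.
  have [|r r0 hr] := segment_continuous e0 _ st; first by rewrite /= in_itv/= lexx lerDl ltW.
  exists (Num.min r e'); first by rewrite lt_min r0.
  move=> s ts; rewrite lt_min => /andP[sr se]; apply: hr => //.
  by move: se; rewrite ltr_norml => /andP[? ?]; rewrite /= in_itv/=; apply/andP; split; lra.
have left (t e : R) : 0 < t -> 0 < e -> exists2 r : R, 0 < r &
    forall s, s <= t -> `|t - s| < r -> `|f (g t) - f (g s)| < e.
  move=> t0 e0; have [e' e'0 [p st]] := g_left t0.
  have [|r r0 hr] := segment_continuous e0 _ st; first by rewrite /= in_itv/= lexx andbT gerBl ltW.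
  exists (Num.min r e'); first by rewrite lt_min r0.
  move=> s ts; rewrite lt_min => /andP[sr se]; apply: hr => //.
  by move: se; rewrite ltr_norml => /andP[? ?]; rewrite /= in_itv/=; apply/andP; split; lra.
split.
- move=> t; rewrite in_itv/= => /andP[t0 _]; apply/cvgrPdist_lt => e e0.
  have [r r0 hr] := right t e (ltW t0) e0; have [r' r'0 hr'] := left t e t0 e0.
  apply/nbhs_ballP; exists (Num.min r r'); first by rewrite /= lt_min r0.
  move=> s; rewrite /ball/= lt_min => /andP[s1 s2].
  by have [ts|/ltW st] := leP t s; [exact: hr|exact: hr'].
- apply/cvgrPdist_lt => e e0; have [r r0 hr] := right 0 e (lexx 0) e0.
  by rewrite near_withinE; apply/nbhs_ballP; exists r => // s sr /ltW s0; exact: hr.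
- apply/cvgrPdist_lt => e e0; have [r r0 hr] := left T e T0 e0.
  by rewrite near_withinE; apply/nbhs_ballP; exists r => // s sr /ltW sT; exact: hr.
Qed.

End Strip.

(** * Sampling planes *)

Section Sampling.
Context {R : realType}.
Implicit Types p : R * R * R.

Lemma euclidean_norm_gt0 (v : R * R * R) : v.1.2 != 0 -> 0 < euclidean_norm v.
Proof.
move=> v2; rewrite sqrtr_gt0 ltr_wpDr ?sqr_ge0// ltr_wpDl ?sqr_ge0//.
by rewrite exprn_even_gt0.
Qed.

(** The first frequency is halved because the signs have period 2 in x. *)
Lemma kronecker_indep (v : R * R * R) : kronecker_direction v ->
  v.1.2 != 0 /\ forall m n l : int,
    m%:~R * (v.1.1 / `|v.1.2| / 2) + n%:~R * (v.2 / `|v.1.2|) = l%:~R -> m = 0 /\ n = 0.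
Proof.
move=> hv; have v2 : v.1.2 != 0.
  apply/eqP => v0; have [] := hv 0 1 0; last by move=> _ /eqP; rewrite oner_eq0.
  by rewrite v0 rmorph0 !mul0r mulr0 !addr0.
split => // m n l h.
have v20 : `|v.1.2| != 0 by rewrite normr_eq0.
pose sl : int := if 0 <= v.1.2 then - (2 * l) else 2 * l.
have [] := hv m%:~R sl%:~R (2 * n)%:~R.
  rewrite !ratr_int.
  have -> : sl%:~R * v.1.2 = - (2 * l%:~R * `|v.1.2|).
    rewrite /sl; case: ifP => v0; first by rewrite ger0_norm// intrN intrM; ring.
    by rewrite ler0_norm ?intrM; [ring|rewrite ltW// ltNge v0].
  by rewrite intrM -h; field.
move=> /eqP; rewrite intr_eq0 => /eqP m0 _ /eqP; rewrite intr_eq0 mulf_eq0/= => /eqP n0.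
by [].
Qed.

Lemma sum_cells (m : nat) (E : 'I_3 -> 'I_m.+1 -> 'I_m.+1 -> 'I_m.+1 -> R) :
  \sum_(i : 'I_3 * ('I_m.+1 * 'I_m.+1 * 'I_m.+1)) E i.1 i.2.1.1 i.2.1.2 i.2.2 =
  \sum_(b < m.+1) \sum_(a < m.+1) \sum_(c < m.+1) \sum_(i < 3) E i a b c.
Proof.
rewrite -(pair_bigA _ (fun i q => E i q.1.1 q.1.2 q.2))/=.
under eq_bigr => i _.
  rewrite -(pair_bigA _ (fun ab c => E i ab.1 ab.2 c))/=.
  rewrite -(pair_bigA _ (fun a b => \sum_c E i a b c))/= exchange_big/=.
  over.
rewrite exchange_big/=; apply: eq_bigr => b _.
rewrite exchange_big/=; apply: eq_bigr => a _.
by rewrite exchange_big.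
Qed.

Lemma frac_grid (m : nat) (a : 'I_m.+1) : frac (a%:R / m.+1%:R : R) = a%:R / m.+1%:R.
Proof.
apply: frac_id; rewrite divr_ge0//= ltr_pdivrMr// mul1r ltr_nat; exact: ltn_ord.
Qed.

Variable f : L_manifold R -> R.
Hypothesis f_cont : continuous f.
Local Notation F := (fun p => f (to_manifold p)).
Local Notation strip := (strip f).

(** The heights at the midpoints of the time steps, in order of time: they decrease
if the geodesic goes down. *)
Definition height (up : bool) (m : nat) (j : 'I_m.+1) : R :=
  if up then (j%:R + 2^-1) / m.+1%:R else 1 - (j%:R + 2^-1) / m.+1%:R.

Definition slice (m : nat) (y : R) : R := 3^-1 * ((m.+1%:R ^+ 2)^-1 *
  \sum_(a < m.+1) \sum_(c < m.+1) \sum_(i < 3) F (unfold i (a%:R / m.+1%:R) y (c%:R / m.+1%:R))).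

(** One e is the error of the Riemann sum, the other one accounts for slices at the
midpoints instead of the corners of the cells. *)
Lemma slices_integral (up : bool) (m : nat) (e d : R) : 0 < e ->
  (forall p q, L_solid R p -> L_solid R q -> close3 d p q -> `|F p - F q| < e) ->
  m.+1%:R^-1 < d ->
  `|m.+1%:R^-1 * (\sum_(j < m.+1) slice m (height up j)) - 3^-1 * manifold_integral f| <= e + e.
Proof.
move=> e0 hd md.
have n0 : 0 < m.+1%:R :> R by [].
pose low (j : 'I_m.+1) : 'I_m.+1 := if up then j else rev_ord j.
have low_inj : injective low by move=> x y; rewrite /low; case: (up) => //; exact: rev_ord_inj.
have hlow (j : 'I_m.+1) : height up j = ((low j)%:R + 2^-1) / m.+1%:R.
  rewrite /height /low; case: (up) => //=.
  by rewrite natrB ?ltn_ord// -[m.+1%:R]natr1 -[j.+1%:R]natr1; field; rewrite natr1.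
have lowK j : low (low j) = j by rewrite /low; case: (up) => //; exact: rev_ordK.
have hlow' (j : 'I_m.+1) : height up (low j) = (j%:R + 2^-1) / m.+1%:R by rewrite hlow lowK.
have hI (j : 'I_m.+1) : 0 <= ((j%:R + 2^-1) / m.+1%:R : R) <= 1.
  rewrite divr_ge0 ?addr_ge0//= ler_pdivrMr// mul1r.
  have : j.+1%:R <= m.+1%:R :> R by rewrite ler_nat ltn_ord.
  by rewrite -natr1; lra.
have hg (j : 'I_m.+1) : 0 <= (j%:R / m.+1%:R : R) <= 1.
  by rewrite -frac_grid; exact: frac_itvc.
pose E (i : 'I_3) (a b c : 'I_m.+1) := F (unfold i (a%:R / m.+1%:R) (b%:R / m.+1%:R) (c%:R / m.+1%:R)).
have rs : `|manifold_integral f - m.+1%:R^-1 ^+ 3 *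
    \sum_(b < m.+1) \sum_(a < m.+1) \sum_(c < m.+1) \sum_(i < 3) E i a b c| <= 3 * e.
  have unif e' : 0 < e' -> exists2 d' : R, 0 < d' & forall p q, L_solid R p -> L_solid R q ->
      `|p.1.1 - q.1.1| < d' -> `|p.1.2 - q.1.2| < d' -> `|p.2 - q.2| < d' -> `|F p - F q| < e'.
    move=> e'0; have [d' d'0 hd'] := L_solid_uniform f_cont e'0; exists d' => // p q Lp Lq h1 h2 h3.
    exact: hd'.
  have hd3 p q : L_solid R p -> L_solid R q ->
      `|p.1.1 - q.1.1| < d -> `|p.1.2 - q.1.2| < d -> `|p.2 - q.2| < d -> `|F p - F q| < e.
    by move=> Lp Lq h1 h2 h3; exact: hd.
  by rewrite -sum_cells; exact: (integral_riemann_sum (L_solid_bounded f_cont) unif hd3 md).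
have diff : `|m.+1%:R^-1 * (\sum_(j < m.+1) slice m (height up j)) - 3^-1 * (m.+1%:R^-1 ^+ 3 *
    \sum_(b < m.+1) \sum_(a < m.+1) \sum_(c < m.+1) \sum_(i < 3) E i a b c)| <= e.
  rewrite (reindex_inj low_inj)/= /slice -!mulr_sumr.
  set S1 := \sum_j _; set S2 := \sum_j _.
  have -> : m.+1%:R^-1 * (3^-1 * (m.+1%:R ^- 2 * S1)) - 3^-1 * (m.+1%:R^-1 ^+ 3 * S2) =
    3^-1 * m.+1%:R^-1 ^+ 3 * (S1 - S2) by rewrite exprVn; field; rewrite addrC natr1 gt_eqF.
  have c0 : 0 < 3^-1 * m.+1%:R^-1 ^+ 3 :> R by rewrite mulr_gt0// exprn_gt0// invr_gt0.
  rewrite normrM gtr0_norm// -ler_pdivlMl//.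
  have -> : (3^-1 * m.+1%:R^-1 ^+ 3)^-1 * e =
      \sum_(b < m.+1) \sum_(a < m.+1) \sum_(c < m.+1) \sum_(i < 3) e.
    rewrite !sumr_const !card_ord -!mulrnA -[RHS]mulr_natl !natrM exprVn.
    by field; rewrite addrC natr1 gt_eqF.
  rewrite /S1 /S2 -sumrB; apply: le_trans (ler_norm_sum _ _ _) _; apply: ler_sum => b _.
  rewrite -sumrB; apply: le_trans (ler_norm_sum _ _ _) _; apply: ler_sum => a _.
  rewrite -sumrB; apply: le_trans (ler_norm_sum _ _ _) _; apply: ler_sum => c _.
  rewrite -sumrB; apply: le_trans (ler_norm_sum _ _ _) _; apply: ler_sum => i _.
  rewrite hlow'; apply/ltW/hd; [by apply: unfold_L; rewrite ?hI ?hg|by apply: unfold_L; rewrite ?hg|].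
  have d0 : 0 < d by apply: lt_trans md; rewrite invr_gt0.
  rewrite /unfold; split => /=; rewrite ?subrr ?normr0//.
  rewrite opprD addrACA subrr add0r -mulrBl addrAC subrr add0r normrM ger0_norm ?invr_ge0//.
  rewrite ger0_norm ?invr_ge0//; apply: lt_trans md.
  by rewrite gtr_pMl ?invr_gt0//; lra.
move: rs diff; set MI := manifold_integral f; set S := _ ^+ 3 * _; set A := m.+1%:R^-1 * _.
move=> rs diff; have -> : A - 3^-1 * MI = (A - 3^-1 * S) - 3^-1 * (MI - S) by ring.
apply: le_trans (ler_normB _ _) _; rewrite lerD// normrM ger0_norm//.
by rewrite -ler_pdivlMl// invrK.
Qed.

End Sampling.

(** * Averages at a fixed phase *)

Section Phase.
Context {R : realType}.
Variables (alpha beta : R).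
Hypothesis indep : forall m n l : int,
  m%:~R * (alpha / 2) + n%:~R * beta = l%:~R -> m = 0 /\ n = 0.
Variable f : L_manifold R -> R.
Hypothesis f_cont : continuous f.
Local Notation strip := (strip f).

(** Split strip into its mean over the three sheets and a remainder psi with sum 0
over the sheets.  The remainder averages to 0 by [skew_cesaro], and the mean has
period 1 in x, so that [weyl_grid_avg] applies to it. *)
Lemma phase_average (xi zeta y a : R) (c : nat -> 'Z_3) (m : nat) (e d : R) : 0 < e ->
  0 <= y <= 1 ->
  (forall k, c k.+1 = psgn (xi + k%:R * alpha) - c k) ->
  (forall i (x x' y y' z z' : R), 0 <= y <= 1 -> 0 <= y' <= 1 ->
    `|x - x'| < d -> `|y - y'| < d -> `|z - z'| < d ->
    `|strip i x y z - strip i x' y' z'| < e) ->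
  m.+1%:R^-1 < d ->
  \forall N \near \oo,
    `|cesaro (fun k => strip (c k) (xi + k%:R * alpha + a) y (zeta + k%:R * beta)) N -
      slice f m y| <= 3 * e.
Proof.
move=> e0 y01 cS hd md.
have [B B0 hB] := strip_bounded f_cont.
have yy d' : 0 < d' -> `|y - y| < d' by rewrite subrr normr0.
pose H x z := \sum_i strip i (x + a) y z.
pose psi i x z := strip i (x + a) y z - 3^-1 * H x z.
have shift_a (x x' : R) : x + a - (x' + a) = x - x' by ring.
have H_mod (e' d' : R) : 0 < d' -> (forall i (x x' z z' : R), `|x - x'| < d' -> `|z - z'| < d' ->
      `|strip i x y z - strip i x' y z'| < e') ->
    forall (x x' z z' : R), `|x - x'| < d' -> `|z - z'| < d' -> `|H x z - H x' z'| < 3 * e'.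
  move=> d'0 h x x' z z' hx hz; rewrite /H !sum_Z3.
  have hi i := h i (x + a) (x' + a) z z'; rewrite shift_a in hi.
  have := hi 0 hx hz; have := hi 1 hx hz; have := hi (-1) hx hz.
  rewrite !ltr_norml => /andP[? ?] /andP[? ?] /andP[? ?]; apply/andP; split; lra.
have unif e' : 0 < e' -> exists2 d' : R, 0 < d' & forall i (x x' z z' : R),
    `|x - x'| < d' -> `|z - z'| < d' -> `|strip i x y z - strip i x' y z'| < e'.
  move=> e'0; have [d' d'0 hd'] := strip_modulus f_cont e'0; exists d' => // i x x' z z' hx hz.
  by apply: hd' => //; exact: yy.
have Hbnd x z : `|H x z| <= 3 * B.
  rewrite /H sum_Z3; have hi i := hB i (x + a) y z y01.
  have := hi 0; have := hi 1; have := hi (-1).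
  rewrite !ler_norml => /andP[? ?] /andP[? ?] /andP[? ?]; apply/andP; split; lra.
have kron := kronecker_density indep.
have kron' p1 p2 (e' : R) : 0 < e' -> exists r : nat,
    nearZ (r%:R * alpha - p1) e' /\ nearZ (r%:R * beta - p2) e'.
  apply: kronecker_density => m' n' l h; have [|h1 ->] := indep (m := 2 * m') (n := n') (l := l).
    by rewrite -h intrM; field.
  by split => //; move/eqP: h1; rewrite mulf_eq0 => /eqP.
have a_irr (j : nat) (l : int) : (0 < j)%N -> j%:R * alpha != l%:~R.
  move=> j0; apply/eqP => h; have [|h1 _] := indep (m := 2 * j%:Z) (n := 0) (l := l).
    by rewrite mul0r addr0 intrM -h -pmulrn; field.
  by move/eqP: h1; rewrite mulf_eq0/= => /eqP[hj]; move: j0; rewrite hj.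
have dpos : 0 < d by apply: lt_trans md; rewrite invr_gt0.
have psi0 : cesaro (fun k => psi (c k) (xi + k%:R * alpha) (zeta + k%:R * beta)) n @[n --> \oo] --> (0 : R).
  apply: (@skew_cesaro R alpha beta xi zeta a_irr kron psi _ _ _ _ _ c cS).
  - exists (B + B) => i x z; rewrite /psi; apply: le_trans (ler_normB _ _) _.
    rewrite lerD ?hB// normrM ger0_norm// -ler_pdivlMl// invrK; exact: Hbnd.
  - move=> i x z; have sh j : strip j (x + 2 + a) y z = strip j (x + a) y z.
      by rewrite addrAC strip_perx.
    by rewrite /psi /H sh; congr (_ - _ * _); apply: eq_bigr => j _; exact: sh.
  - by move=> i x z; rewrite /psi /H strip_perz; congr (_ - _ * _); apply: eq_bigr => j _; rewrite strip_perz.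
  - move=> e' e'0; have e20 : 0 < e' / 2 by rewrite divr_gt0.
    have [d' d'0 hd'] := unif _ e20; exists d' => // i x x' z z' hx hz.
    have h1 := H_mod _ _ d'0 hd' _ _ _ _ hx hz.
    have h2 := hd' i (x + a) (x' + a) z z'; rewrite shift_a in h2; have {}h2 := h2 hx hz.
    rewrite /psi; move: h1 h2; rewrite !ltr_norml => /andP[? ?] /andP[? ?].
    by apply/andP; split; lra.
  - by move=> x z; rewrite /psi /H !sum_Z3; field.
(* The base point - a of the grid cancels the translation by a in H. *)
have Hw : \forall n \near \oo, `|cesaro (fun k => H (xi + k%:R * alpha) (zeta + k%:R * beta)) n -
    grid_avg H m (- a) 0| <= 3 * e + 3 * e.
  apply: (@weyl_grid_avg R alpha beta xi zeta kron' H _ _ _ _ m (3 * e) d (- a) 0).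
  - by exists (3 * B).
  - move=> x z; rewrite /H !strip_sum.
    by rewrite addrAC -[X in frac (x + a + X)]/((1 : int)%:~R) fracDz.
  - by move=> x z; rewrite /H; apply: eq_bigr => j _; rewrite strip_perz.
  - move=> e' e'0; have e30 : 0 < e' / 3 by rewrite divr_gt0.
    have [d' d'0 hd'] := unif _ e30; exists d' => // x x' z z' hx hz.
    have := H_mod _ _ d'0 hd' _ _ _ _ hx hz; rewrite mulrCA mulfV// mulr1.
    exact.
  - by rewrite mulr_gt0.
  - by apply: H_mod => // i x x' z z' hx hz; apply: hd => //; exact: yy.
  - exact: md.
have grid_slice : 3^-1 * grid_avg H m (- a) 0 = slice f m y.
  rewrite /grid_avg /slice; congr (_ * (_ * _)); apply: eq_bigr => i _; apply: eq_bigr => j _.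
  by rewrite /H strip_sum addrAC addNr !add0r !frac_grid.
move/cvgrPdist_le: psi0 => /(_ e e0) psi0.
near=> N.
have -> : cesaro (fun k => strip (c k) (xi + k%:R * alpha + a) y (zeta + k%:R * beta)) N =
    cesaro (fun k => psi (c k) (xi + k%:R * alpha) (zeta + k%:R * beta)) N +
    3^-1 * cesaro (fun k => H (xi + k%:R * alpha) (zeta + k%:R * beta)) N.
  rewrite -cesaroZ -cesaroD; congr cesaro; apply/funext => k.
  by rewrite /psi subrK.
rewrite -grid_slice -addrA -mulrBr.
have h1 : `|0 - cesaro (fun k => psi (c k) (xi + k%:R * alpha) (zeta + k%:R * beta)) N| <= e.
  by near: N.
rewrite sub0r normrN in h1.
have h2 : `|cesaro (fun k => H (xi + k%:R * alpha) (zeta + k%:R * beta)) N -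
    grid_avg H m (- a) 0| <= 3 * e + 3 * e by near: N.
apply: le_trans (ler_normD _ _) _; rewrite [X in _ + X]normrM [X in _ + X * _]ger0_norm//.
lra.
Unshelve. all: by end_near. Qed.

End Phase.

(** * Uniform distribution *)

Section Steps.
Context {R : realType}.
Implicit Types h s : R.

Lemma step_in_period (i m : nat) h s : 0 < h -> i%:R * h < s < i.+1%:R * h ->
  0 < s - (i %/ m.+1)%:R * (h * m.+1%:R) < h * m.+1%:R.
Proof.
move=> h0; have -> : i%:R = (i %/ m.+1)%:R * m.+1%:R + (i %% m.+1)%:R :> R.
  by rewrite -natrM -natrD -divn_eq.
have : (i %% m.+1).+1%:R * h <= m.+1%:R * h by rewrite ler_pM2r// ler_nat ltn_mod.
rewrite -[i.+1%:R]natr1 [X in _ < _ < (X + 1) * _](_ : _ = (i %/ m.+1)%:R * m.+1%:R + (i %% m.+1)%:R).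
  rewrite -[(_ %% _).+1%:R]natr1; have : 0 <= (i %% m.+1)%:R * h by rewrite mulr_ge0// ltW.
  by move=> j0 jh /andP[s1 s2]; apply/andP; split; lra.
by rewrite -natrM -natrD -divn_eq.
Qed.

Lemma near_midpoint (i : nat) h s : i%:R * h < s < i.+1%:R * h ->
  `|s - (i%:R + 2^-1) * h| < h.
Proof.
rewrite -natr1 mulrDl mul1r => /andP[s1 s2].
by rewrite ltr_norml; apply/andP; split; lra.
Qed.

Lemma midpoint_in_step (i : nat) h : 0 < h -> i%:R * h < (i%:R + 2^-1) * h < i.+1%:R * h.
Proof. by move=> h0; rewrite -[i.+1%:R]natr1 !ltr_pM2r//; apply/andP; split; lra. Qed.

End Steps.

Theorem theorem1 (R : realType) (v : R * R * R) (g : R -> L_manifold R)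
    (hv : kronecker_direction v) (hg : half_infinite_geodesic v g)
    (hsing : ~ hits_singularity g) :
  uniformly_distributed g.
Proof.
move=> f f_cont.
have [v2 indep] := kronecker_indep hv.
move: hg; rewrite /half_infinite_geodesic; set u := _ *: v => -[g_right g_left].
have nv0 : 0 < euclidean_norm v by exact: euclidean_norm_gt0.
have u2E : u.1.2 = (euclidean_norm v)^-1 * v.1.2 by [].
have u2 : u.1.2 != 0 by rewrite u2E mulf_neq0// invr_eq0 gt_eqF.
pose d : R := `|u.1.2|^-1.
have d0 : 0 < d by rewrite invr_gt0 normr_gt0.
have dE : d = euclidean_norm v / `|v.1.2|.
  by rewrite /d u2E normrM ger0_norm ?invr_ge0 ?(ltW nv0)// invfM invrK mulrC.
pose alpha := v.1.1 / `|v.1.2|; pose beta := v.2 / `|v.1.2|.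
have v20 : `|v.1.2| != 0 by rewrite normr_eq0.
have u1E : u.1.1 = (euclidean_norm v)^-1 * v.1.1 by [].
have u3E : u.2 = (euclidean_norm v)^-1 * v.2 by [].
clearbody u.
have du1 : d * u.1.1 = alpha by rewrite dE u1E /alpha; field; rewrite v20 gt_eqF.
have du3 : d * u.2 = beta by rewrite dE u3E /beta; field; rewrite v20 gt_eqF.
have [p0 [p0_L p0_rep]] : exists p0, L_solid R p0 /\ g 0 = to_manifold p0.
  have [e e0 [p st]] := g_right 0 (lexx 0); exists p.
  by have := st 0; rewrite subrr scale0r addr0; apply; rewrite /= in_itv/= lexx add0r ltW.
have [T0 [c [T00 [cS coded]]]] := geodesic_coding g_right g_left hsing p0_L p0_rep u2.
rewrite -/d in cS coded.
pose Q t := advance u p0 t.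
pose height_at (r : R) := if 0 < u.1.2 then r / d else 1 - r / d.
have height_at01 (r : R) : 0 < r < d -> 0 <= height_at r <= 1.
  move=> /andP[r0 rd]; have h1 : r / d < 1 by rewrite ltr_pdivrMr// mul1r.
  have h2 : 0 < r / d by rewrite divr_gt0.
  by rewrite /height_at; case: ifP => _; apply/andP; split; lra.
have G_strip (k : nat) (r : R) : 0 < r < d -> let q := Q (T0 + k%:R * d + r) in
    f (g (T0 + k%:R * d + r)) = strip f (c k) q.1.1 (height_at r) q.2.
  by move=> rd q; have [hy ->] := coded k r rd; rewrite /strip /height_at -hy.
have [B hB] := L_solid_bounded f_cont.
apply: (@time_average R (f \o g) B _ _ T0 d) => //.
- by move=> T T_gt0; exact: (geodesic_continuous f_cont g_right g_left).
- move=> t t0; have [e e0 [p st]] := g_right t t0.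
  by have [|Lp gp] := st t; [rewrite /= in_itv/= lexx lerDl ltW|rewrite /= gp; exact: hB].
- exact: ltW.
move=> e e0; have e30 : 0 < e / 3 by rewrite divr_gt0.
have [d1 d10 hd1] := strip_modulus f_cont e30.
have [d2 d20 hd2] := L_solid_uniform f_cont e30.
(* In a period of length d the coordinates x and z move by at most U. *)
pose U := d * `|u.1.1| + d * `|u.2| + 1.
have [U1 U2 U3 U0] : [/\ 0 < U, d * `|u.1.1| <= U, d * `|u.2| <= U & 1 <= U].
  have h1 : 0 <= d * `|u.1.1| by rewrite mulr_ge0// ltW.
  have h2 : 0 <= d * `|u.2| by rewrite mulr_ge0// ltW.
  by rewrite /U; split; lra.
have [m md] : exists m : nat, m.+1%:R^-1 * U < Num.min d1 d2.
  have z0 : 0 < Num.min d1 d2 / U by rewrite divr_gt0// lt_min d10.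
  exists (Num.truncn (Num.min d1 d2 / U)^-1).
  rewrite -ltr_pdivlMr// -[ltRHS]invrK ltf_pV2 ?posrE ?invr_gt0//.
  by rewrite truncnS_gt.
move: md; rewrite lt_min => /andP[md1 md2].
have n0 : 0 < m.+1%:R :> R by [].
have nV0 : 0 < m.+1%:R^-1 :> R by rewrite invr_gt0.
have mV1 : m.+1%:R^-1 < d1 by apply: le_lt_trans md1; rewrite ler_pMr.
have mV2 : m.+1%:R^-1 < d2 by apply: le_lt_trans md2; rewrite ler_pMr.
set h := d / m.+1%:R.
have h0 : 0 < h by rewrite divr_gt0.
have hd : h * m.+1%:R = d by rewrite /h divfK// gt_eqF.
exists m; split.
- move=> i t; rewrite -/h => /andP[t1 t2].
  pose k := (i %/ m.+1)%N; pose s := t - T0; pose s' := (i%:R + 2^-1) * h.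
  have s_in : i%:R * h < s < i.+1%:R * h by rewrite /s ltrBrDl ltrBlDl t1.
  have in_level (w : R) : i%:R * h < w < i.+1%:R * h -> 0 < w - k%:R * d < d.
    by move=> /(step_in_period m h0); rewrite hd.
  have near_s : `|s - s'| < h by exact: near_midpoint.
  have s'_in := midpoint_in_step i h0; rewrite -/s' in s'_in.
  have rewr (w : R) : T0 + w = T0 + k%:R * d + (w - k%:R * d) by ring.
  have tE : t = T0 + s by rewrite /s; ring.
  rewrite -/s' {1}tE /= (rewr s) (rewr s') !G_strip ?in_level//; apply/ltW.
  apply: lt_le_trans (_ : e / 3 <= e); last by lra.
  have slow (a b : R) : d * `|b| <= U -> `|a + (T0 + s) * b - (a + (T0 + s') * b)| < d1.
    move=> bU; have -> : a + (T0 + s) * b - (a + (T0 + s') * b) = (s - s') * b by ring.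
    rewrite normrM; apply: le_lt_trans md1.
    apply: le_trans (ler_wpM2r (normr_ge0 _) (ltW near_s)) _.
    by rewrite /h mulrAC mulrC ler_pM2l.
  apply: hd1; rewrite ?height_at01 ?in_level// -?(rewr s) -?(rewr s') ?slow//.
  have height_at_lip (a b : R) : `|height_at a - height_at b| = `|a - b| / d.
    rewrite -[in RHS](gtr0_norm d0) -normf_div /height_at; case: ifP => _; first by rewrite -mulrBl.
    by rewrite distrC opprB addrC subrKA -mulrBl.
  rewrite height_at_lip; have -> : s - k%:R * d - (s' - k%:R * d) = s - s' by ring.
  by apply: lt_trans mV1; rewrite ltr_pdivrMr// mulrC.
(* At phase j the geodesic is at a fixed height in its current cube. *)
exists (fun j => slice f m (height (0 < u.1.2) j)); split.
- move=> j; rewrite -/h; pose r : R := (j%:R + 2^-1) * h.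
  have rd : 0 < r < d.
    have := step_in_period m h0 (midpoint_in_step j h0).
    by rewrite divn_small ?ltn_ord// mul0r subr0 hd.
  have rj : height_at r = height (0 < u.1.2) j.
    by rewrite /height_at /height /r -hd; case: ifP => _; congr (_ - _) || idtac; field; rewrite ?natr1 ?gt_eqF.
  have -> : e = 3 * (e / 3) by field.
  have := @phase_average R alpha beta indep f f_cont (Q (T0 + d)).1.1 (Q (T0 + r)).2
    (height (0 < u.1.2) j) ((r - d) * u.1.1) c m (e / 3) d1 e30.
  rewrite -rj => /(_ (height_at01 _ rd)).
  have xE k : (Q (T0 + k.+1%:R * d)).1.1 = (Q (T0 + d)).1.1 + k%:R * alpha.
    by rewrite /Q /advance/= -du1 -[k.+1%:R]natr1; ring.
  have eqG : (fun k => (f \o g) (T0 + k%:R * d + (j%:R + 2^-1) * h)) =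
      (fun k => strip f (c k) ((Q (T0 + d)).1.1 + k%:R * alpha + (r - d) * u.1.1)
         (height_at r) ((Q (T0 + r)).2 + k%:R * beta)).
    apply/funext => k; rewrite /= -/r G_strip// /Q /advance/= -du1 -du3.
    by congr (strip f _ _ _ _); ring.
  by rewrite eqG; apply => // k; rewrite -xE; exact: cS.
- have := @slices_integral R f f_cont (0 < u.1.2) m (e / 3) d2 e30 hd2 mV2.
  by move=> hs; apply: le_trans hs _; lra.
Qed.
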